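(* Let $(A,B,P)$ be a tetrablock contraction on a Hilbert space $\mathcal{H}$ whose fundamental operators $F_1,F_2$ satisfy $[F_1,F_2]=0$ and $[F_1,F_1^*]=[F_2,F_2^*]$, and let $(R_1,R_2,U)$ be the explicit tetrablock unitary dilation of $(A,B,P)$ on $\mathcal{K}=\mathcal{H}\oplus l^2(\mathcal{D}_P)\oplus l^2(\mathcal{D}_{P^*})$ defined in the context. (i) If $(\tilde{R}_1,\tilde{R}_2,U)$ (on the same space $\mathcal{K}$, with the same $U$) is another tetrablock unitary dilation of $(A,B,P)$, then $\tilde{R}_1=R_1$ and $\tilde{R}_2=R_2$. (ii) If $(\tilde{R}_1,\tilde{R}_2,\tilde{U})$ on some Hilbert space $\tilde{\mathcal{K}}$ containing $\mathcal{H}$ is another tetrablock unitary dilation of $(A,B,P)$, where $\tilde{U}$ is a minimal unitary dilation of $P$, then $(\tilde{R}_1,\tilde{R}_2,\tilde{U})$ is unitarily equivalent to $(R_1,R_2,U)$.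
   Context: All Hilbert spaces are complex. The tetrablock is the domain $E=\{(a_{11},a_{22},\det A): A=\begin{pmatrix}a_{11}&a_{12}\\ a_{21}&a_{22}\end{pmatrix},\ \|A\|<1\}\subset\mathbb{C}^3$; $\overline{E}$ is polynomially convex, and $bE$ denotes its distinguished (Shilov) boundary, i.e. the smallest closed subset of $\overline{E}$ on which every function continuous on $\overline{E}$ and holomorphic on $E$ attains its maximum modulus. A triple $(A,B,P)$ of commuting bounded operators on a Hilbert space is a tetrablock contraction if its joint spectrum is contained in $\overline{E}$ and $\|f(A,B,P)\|\le\sup_{\overline{E}}|f|$ for every polynomial $f$ in three variables. Then $P$ is a contraction and $(A^*,B^*,P^* )$ is also a tetrablock contraction. For a contraction $P$ on $\mathcal{H}$: $D_P=(I-P^*P)^{1/2}$, $D_{P^*}=(I-PP^* )^{1/2}$, $\mathcal{D}_P=\overline{\mathrm{Ran}}\,D_P$, $\mathcal{D}_{P^*}=\overline{\mathrm{Ran}}\,D_{P^*}$. Fundamental operators of a tetrablock contraction $(A,B,P)$: the (known to exist and be unique) bounded operators $F_1,F_2$ on $\mathcal{D}_P$ with $A-B^*P=D_PF_1D_P$ and $B-A^*P=D_PF_2D_P$. Correspondingly, the fundamental operators $G_1,G_2\in\mathcal{B}(\mathcal{D}_{P^*})$ of $(A^*,B^*,P^* )$ satisfy $A^*-BP^*=D_{P^*}G_1D_{P^*}$ and $B^*-AP^*=D_{P^*}G_2D_{P^*}$. Notation: $[X,Y]=XY-YX$; $l^2(\mathcal{E})$ is the space of square-summable sequences $(a_0,a_1,\dots)$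 in $\mathcal{E}$. A tetrablock unitary is a triple of commuting bounded normal operators whose Taylor joint spectrum is contained in $bE$. A tetrablock unitary dilation of $(A,B,P)$ on $\mathcal{H}$ is a tetrablock unitary $(N_1,N_2,N_3)$ on a Hilbert space $\mathcal{K}\supseteq\mathcal{H}$ such that $A^mB^nP^l=P_{\mathcal{H}}N_1^mN_2^nN_3^l|_{\mathcal{H}}$ for all integers $m,n,l\ge0$, where $P_{\mathcal{H}}$ is the orthogonal projection onto $\mathcal{H}$. A unitary $\tilde U$ on $\tilde{\mathcal K}\supseteq\mathcal{H}$ is a minimal unitary dilation of $P$ if $P^m=P_{\mathcal{H}}\tilde U^m|_{\mathcal{H}}$ for all $m\ge0$ and $\tilde{\mathcal K}=\overline{\mathrm{span}}\{\tilde U^mh:h\in\mathcal{H},\,m\in\mathbb{Z}\}$. Two triples $(X_1,X_2,X_3)$ on $\mathcal{K}_1$ and $(Y_1,Y_2,Y_3)$ on $\mathcal{K}_2$ are unitarily equivalent if there is a unitary $W:\mathcal{K}_1\to\mathcal{K}_2$ with $WX_iW^*=Y_i$ for $i=1,2,3$. The explicit dilation $(R_1,R_2,U)$: let $\tilde{\mathcal{H}}=\mathcal{H}\oplus l^2(\mathcal{D}_P)$ (with $\mathcal{H}$ identified with the first summand), $\mathcal{K}=\tilde{\mathcal{H}}\oplus l^2(\mathcal{D}_{P^*})$. Define on $\tilde{\mathcal{H}}$ $$V_1(h\oplus(a_0,a_1,\dots))=Ah\oplus(F_2^*D_Ph+F_1a_0,F_2^*a_0+F_1a_1,F_2^*a_1+F_1a_2,\dots),$$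 $$V_2(h\oplus(a_0,a_1,\dots))=Bh\oplus(F_1^*D_Ph+F_2a_0,F_1^*a_0+F_2a_1,F_1^*a_1+F_2a_2,\dots),$$ $$V_3(h\oplus(a_0,a_1,\dots))=Ph\oplus(D_Ph,a_0,a_1,\dots);$$ define $C_1,C_2,C_3:l^2(\mathcal{D}_{P^*})\to\tilde{\mathcal{H}}$ by $$C_1(a_0,a_1,\dots)=D_{P^*}G_2a_0\oplus(-F_2^*P^*a_0,0,\dots),\quad C_2(a_0,a_1,\dots)=D_{P^*}G_1a_0\oplus(-F_1^*P^*a_0,0,\dots),$$ $$C_3(a_0,a_1,\dots)=D_{P^*}a_0\oplus(-P^*a_0,0,\dots);$$ and $D_1,D_2,D_3$ on $l^2(\mathcal{D}_{P^*})$ by $$D_1(a_0,a_1,\dots)=(G_1^*a_0+G_2a_1,G_1^*a_1+G_2a_2,\dots),\quad D_2(a_0,a_1,\dots)=(G_2^*a_0+G_1a_1,G_2^*a_1+G_1a_2,\dots),$$ $$D_3(a_0,a_1,\dots)=(a_1,a_2,\dots).$$ Then, with respect to $\mathcal{K}=\tilde{\mathcal{H}}\oplus l^2(\mathcal{D}_{P^*})$, $$R_1=\begin{pmatrix}V_1&C_1\\0&D_1\end{pmatrix},\quad R_2=\begin{pmatrix}V_2&C_2\\0&D_2\end{pmatrix},\quad U=\begin{pmatrix}V_3&C_3\\0&D_3\end{pmatrix}.$$ *)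

(* Defs.v *)
From Stdlib Require Import Reals Lra List Classical ClassicalEpsilon
  FunctionalExtensionality PropExtensionality ProofIrrelevance.
From Coquelicot Require Import Coquelicot.

Set Implicit Arguments.
Unset Strict Implicit.
Open Scope R_scope.

(** The inner product is linear in its first argument. *)
Record Hilbert : Type := MakeHilbert {
  hcarrier :> CompleteNormedModule C_AbsRing;
  inner : hcarrier -> hcarrier -> C;
  inner_plus_l : forall x y z, inner (plus x y) z = (inner x z + inner y z)%C;
  inner_scal_l : forall (c : C) x y, inner (scal c x) y = (c * inner x y)%C;
  inner_conj : forall x y, inner y x = Cconj (inner x y);
  inner_norm : forall x, inner x x = RtoC (norm x ^ 2) }.

Record inner_product (V : ModuleSpace C_Ring) (ip : V -> V -> C) : Prop := InnerProduct {
  ip_plus_l : forall x y z, ip (plus x y) z = (ip x z + ip y z)%C;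
  ip_scal_l : forall (c : C) x y, ip (scal c x) y = (c * ip x y)%C;
  ip_conj : forall x y, ip y x = Cconj (ip x y);
  ip_ge0 : forall x, 0 <= Re (ip x x);
  ip_eq0 : forall x, Re (ip x x) = 0 -> x = zero }.

Definition ip_norm (V : ModuleSpace C_Ring) (ip : V -> V -> C) (x : V) : R :=
  sqrt (Re (ip x x)).

Section OfInnerProduct.

Variables (V : ModuleSpace C_Ring) (ip : V -> V -> C).
Hypothesis ax : inner_product ip.

Local Notation nrm := (ip_norm ip).

Lemma ip_plus_r x y z : ip x (plus y z) = (ip x y + ip x z)%C.
Proof.
rewrite (ip_conj ax (plus y z) x), (ip_plus_l ax), Cplus_conj.
now rewrite <- !(ip_conj ax).
Qed.

Lemma ip_scal_r (c : C) x y : ip x (scal c y) = (Cconj c * ip x y)%C.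
Proof.
rewrite (ip_conj ax (scal c y) x), (ip_scal_l ax), Cmult_conj.
now rewrite <- !(ip_conj ax).
Qed.

Lemma ip_self x : ip x x = RtoC (Re (ip x x)).
Proof.
pose proof (ip_conj ax x x) as h.
destruct (ip x x) as [a b]; unfold Cconj in h; simpl in h; injection h; intros h1.
unfold RtoC; simpl; f_equal; lra.
Qed.

Lemma ip_norm_sqr x : (nrm x) ^ 2 = Re (ip x x).
Proof. unfold ip_norm; apply pow2_sqrt, (ip_ge0 ax). Qed.

Lemma ip_norm_ge0 x : 0 <= nrm x.
Proof. apply sqrt_pos. Qed.

Lemma ip_CS2 x y : Cmod (ip x y) ^ 2 <= Re (ip x x) * Re (ip y y).
Proof.
set (a := Re (ip x x)); set (b := Re (ip y y)).
destruct (Req_dec b 0) as [b0 | bn0].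
- assert (y0 : y = scal (RtoC 0) y).
  { rewrite (ip_eq0 ax b0); symmetry; apply scal_zero_r. }
  assert (h : ip x y = RtoC 0).
  { rewrite y0, ip_scal_r; unfold Cconj, RtoC; simpl.
    apply injective_projections; simpl; ring. }
  rewrite h, Cmod_0, b0; lra.
- assert (bpos : 0 < b) by (pose proof (ip_ge0 ax y); unfold b in *; lra).
  pose proof (ip_ge0 ax (plus (scal (RtoC b) x) (scal (- ip x y)%C y))) as h.
  rewrite (ip_plus_l ax), !ip_plus_r, !(ip_scal_l ax), !ip_scal_r in h.
  rewrite (ip_conj ax x y) in h.
  rewrite (ip_self x), (ip_self y) in h; fold a b in h.
  rewrite Cmod2_alt; destruct (ip x y) as [u v].
  unfold Cconj, Copp, Cmult, Cplus, RtoC, Re, Im in *; simpl in *.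
  assert (0 <= b * (a * b - (u * (u * 1) + v * (v * 1)))).
  { eapply Rle_trans; [exact h |]; right; ring. }
  assert (0 <= a * b - (u * (u * 1) + v * (v * 1))).
  { apply Rmult_le_reg_l with b; [exact bpos | now rewrite Rmult_0_r]. }
  lra.
Qed.

Lemma ip_CS x y : Cmod (ip x y) <= nrm x * nrm y.
Proof.
apply Rsqr_incr_0_var; [| apply Rmult_le_pos; apply ip_norm_ge0].
unfold Rsqr.
pose proof (ip_CS2 x y) as h.
rewrite <- !ip_norm_sqr in h; nra.
Qed.

Lemma ip_triangle x y : nrm (plus x y) <= nrm x + nrm y.
Proof.
apply Rsqr_incr_0_var;
  [| apply Rplus_le_le_0_compat; apply ip_norm_ge0].
unfold Rsqr.
assert (h : nrm (plus x y) ^ 2 = nrm x ^ 2 + nrm y ^ 2 + 2 * Re (ip x y)).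
{ rewrite !ip_norm_sqr, (ip_plus_l ax), !ip_plus_r, (ip_conj ax x y).
  destruct (ip x y), (ip x x), (ip y y); simpl; ring. }
pose proof (ip_CS x y).
pose proof (re_le_Cmod (ip x y)).
pose proof (Rle_abs (Re (ip x y))).
nra.
Qed.

Lemma ip_norm_scal (c : C) x : nrm (scal c x) = Cmod c * nrm x.
Proof.
unfold ip_norm.
rewrite (ip_scal_l ax), ip_scal_r, (ip_self x).
rewrite <- (sqrt_pow2 (Cmod c)) by apply Cmod_ge_0.
rewrite <- sqrt_mult_alt by apply pow2_ge_0.
f_equal.
rewrite Cmod2_alt; destruct c; simpl; ring.
Qed.

Lemma ip_norm_zero : nrm zero = 0.
Proof.
pose proof (ip_norm_scal (RtoC 0) zero) as h.
rewrite (scal_zero_r (RtoC 0 : C_Ring) : scal (RtoC 0) (zero : V) = zero) in h.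
refine (eq_trans h _); rewrite Cmod_0; ring.
Qed.

Lemma ip_norm_opp x : nrm (opp x) = nrm x.
Proof.
rewrite <- (scal_opp_one x), ip_norm_scal.
change (Cmod (- RtoC 1)%C * nrm x = nrm x).
rewrite Cmod_opp, Cmod_1; ring.
Qed.

Definition ip_ball (x : V) (e : R) (y : V) : Prop := nrm (minus y x) < e.

Lemma ip_ball_center x (e : posreal) : ip_ball x e x.
Proof.
unfold ip_ball; rewrite minus_eq_zero.
eapply Rle_lt_trans; [right; exact ip_norm_zero | apply cond_pos].
Qed.

Lemma ip_ball_sym x y e : ip_ball x e y -> ip_ball y e x.
Proof. unfold ip_ball; now rewrite <- (ip_norm_opp (minus y x)), opp_minus. Qed.

Lemma ip_ball_triangle x y z e1 e2 :
  ip_ball x e1 y -> ip_ball y e2 z -> ip_ball x (e1 + e2) z.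
Proof.
unfold ip_ball; intros h1 h2.
rewrite (minus_trans y z x).
eapply Rle_lt_trans; [apply ip_triangle | lra].
Qed.

Definition ip_UniformSpace_mixin : UniformSpace.mixin_of V :=
  UniformSpace.Mixin V zero ip_ball ip_ball_center ip_ball_sym ip_ball_triangle.

Definition ip_NormedModuleAux : NormedModuleAux C_AbsRing :=
  NormedModuleAux.Pack C_AbsRing V
    (NormedModuleAux.Class C_AbsRing V (ModuleSpace.class C_Ring V)
       ip_UniformSpace_mixin) V.

Lemma ip_compat2 (x y : V) (e : posreal) : ip_ball x e y -> nrm (minus y x) < 1 * e.
Proof. unfold ip_ball; lra. Qed.

Lemma ip_norm_scal_le (c : C) (x : V) : nrm (scal c x) <= Cmod c * nrm x.
Proof. right; apply ip_norm_scal. Qed.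

Lemma ip_norm_eq0 x : nrm x = 0 -> x = zero.
Proof.
intros h; apply (ip_eq0 ax); rewrite <- ip_norm_sqr, h; ring.
Qed.

Definition ip_NormedModule_mixin : NormedModule.mixin_of C_AbsRing ip_NormedModuleAux :=
  NormedModule.Mixin C_AbsRing ip_NormedModuleAux nrm 1
    ip_triangle ip_norm_scal_le (fun _ _ _ h => h) ip_compat2 ip_norm_eq0.

Definition ip_NormedModule : NormedModule C_AbsRing :=
  NormedModule.Pack C_AbsRing V
    (NormedModule.Class C_AbsRing V (NormedModuleAux.class C_AbsRing ip_NormedModuleAux)
       ip_NormedModule_mixin) V.

Hypothesis compl : forall u : nat -> V,
  (forall e : posreal, exists N, forall n m, (N <= n)%nat -> (N <= m)%nat ->
     ip_ball (u n) e (u m)) ->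
  exists x, forall e : posreal, exists N, forall n, (N <= n)%nat -> ip_ball x e (u n).

Definition ip_lim (F : (V -> Prop) -> Prop) : V :=
  epsilon (inhabits zero) (fun x => forall e : posreal, F (ip_ball x e)).

Lemma ip_complete (F : (V -> Prop) -> Prop) :
  ProperFilter F -> (forall e : posreal, exists x, F (ip_ball x e)) ->
  forall e : posreal, F (ip_ball (ip_lim F) e).
Proof.
intros FF Fc.
unfold ip_lim; apply epsilon_spec.
assert (ipos : forall n : nat, 0 < / INR (S n)).
{ intros n; apply Rinv_0_lt_compat, lt_0_INR, Nat.lt_0_succ. }
set (d n := mkposreal _ (ipos n)).
set (u n := epsilon (inhabits zero) (fun x => F (ip_ball x (d n)))).
assert (hu : forall n, F (ip_ball (u n) (d n))).
{ intros n; unfold u; apply epsilon_spec, Fc. }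
assert (small : forall e : posreal, exists N, forall n, (N <= n)%nat -> d n < e).
{ intros e.
  destruct (archimed_cor1 e (cond_pos e)) as [N [h1 h2]].
  exists N; intros n hn; change (/ INR (S n) < e).
  eapply Rle_lt_trans; [| exact h1].
  apply Rinv_le_contravar; [now apply lt_0_INR |].
  apply le_INR; auto. }
assert (half : forall e : posreal, 0 < e / 2).
{ intros e; pose proof (cond_pos e); lra. }
destruct (compl (u := u)) as [x hx].
- intros e; destruct (small (mkposreal _ (half e))) as [N hN]; exists N.
  intros n m hn hm.
  destruct (filter_ex _ (filter_and _ _ (hu n) (hu m))) as [y [y1 y2]].
  pose proof (hN n hn); pose proof (hN m hm); simpl in H, H0.
  pose proof (ip_ball_triangle y1 (ip_ball_sym y2)) as h.
  unfold ip_ball in *; simpl in *; lra.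
- exists x; intros e.
  destruct (small (mkposreal _ (half e))) as [N1 h1].
  destruct (hx (mkposreal _ (half e))) as [N2 h2].
  pose proof (h1 (max N1 N2) (Nat.le_max_l _ _)) as k1.
  pose proof (h2 (max N1 N2) (Nat.le_max_r _ _)) as k2.
  apply filter_imp with (2 := hu (max N1 N2)).
  intros y hy.
  pose proof (ip_ball_triangle k2 hy) as h.
  unfold ip_ball in *; simpl in *; lra.
Qed.

Lemma ip_lim_close (F1 F2 : (V -> Prop) -> Prop) :
  filter_le F1 F2 -> filter_le F2 F1 ->
  forall e : posreal, ip_ball (ip_lim F1) e (ip_lim F2).
Proof.
intros h1 h2 e.
replace F2 with F1; [apply ip_ball_center |].
apply functional_extensionality; intros Q; apply propositional_extensionality.
split; [apply h2 | apply h1].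
Qed.

Definition ip_CompleteSpace_mixin :
  CompleteSpace.mixin_of (NormedModule.UniformSpace C_AbsRing ip_NormedModule) :=
  CompleteSpace.Mixin (NormedModule.UniformSpace C_AbsRing ip_NormedModule)
    ip_lim ip_complete ip_lim_close.

Definition ip_CompleteNormedModule : CompleteNormedModule C_AbsRing :=
  CompleteNormedModule.Pack C_AbsRing V
    (CompleteNormedModule.Class C_AbsRing V (NormedModule.class C_AbsRing ip_NormedModule)
       ip_CompleteSpace_mixin) V.

Lemma ip_inner_norm (x : V) : ip x x = RtoC (nrm x ^ 2).
Proof. rewrite ip_norm_sqr; apply ip_self. Qed.

Definition Hilbert_of_inner_product : Hilbert :=
  @MakeHilbert ip_CompleteNormedModule ip (ip_plus_l ax) (ip_scal_l ax) (ip_conj ax)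
    ip_inner_norm.

End OfInnerProduct.

Lemma inner_product_Hilbert (H : Hilbert) : inner_product (@inner H).
Proof.
split; [apply inner_plus_l | apply inner_scal_l | apply inner_conj | |];
  intros x; rewrite inner_norm; simpl.
- change (0 <= norm x ^ 2); apply pow2_ge_0.
- change (norm x ^ 2 = 0 -> x = zero); intros h.
  apply (@norm_eq_zero C_AbsRing H x); rewrite <- Rsqr_pow2 in h; now apply Rsqr_0_uniq.
Qed.

Lemma ip_norm_Hilbert (H : Hilbert) (x : H) : ip_norm (@inner H) x = norm x.
Proof.
unfold ip_norm; rewrite inner_norm.
change (sqrt (norm x ^ 2) = norm x); apply sqrt_pow2, norm_ge_0.
Qed.

(** The norm is Coquelicot's [prod_norm], the Euclidean combination of the two norms. *)
Section DirectSum.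

Variables H K : Hilbert.

Definition hsum_lim (F : (H * K -> Prop) -> Prop) : H * K :=
  (lim (filtermap fst F), lim (filtermap snd F)).

Lemma hsum_complete (F : (H * K -> Prop) -> Prop) :
  ProperFilter F -> cauchy F -> forall e : posreal, F (ball (hsum_lim F) e).
Proof.
intros FF Fc e.
apply filter_and.
- apply (complete_cauchy (filtermap fst F) (@filtermap_proper_filter _ _ fst F FF)).
  intros d; destruct (Fc d) as [[x y] hxy]; exists x.
  apply filter_imp with (2 := hxy); now intros z [].
- apply (complete_cauchy (filtermap snd F) (@filtermap_proper_filter _ _ snd F FF)).
  intros d; destruct (Fc d) as [[x y] hxy]; exists y.
  apply filter_imp with (2 := hxy); now intros z [].
Qed.

Lemma hsum_lim_close (F1 F2 : (H * K -> Prop) -> Prop) :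
  filter_le F1 F2 -> filter_le F2 F1 -> close (hsum_lim F1) (hsum_lim F2).
Proof.
intros h1 h2 e; split.
- apply (close_lim (filtermap fst F1) (filtermap fst F2)); intros Q hQ;
    [now apply h1 | now apply h2].
- apply (close_lim (filtermap snd F1) (filtermap snd F2)); intros Q hQ;
    [now apply h1 | now apply h2].
Qed.

Definition hsum_CompleteNormedModule : CompleteNormedModule C_AbsRing :=
  CompleteNormedModule.Pack C_AbsRing (H * K)
    (CompleteNormedModule.Class C_AbsRing (H * K)
       (NormedModule.class C_AbsRing (prod_NormedModule C_AbsRing H K))
       (CompleteSpace.Mixin (prod_UniformSpace H K)
          hsum_lim hsum_complete hsum_lim_close)) (H * K).

Definition hsum_inner (x y : H * K) : C :=
  (inner (fst x) (fst y) + inner (snd x) (snd y))%C.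

Lemma hsum_inner_plus_l (x y z : hsum_CompleteNormedModule) :
  hsum_inner (plus x y) z = (hsum_inner x z + hsum_inner y z)%C.
Proof.
unfold hsum_inner; simpl; rewrite !inner_plus_l.
match goal with |- ((?a + ?b) + (?c + ?d) = _)%C =>
  change ((a + b) + (c + d) = (a + c) + (b + d))%C end; ring.
Qed.

Lemma hsum_inner_scal_l (c : C) (x y : hsum_CompleteNormedModule) :
  hsum_inner (scal c x) y = (c * hsum_inner x y)%C.
Proof. unfold hsum_inner; simpl; rewrite !inner_scal_l; ring. Qed.

Lemma hsum_inner_conj (x y : hsum_CompleteNormedModule) :
  hsum_inner y x = Cconj (hsum_inner x y).
Proof. unfold hsum_inner; now rewrite Cplus_conj, <- !inner_conj. Qed.

Lemma hsum_inner_norm (x : hsum_CompleteNormedModule) :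
  hsum_inner x x = RtoC (norm x ^ 2).
Proof.
unfold hsum_inner; rewrite !inner_norm, <- RtoC_plus; f_equal; symmetry.
apply pow2_sqrt, Rplus_le_le_0_compat; apply pow2_ge_0.
Qed.

Definition hsum : Hilbert :=
  @MakeHilbert hsum_CompleteNormedModule hsum_inner hsum_inner_plus_l
    hsum_inner_scal_l hsum_inner_conj hsum_inner_norm.

End DirectSum.

Section Subspace.

Variables (H : Hilbert) (S : H -> Prop).
Hypotheses (S_zero : S zero) (S_plus : forall x y, S x -> S y -> S (plus x y))
  (S_scal : forall (c : C) x, S x -> S (scal c x)) (S_closed : closed S).

Local Notation T := {x : H | S x}.

Lemma sub_eq (x y : T) : proj1_sig x = proj1_sig y -> x = y.
Proof. apply eq_sig_hprop; intros; apply proof_irrelevance. Qed.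

Lemma sub_opp_in x : S x -> S (opp x).
Proof. intros h; exact (eq_ind _ S (S_scal (opp (one : C_Ring)) h) _ (scal_opp_one x)). Qed.

Definition sub_plus (x y : T) : T :=
  exist S (plus (proj1_sig x) (proj1_sig y)) (S_plus (proj2_sig x) (proj2_sig y)).
Definition sub_zero : T := exist S zero S_zero.
Definition sub_opp (x : T) : T :=
  exist S (opp (proj1_sig x)) (sub_opp_in (proj2_sig x)).
Definition sub_scal (c : C) (x : T) : T :=
  exist S (scal c (proj1_sig x)) (S_scal c (proj2_sig x)).

Lemma sub_plusC x y : sub_plus x y = sub_plus y x.
Proof. apply sub_eq, plus_comm. Qed.
Lemma sub_plusA x y z : sub_plus x (sub_plus y z) = sub_plus (sub_plus x y) z.
Proof. apply sub_eq, plus_assoc. Qed.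
Lemma sub_plus0 x : sub_plus x sub_zero = x.
Proof. apply sub_eq, plus_zero_r. Qed.

Definition sub_AbelianMonoid : AbelianMonoid :=
  AbelianMonoid.Pack T
    (AbelianMonoid.Mixin T sub_plus sub_zero sub_plusC sub_plusA sub_plus0) T.

Lemma sub_plusN (x : sub_AbelianMonoid) : plus x (sub_opp x) = zero.
Proof. apply sub_eq; exact (plus_opp_r (proj1_sig x)). Qed.

Definition sub_AbelianGroup : AbelianGroup :=
  AbelianGroup.Pack T
    (AbelianGroup.Class T (AbelianMonoid.class sub_AbelianMonoid)
       (AbelianGroup.Mixin sub_AbelianMonoid sub_opp sub_plusN)) T.

Lemma sub_scalA (c d : C_Ring) (x : sub_AbelianGroup) :
  sub_scal c (sub_scal d x) = sub_scal (mult c d) x.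
Proof. apply sub_eq; exact (scal_assoc c d (proj1_sig x)). Qed.
Lemma sub_scal1 (x : sub_AbelianGroup) : sub_scal (one : C_Ring) x = x.
Proof. apply sub_eq; exact (scal_one (proj1_sig x)). Qed.
Lemma sub_scalDr (c : C_Ring) (x y : sub_AbelianGroup) :
  sub_scal c (plus x y) = plus (sub_scal c x : sub_AbelianGroup) (sub_scal c y).
Proof. apply sub_eq; exact (scal_distr_l c (proj1_sig x) (proj1_sig y)). Qed.
Lemma sub_scalDl (c d : C_Ring) (x : sub_AbelianGroup) :
  sub_scal (plus c d) x = plus (sub_scal c x : sub_AbelianGroup) (sub_scal d x).
Proof. apply sub_eq; exact (scal_distr_r c d (proj1_sig x)). Qed.

Definition sub_ModuleSpace : ModuleSpace C_Ring :=
  ModuleSpace.Pack C_Ring T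
    (ModuleSpace.Class C_Ring T (AbelianGroup.class sub_AbelianGroup)
       (ModuleSpace.Mixin C_Ring sub_AbelianGroup sub_scal sub_scalA sub_scal1
          sub_scalDr sub_scalDl)) T.

Definition sub_inner (x y : T) : C := inner (proj1_sig x) (proj1_sig y).

Lemma sub_inner_product : inner_product (V := sub_ModuleSpace) sub_inner.
Proof.
destruct (inner_product_Hilbert H) as [h1 h2 h3 h4 h5].
split; unfold sub_inner; intros.
- apply h1.
- apply h2.
- apply h3.
- apply h4.
- apply sub_eq; exact (h5 _ H0).
Qed.

Lemma sub_ballE (x y : T) e :
  ip_ball (V := sub_ModuleSpace) sub_inner x e y <->
  norm (minus (proj1_sig y) (proj1_sig x)) < e.
Proof. rewrite <- ip_norm_Hilbert; reflexivity. Qed.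

Lemma Hilbert_cauchy_seq (u : nat -> H) :
  (forall e : posreal, exists N, forall n m, (N <= n)%nat -> (N <= m)%nat ->
     norm (minus (u m) (u n)) < e) ->
  exists x, forall e : posreal, exists N, forall n, (N <= n)%nat ->
     norm (minus (u n) x) < e.
Proof.
intros hu.
assert (h : exists x : H, filterlim u eventually (locally x)).
{ apply (filterlim_locally_cauchy (U := CompleteNormedModule.CompleteSpace C_AbsRing H)
           (F := eventually)).
  intros e; destruct (hu e) as [N hN].
  exists (fun n => (N <= n)%nat); split; [now exists N |].
  intros n m hn hm; apply (@norm_compat1 C_AbsRing H); now apply hN. }
destruct h as [x hx]; exists x; intros e.
exact (hx _ (locally_le_locally_norm x _ (ex_intro _ e (fun y h => h)))).
Qed.

Lemma sub_complete (u : nat -> T) :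
  (forall e : posreal, exists N, forall n m, (N <= n)%nat -> (N <= m)%nat ->
     ip_ball (V := sub_ModuleSpace) sub_inner (u n) e (u m)) ->
  exists x, forall e : posreal, exists N, forall n, (N <= n)%nat ->
     ip_ball (V := sub_ModuleSpace) sub_inner x e (u n).
Proof.
intros hu.
destruct (@Hilbert_cauchy_seq (fun n => proj1_sig (u n))) as [x hx].
{ intros e; destruct (hu e) as [N hN]; exists N; intros n m hn hm.
  now apply sub_ballE, hN. }
assert (Sx : S x).
{ apply S_closed; intros [e he].
  destruct (hx e) as [N hN]; specialize (hN N (le_n N)).
  exact (he _ (@norm_compat1 C_AbsRing H _ _ _ hN) (proj2_sig (u N))). }
exists (exist S x Sx); intros e; destruct (hx e) as [N hN]; exists N.
intros n hn; now apply sub_ballE, hN.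
Qed.

Definition subHilbert : Hilbert := Hilbert_of_inner_product sub_inner_product sub_complete.

End Subspace.

Record l2_seq (E : Hilbert) : Type := L2Seq {
  l2_fun :> nat -> E;
  l2_summable : ex_series (fun n => norm (l2_fun n) ^ 2) }.

Lemma sum_nS (a : nat -> R) n : sum_n a (S n) = sum_n a n + a (S n).
Proof. exact (sum_Sn a n). Qed.

Lemma ex_series_pos_le (a b : nat -> R) :
  (forall n, 0 <= a n <= b n) -> ex_series b -> ex_series a.
Proof.
intros h; apply (ex_series_le (K := R_AbsRing) (V := R_CompleteNormedModule)).
intros n; change (Rabs (a n) <= b n).
rewrite Rabs_pos_eq; apply h.
Qed.

Lemma sum_n_le_Series (a : nat -> R) (N : nat) :
  (forall n, 0 <= a n) -> ex_series a -> sum_n a N <= Series a.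
Proof.
intros a0 exa.
apply (is_lim_seq_incr_compare (sum_n a)).
- exact (Series_correct _ exa).
- intros n; rewrite sum_nS; pose proof (a0 (S n)); lra.
Qed.

Lemma bounded_series (a : nat -> R) (M : R) :
  (forall n, 0 <= a n) -> (forall N, sum_n a N <= M) -> ex_series a /\ Series a <= M.
Proof.
intros a0 aM.
destruct (ex_finite_lim_seq_incr (sum_n a) M) as [l hl].
- intros n; rewrite sum_nS; pose proof (a0 (S n)); lra.
- exact aM.
- assert (ha : is_series a l) by exact hl.
  split; [now exists l |].
  rewrite (is_series_unique _ _ ha).
  exact (is_lim_seq_le _ _ l M aM hl (is_lim_seq_const M)).
Qed.

Lemma minus_minus_r (G : AbelianGroup) (x y z : G) :
  minus (minus x z) (minus y z) = minus x y.
Proof.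
rewrite (minus_trans z x y); unfold minus at 1 4; f_equal.
now rewrite !opp_minus.
Qed.

Lemma minus_plusK (G : AbelianGroup) (x y : G) : plus (minus x y) y = x.
Proof. unfold minus; now rewrite <- plus_assoc, plus_opp_l, plus_zero_r. Qed.

Lemma norm_plus_sqr_le (E : Hilbert) (x y : E) :
  norm (plus x y) ^ 2 <= 2 * norm x ^ 2 + 2 * norm y ^ 2.
Proof.
assert (h : norm (plus x y) <= norm x + norm y) by exact (norm_triangle x y).
assert (h0 : 0 <= norm (plus x y)) by exact (norm_ge_0 (plus x y)).
pose proof (pow2_ge_0 (norm x - norm y)).
assert (norm (plus x y) ^ 2 <= (norm x + norm y) ^ 2) by (apply pow_incr; lra).
nra.
Qed.

Lemma norm_scal_Hilbert (E : Hilbert) (c : C) (x : E) : norm (scal c x) = Cmod c * norm x.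
Proof.
rewrite <- !ip_norm_Hilbert; exact (ip_norm_scal (inner_product_Hilbert E) c x).
Qed.

Lemma inner_CS (E : Hilbert) (x y : E) : Cmod (inner x y) <= norm x * norm y.
Proof.
rewrite <- !ip_norm_Hilbert; exact (ip_CS (inner_product_Hilbert E) x y).
Qed.

Section SquareSummable.

Variable E : Hilbert.
Implicit Types a b : l2_seq E.

Lemma l2_eq a b : (forall n, a n = b n) -> a = b.
Proof.
destruct a as [a ha], b as [b hb]; simpl; intros h.
assert (ab : a = b) by now apply functional_extensionality.
subst b; f_equal; apply proof_irrelevance.
Qed.

Lemma l2_sqr_ge0 (a : nat -> E) n : 0 <= norm (a n) ^ 2.
Proof. apply pow2_ge_0. Qed.

Lemma l2_plus_summable a b : ex_series (fun n => norm (plus (a n) (b n)) ^ 2).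
Proof.
apply (@ex_series_pos_le _ (fun n => 2 * norm (a n) ^ 2 + 2 * norm (b n) ^ 2)).
- intros n; split; [apply pow2_ge_0 | apply norm_plus_sqr_le].
- apply (ex_series_plus (fun n => 2 * norm (a n) ^ 2) (fun n => 2 * norm (b n) ^ 2));
    apply (ex_series_scal_l 2 (fun n => norm (_ n) ^ 2)); apply l2_summable.
Qed.

Lemma l2_zero_summable : ex_series (fun _ : nat => norm (zero : E) ^ 2).
Proof.
assert (h : norm (zero : E) = 0) by exact (@norm_zero C_AbsRing E).
apply (@bounded_series _ 0); [intros _; apply pow2_ge_0 |].
intros N; right; rewrite sum_n_const, h; ring.
Qed.

Lemma l2_scal_summable (c : C) a : ex_series (fun n => norm (scal c (a n)) ^ 2).
Proof.
apply (ex_series_ext (fun n => Cmod c ^ 2 * norm (a n) ^ 2)).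
- intros n; rewrite norm_scal_Hilbert.
  match goal with |- ?x = ?y => change (@eq R x y) end; ring.
- apply (ex_series_scal_l (Cmod c ^ 2) (fun n => norm (a n) ^ 2)), l2_summable.
Qed.

Lemma l2_opp_summable a : ex_series (fun n => norm (opp (a n)) ^ 2).
Proof.
apply (ex_series_ext (fun n => norm (a n) ^ 2)); [| apply l2_summable].
intros n; f_equal; symmetry; exact (norm_opp (a n)).
Qed.

Definition l2_plus a b : l2_seq E := L2Seq (l2_plus_summable a b).
Definition l2_zero : l2_seq E := L2Seq l2_zero_summable.
Definition l2_opp a : l2_seq E := L2Seq (l2_opp_summable a).
Definition l2_scal (c : C) a : l2_seq E := L2Seq (l2_scal_summable c a).

Lemma l2_plusC a b : l2_plus a b = l2_plus b a.
Proof. apply l2_eq; intros n; apply plus_comm. Qed.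
Lemma l2_plusA a b c : l2_plus a (l2_plus b c) = l2_plus (l2_plus a b) c.
Proof. apply l2_eq; intros n; apply plus_assoc. Qed.
Lemma l2_plus0 a : l2_plus a l2_zero = a.
Proof. apply l2_eq; intros n; apply plus_zero_r. Qed.

Definition l2_AbelianMonoid : AbelianMonoid :=
  AbelianMonoid.Pack (l2_seq E)
    (AbelianMonoid.Mixin (l2_seq E) l2_plus l2_zero l2_plusC l2_plusA l2_plus0) (l2_seq E).

Lemma l2_plusN (a : l2_AbelianMonoid) : plus a (l2_opp a) = zero.
Proof. apply l2_eq; intros n; exact (plus_opp_r (a n)). Qed.

Definition l2_AbelianGroup : AbelianGroup :=
  AbelianGroup.Pack (l2_seq E)
    (AbelianGroup.Class (l2_seq E) (AbelianMonoid.class l2_AbelianMonoid)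
       (AbelianGroup.Mixin l2_AbelianMonoid l2_opp l2_plusN)) (l2_seq E).

Lemma l2_scalA (c d : C_Ring) (a : l2_AbelianGroup) :
  l2_scal c (l2_scal d a) = l2_scal (mult c d) a.
Proof. apply l2_eq; intros n; exact (scal_assoc c d (a n)). Qed.
Lemma l2_scal1 (a : l2_AbelianGroup) : l2_scal (one : C_Ring) a = a.
Proof. apply l2_eq; intros n; exact (scal_one (a n)). Qed.
Lemma l2_scalDr (c : C_Ring) (a b : l2_AbelianGroup) :
  l2_scal c (plus a b) = plus (l2_scal c a : l2_AbelianGroup) (l2_scal c b).
Proof. apply l2_eq; intros n; exact (scal_distr_l c (a n) (b n)). Qed.
Lemma l2_scalDl (c d : C_Ring) (a : l2_AbelianGroup) :
  l2_scal (plus c d) a = plus (l2_scal c a : l2_AbelianGroup) (l2_scal d a).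
Proof. apply l2_eq; intros n; exact (scal_distr_r c d (a n)). Qed.

Definition l2_ModuleSpace : ModuleSpace C_Ring :=
  ModuleSpace.Pack C_Ring (l2_seq E)
    (ModuleSpace.Class C_Ring (l2_seq E) (AbelianGroup.class l2_AbelianGroup)
       (ModuleSpace.Mixin C_Ring l2_AbelianGroup l2_scal l2_scalA l2_scal1
          l2_scalDr l2_scalDl)) (l2_seq E).

Definition l2_inner a b : C :=
  (Series (fun n => Re (inner (a n) (b n))), Series (fun n => Im (inner (a n) (b n)))).

Lemma l2_dominated a b (f : C -> R) : (forall z, Rabs (f z) <= Cmod z) ->
  ex_series (fun n => f (inner (a n) (b n))).
Proof.
intros hf.
apply (ex_series_le (K := R_AbsRing) (V := R_CompleteNormedModule) _
         (fun n => norm (a n) ^ 2 + norm (b n) ^ 2)).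
- intros n; eapply Rle_trans; [apply hf |].
  pose proof (inner_CS (a n) (b n)).
  pose proof (pow2_ge_0 (norm (a n) - norm (b n))).
  pose proof (pow2_ge_0 (norm (a n))); pose proof (pow2_ge_0 (norm (b n))); nra.
- apply (ex_series_plus (fun n => norm (a n) ^ 2) (fun n => norm (b n) ^ 2));
    apply l2_summable.
Qed.

Lemma Rabs_Im_le (z : C) : Rabs (Im z) <= Cmod z.
Proof.
eapply Rle_trans; [apply Rmax_r | apply Rmax_Cmod].
Qed.

Lemma l2_ex_Re a b : ex_series (fun n => Re (inner (a n) (b n))).
Proof. apply (@l2_dominated a b Re), re_le_Cmod. Qed.

Lemma l2_ex_Im a b : ex_series (fun n => Im (inner (a n) (b n))).
Proof. apply (@l2_dominated a b Im), Rabs_Im_le. Qed.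

Lemma l2_Re_self a : Re (l2_inner a a) = Series (fun n => norm (a n) ^ 2).
Proof. apply Series_ext; intros n; now rewrite inner_norm. Qed.

Lemma l2_inner_product : inner_product (V := l2_ModuleSpace) l2_inner.
Proof.
split.
- intros x y z; apply injective_projections; simpl.
  + rewrite <- Series_plus by apply l2_ex_Re; apply Series_ext; intros n.
    now rewrite <- re_plus, <- inner_plus_l.
  + rewrite <- Series_plus by apply l2_ex_Im; apply Series_ext; intros n.
    now rewrite <- im_plus, <- inner_plus_l.
- intros c x y; apply injective_projections; simpl.
  + rewrite <- !Series_scal_l, <- Series_minus.
    * apply Series_ext; intros n.
      change (Re (inner (scal c (x n)) (y n)) =
        fst c * Re (inner (x n) (y n)) - snd c * Im (inner (x n) (y n))).
      now rewrite inner_scal_l.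
    * apply (ex_series_scal_l (fst c) (fun n => Re (inner (x n) (y n)))), l2_ex_Re.
    * apply (ex_series_scal_l (snd c) (fun n => Im (inner (x n) (y n)))), l2_ex_Im.
  + rewrite <- !Series_scal_l, <- Series_plus.
    * apply Series_ext; intros n.
      change (Im (inner (scal c (x n)) (y n)) =
        fst c * Im (inner (x n) (y n)) + snd c * Re (inner (x n) (y n))).
      now rewrite inner_scal_l.
    * apply (ex_series_scal_l (fst c) (fun n => Im (inner (x n) (y n)))), l2_ex_Im.
    * apply (ex_series_scal_l (snd c) (fun n => Re (inner (x n) (y n)))), l2_ex_Re.
- intros x y; apply injective_projections; simpl.
  + apply Series_ext; intros n; now rewrite inner_conj, re_conj.
  + rewrite <- Series_opp; apply Series_ext; intros n; now rewrite inner_conj, im_conj.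
- intros x; rewrite l2_Re_self.
  eapply Rle_trans; [| apply (@sum_n_le_Series _ 0 (l2_sqr_ge0 x) (l2_summable x))].
  rewrite sum_O; apply pow2_ge_0.
- intros x; rewrite l2_Re_self; intros hx; apply l2_eq; intros n.
  apply (@norm_eq_zero C_AbsRing E).
  assert (h : norm (x n) ^ 2 <= 0).
  { rewrite <- hx.
    eapply Rle_trans; [| apply (@sum_n_le_Series _ n (l2_sqr_ge0 x) (l2_summable x))].
    destruct n as [| n]; [right; now rewrite sum_O |].
    rewrite sum_nS.
    assert (0 <= sum_n (fun n => norm (x n) ^ 2) n).
    { induction n as [| n IH]; [rewrite sum_O; apply pow2_ge_0 |].
      rewrite sum_nS; apply Rplus_le_le_0_compat; [exact IH | apply pow2_ge_0]. }
    lra. }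
  pose proof (norm_ge_0 (x n)); nra.
Qed.

Local Notation l2norm := (ip_norm (V := l2_ModuleSpace) l2_inner).

Lemma l2norm_sqr a : l2norm a ^ 2 = Series (fun n => norm (a n) ^ 2).
Proof. rewrite (ip_norm_sqr l2_inner_product); apply l2_Re_self. Qed.

Lemma sum_n_le_l2norm a N : sum_n (fun n => norm (a n) ^ 2) N <= l2norm a ^ 2.
Proof. rewrite l2norm_sqr; apply sum_n_le_Series; [apply l2_sqr_ge0 | apply l2_summable]. Qed.

Lemma norm_le_l2norm a n : norm (a n) <= l2norm a.
Proof.
assert (h : norm (a n) ^ 2 <= l2norm a ^ 2).
{ eapply Rle_trans; [| apply (sum_n_le_l2norm a n)].
  destruct n as [| n]; [right; now rewrite sum_O |].
  rewrite sum_nS.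
  assert (0 <= sum_n (fun n => norm (a n) ^ 2) n).
  { induction n as [| n IH]; [rewrite sum_O; apply pow2_ge_0 |].
    rewrite sum_nS; apply Rplus_le_le_0_compat; [exact IH | apply pow2_ge_0]. }
  lra. }
pose proof (norm_ge_0 (a n)).
pose proof (@ip_norm_ge0 l2_ModuleSpace l2_inner a).
apply Rnot_lt_le; intros hl; nra.
Qed.

Lemma l2_lim_partial (u : nat -> l2_seq E) (v c : nat -> E) (M : nat) :
  (forall k, forall e : posreal, exists N, forall n, (N <= n)%nat ->
     norm (minus (u n k) (v k)) < e) ->
  is_lim_seq (fun m => sum_n (fun k => norm (minus (u m k) (c k)) ^ 2) M)
    (sum_n (fun k => norm (minus (v k) (c k)) ^ 2) M).
Proof.
intros hu.
assert (h : forall k, is_lim_seq (fun m => norm (minus (u m k) (c k)) ^ 2)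
              (norm (minus (v k) (c k)) ^ 2)).
{ intros k.
  assert (h1 : is_lim_seq (fun m => norm (minus (u m k) (c k))) (norm (minus (v k) (c k)))).
  { apply is_lim_seq_spec; intros e; destruct (hu k e) as [N hN]; exists N; intros n hn.
    apply (Rle_lt_trans _ _ _ (norm_triangle_inv (minus (u n k) (c k)) (minus (v k) (c k)))).
    exact (eq_ind _ (fun z => norm z < e) (hN n hn) _
             (eq_sym (minus_minus_r (u n k) (v k) (c k)))). }
  apply (is_lim_seq_ext (fun m => norm (minus (u m k) (c k)) * norm (minus (u m k) (c k)))).
  { intros n; ring. }
  replace (norm (minus (v k) (c k)) ^ 2)
    with (norm (minus (v k) (c k)) * norm (minus (v k) (c k))) by ring.
  now apply is_lim_seq_mult'. }
induction M as [| M IH].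
- rewrite sum_O; apply (is_lim_seq_ext (fun m => norm (minus (u m O) (c O)) ^ 2)).
  + intros n; now rewrite sum_O.
  + apply h.
- rewrite sum_nS.
  apply (is_lim_seq_ext (fun m => sum_n (fun k => norm (minus (u m k) (c k)) ^ 2) M
                           + norm (minus (u m (S M)) (c (S M))) ^ 2)).
  + intros n; now rewrite sum_nS.
  + now apply is_lim_seq_plus'.
Qed.

Lemma l2_complete (u : nat -> l2_ModuleSpace) :
  (forall e : posreal, exists N, forall n m, (N <= n)%nat -> (N <= m)%nat ->
     ip_ball (V := l2_ModuleSpace) l2_inner (u n) e (u m)) ->
  exists x, forall e : posreal, exists N, forall n, (N <= n)%nat ->
     ip_ball (V := l2_ModuleSpace) l2_inner x e (u n).
Proof.
intros hu.
assert (lims : forall k, exists x : E, forall e : posreal, exists N, forall n, (N <= n)%nat ->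
     norm (minus ((u n : l2_seq E) k) x) < e).
{ intros k; apply (@Hilbert_cauchy_seq E (fun n => (u n : l2_seq E) k)).
  intros e; destruct (hu e) as [N hN]; exists N; intros n m hn hm.
  eapply Rle_lt_trans; [| exact (hN n m hn hm)].
  exact (norm_le_l2norm (minus (u m) (u n)) k). }
set (v k := epsilon (inhabits (zero : E)) (fun x => forall e : posreal, exists N,
   forall n, (N <= n)%nat -> norm (minus ((u n : l2_seq E) k) x) < e)).
assert (hv : forall k, forall e : posreal, exists N, forall n, (N <= n)%nat ->
   norm (minus ((u n : l2_seq E) k) (v k)) < e).
{ intros k; unfold v; apply epsilon_spec, lims. }
assert (key : forall e : posreal, exists N, forall n, (N <= n)%nat -> forall M,
   sum_n (fun k => norm (minus (v k) ((u n : l2_seq E) k)) ^ 2) M <= e ^ 2).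
{ intros e; destruct (hu e) as [N hN]; exists N; intros n hn M.
  apply (is_lim_seq_le_loc
    (fun m => sum_n (fun k => norm (minus ((u m : l2_seq E) k) ((u n : l2_seq E) k)) ^ 2) M)
    (fun _ => e ^ 2)
    (sum_n (fun k => norm (minus (v k) ((u n : l2_seq E) k)) ^ 2) M) (e ^ 2)).
  - exists N; intros m hm.
    eapply Rle_trans; [exact (sum_n_le_l2norm (minus (u m) (u n)) M) |].
    apply pow_incr; split; [apply ip_norm_ge0 | left; exact (hN n m hn hm)].
  - now apply l2_lim_partial.
  - apply is_lim_seq_const. }
assert (vs : ex_series (fun k => norm (v k) ^ 2)).
{ destruct (key (mkposreal 1 Rlt_0_1)) as [N hN]; specialize (hN N (le_n N)).
  destruct (bounded_series (fun k => pow2_ge_0 _) hN) as [h _].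
  apply (ex_series_ext (fun k => norm (plus (L2Seq h k) ((u N : l2_seq E) k)) ^ 2)).
  - intros k; exact (f_equal (fun z => norm z ^ 2) (minus_plusK (v k) ((u N : l2_seq E) k))).
  - apply l2_plus_summable. }
exists (L2Seq vs : l2_ModuleSpace); intros e.
assert (half : 0 < e / 2) by (pose proof (cond_pos e); lra).
destruct (key (mkposreal _ half)) as [N hN]; exists N; intros n hn.
apply (ip_ball_sym l2_inner_product); unfold ip_ball.
destruct (bounded_series (fun k => pow2_ge_0 _) (hN n hn)) as [_ h].
assert (h' : l2norm (minus (L2Seq vs : l2_ModuleSpace) (u n)) ^ 2 <= (e / 2) ^ 2).
{ rewrite l2norm_sqr; exact h. }
pose proof (@ip_norm_ge0 l2_ModuleSpace l2_inner (minus (L2Seq vs : l2_ModuleSpace) (u n))).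
pose proof (cond_pos e).
apply Rnot_le_lt; intros hl; nra.
Qed.

Definition l2 : Hilbert := Hilbert_of_inner_product l2_inner_product l2_complete.

End SquareSummable.

(** [is_linear] is Coquelicot's predicate for bounded linear maps. *)
Record bop (H K : Hilbert) : Type := Bop {
  bop_fun :> H -> K;
  bop_linear : is_linear bop_fun }.

Declare Scope bop_scope.
Delimit Scope bop_scope with B.
Bind Scope bop_scope with bop.

Lemma bop_eq (H K : Hilbert) (S T : bop H K) : (forall x, S x = T x) -> S = T.
Proof.
destruct S as [S hS], T as [T hT]; simpl; intros h.
assert (ST : S = T) by now apply functional_extensionality.
subst T; f_equal; apply proof_irrelevance.
Qed.

Lemma is_linear_add (U V : NormedModule C_AbsRing) (f g : U -> V) :
  is_linear f -> is_linear g -> is_linear (fun x => plus (f x) (g x)).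
Proof.
intros hf hg.
exact (is_linear_comp _ _ (is_linear_prod f g hf hg) is_linear_plus).
Qed.

Lemma is_linear_opp_comp (U V : NormedModule C_AbsRing) (f : U -> V) :
  is_linear f -> is_linear (fun x => opp (f x)).
Proof. intros hf; exact (is_linear_comp _ _ hf is_linear_opp). Qed.

Lemma is_linear_scal_comp (U V : NormedModule C_AbsRing) (c : C) (f : U -> V) :
  is_linear f -> is_linear (fun x => scal c (f x)).
Proof.
intros hf; exact (is_linear_comp _ _ hf (is_linear_scal_r c Cmult_comm)).
Qed.

Definition bid (H : Hilbert) : bop H H := Bop (is_linear_id (V := H)).
Definition bzero (H K : Hilbert) : bop H K := Bop (is_linear_zero (U := H) (V := K)).
Definition bcomp (H K L : Hilbert) (S : bop K L) (T : bop H K) : bop H L :=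
  Bop (is_linear_comp _ _ (bop_linear T) (bop_linear S)).
Definition badd (H K : Hilbert) (S T : bop H K) : bop H K :=
  Bop (is_linear_add (bop_linear S) (bop_linear T)).
Definition bopp (H K : Hilbert) (T : bop H K) : bop H K :=
  Bop (is_linear_opp_comp (bop_linear T)).
Definition bscal (H K : Hilbert) (c : C) (T : bop H K) : bop H K :=
  Bop (is_linear_scal_comp c (bop_linear T)).
Fixpoint bpow (H : Hilbert) (T : bop H H) (n : nat) : bop H H :=
  match n with O => bid H | S k => bcomp T (bpow T k) end.

Arguments bid {H}.
Arguments bzero {H K}.

Notation "1" := bid : bop_scope.
Notation "0" := bzero : bop_scope.
Notation "S * T" := (bcomp S T) : bop_scope.
Notation "S + T" := (badd S T) : bop_scope.
Notation "S - T" := (badd S (bopp T)) : bop_scope.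
Notation "- T" := (bopp T) : bop_scope.
Notation "c *: T" := (bscal c T) (at level 40, T at next level) : bop_scope.
Notation "T ^ n" := (bpow T n) : bop_scope.

(** The unique [S] with [<T x, y> = <x, S y>], which exists by the Riesz
    representation theorem. *)
Definition adj (H K : Hilbert) (T : bop H K) : bop K H :=
  epsilon (inhabits bzero) (fun S => forall x y, inner (T x) y = inner x (S y)).

Notation "T ^*" := (adj T) (at level 2, format "T ^*") : bop_scope.

Definition commute (H : Hilbert) (S T : bop H H) : Prop := (S * T)%B = (T * S)%B.
Definition commutator (H : Hilbert) (S T : bop H H) : bop H H := (S * T - T * S)%B.
Definition normal (H : Hilbert) (T : bop H H) : Prop := commute T (T^*)%B.
Definition unitary (H K : Hilbert) (W : bop H K) : Prop :=
  (W^* * W = 1)%B /\ (W * W^* = 1)%B.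
Definition isometric (H K : Hilbert) (j : bop H K) : Prop := forall x, norm (j x) = norm x.

Definition positive (H : Hilbert) (T : bop H H) : Prop :=
  forall x, Im (inner (T x) x) = 0 /\ 0 <= Re (inner (T x) x).

(** For positive [T] exactly one such [S] exists: the positive square root of [T]. *)
Definition bsqrt (H : Hilbert) (T : bop H H) : bop H H :=
  epsilon (inhabits bzero) (fun S => positive S /\ (S * S)%B = T).

Definition opnorm (U V : NormedModule C_AbsRing) (T : U -> V) : Rbar :=
  Lub_Rbar (fun r => exists x, norm x <= 1 /\ r = norm (T x)).

Definition closure (T : UniformSpace) (D : T -> Prop) (x : T) : Prop :=
  forall Q, locally x Q -> exists y, D y /\ Q y.

Inductive span (H : Hilbert) (D : H -> Prop) : H -> Prop :=
  | span_zero : span D zero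
  | span_add (c : C) (d x : H) : D d -> span D x -> span D (plus (scal c d) x).

Section ClosedRange.

Variables (H K : Hilbert) (T : bop H K).

Definition closed_range : K -> Prop := closure (fun y => exists x, y = T x).

Lemma closed_rangeP (y : K) :
  closed_range y <-> forall e : posreal, exists x, norm (minus (T x) y) < e.
Proof.
split.
- intros h e.
  destruct (h (fun z => norm (minus z y) < e)) as [z [[x ->] hx]]; [| now exists x].
  exact (locally_le_locally_norm y _ (ex_intro _ e (fun z h => h))).
- intros h Q hQ.
  destruct (locally_norm_le_locally (V := K) y Q hQ) as [e he].
  destruct (h e) as [x hx]; exists (T x); split; [now exists x | exact (he _ hx)].
Qed.

Lemma closed_range_in (x : H) : closed_range (T x).
Proof.
intros Q [e he]; exists (T x); split; [now exists x | apply he, ball_center].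
Qed.

Lemma closed_range_zero : closed_range zero.
Proof.
exact (eq_ind _ closed_range (@closed_range_in zero) _ (linear_zero _ (bop_linear T))).
Qed.

Lemma closed_range_plus (y z : K) :
  closed_range y -> closed_range z -> closed_range (plus y z).
Proof.
rewrite !closed_rangeP; intros hy hz e.
assert (half : 0 < e / 2) by (pose proof (cond_pos e); lra).
destruct (hy (mkposreal _ half)) as [u hu], (hz (mkposreal _ half)) as [v hv].
exists (plus u v).
assert (h : minus (T (plus u v)) (plus y z) = plus (minus (T u) y) (minus (T v) z)).
{ refine (eq_trans (f_equal (fun w => minus w (plus y z))
                      (linear_plus _ (bop_linear T) u v)) _).
  unfold minus.
  refine (eq_trans (f_equal (plus (plus (T u) (T v))) (opp_plus y z)) _).
  rewrite <- !plus_assoc; f_equal.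
  rewrite !plus_assoc; f_equal; apply plus_comm. }
rewrite h.
eapply Rle_lt_trans; [exact (norm_triangle (minus (T u) y) (minus (T v) z)) |].
simpl in hu, hv; lra.
Qed.

Lemma closed_range_scal (c : C) (y : K) : closed_range y -> closed_range (scal c y).
Proof.
rewrite !closed_rangeP; intros hy e.
assert (pos : 0 < e / (Cmod c + 1)).
{ apply Rdiv_lt_0_compat; [apply cond_pos | pose proof (Cmod_ge_0 c); lra]. }
destruct (hy (mkposreal _ pos)) as [u hu]; exists (scal c u).
assert (h : minus (T (scal c u)) (scal c y) = scal c (minus (T u) y)).
{ refine (eq_trans (f_equal (fun w => minus w (scal c y))
                      (linear_scal _ (bop_linear T) c u)) _).
  exact (eq_sym (scal_minus_distr_l c (T u) y)). }
rewrite h, norm_scal_Hilbert; simpl in hu.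
pose proof (Cmod_ge_0 c); pose proof (cond_pos e).
apply Rle_lt_trans with (Cmod c * (e / (Cmod c + 1))).
- apply Rmult_le_compat_l; lra.
- apply Rmult_lt_reg_r with (Cmod c + 1); [lra |].
  field_simplify; [nra | lra].
Qed.

Lemma closed_range_closed : closed closed_range.
Proof.
intros y hy; apply NNPP; intros hn; apply hy.
unfold closed_range, closure in hn.
apply not_all_ex_not in hn; destruct hn as [Q hQ].
apply imply_to_and in hQ; destruct hQ as [hQ hQn].
apply filter_imp with (2 := locally_locally _ _ hQ).
intros z hz hzc; destruct (hzc Q hz) as [w hw]; now apply hQn; exists w.
Qed.

Definition ranH : Hilbert :=
  subHilbert closed_range_zero closed_range_plus closed_range_scal closed_range_closed.

Lemma corestrict_linear :
  is_linear (fun x => exist closed_range (T x) (@closed_range_in x) : ranH).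
Proof.
split.
- intros x y; apply sub_eq; exact (linear_plus _ (bop_linear T) x y).
- intros c x; apply sub_eq; exact (linear_scal _ (bop_linear T) c x).
- destruct (linear_norm _ (bop_linear T)) as [M [hM h]]; exists M; split; [exact hM |].
  intros x; eapply Rle_trans; [right | exact (h x)].
  exact (ip_norm_Hilbert (T x)).
Qed.

Lemma ran_incl_linear : is_linear (fun y : ranH => proj1_sig y : K).
Proof.
split; [reflexivity | reflexivity |].
exists 1; split; [lra |]; intros y; right; rewrite Rmult_1_l.
symmetry; exact (ip_norm_Hilbert (proj1_sig y)).
Qed.

Definition corestrict : bop H ranH := Bop corestrict_linear.
Definition ran_incl : bop ranH K := Bop ran_incl_linear.

End ClosedRange.

Section SequenceOperators.

Variable E : Hilbert.

Lemma series_shift (a : nat -> R) : ex_series (fun n => a (S n)) <-> ex_series a.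
Proof. symmetry; apply ex_series_incr_1. Qed.

Definition cons_fun (e : E) (a : nat -> E) (n : nat) : E :=
  match n with O => e | S k => a k end.

Lemma cons_summable (e : E) (a : l2 E) : ex_series (fun n => norm (cons_fun e a n) ^ 2).
Proof.
apply (proj1 (series_shift _)); exact (l2_summable a).
Qed.

Lemma tail_summable (a : l2 E) : ex_series (fun n => norm (a (S n)) ^ 2).
Proof.
apply (proj2 (series_shift (fun n => norm (a n) ^ 2))); exact (l2_summable a).
Qed.

Definition l2_cons (e : E) (a : l2 E) : l2 E := L2Seq (cons_summable e a).
Definition l2_tail (a : l2 E) : l2 E := L2Seq (tail_summable a).

Lemma norm_l2_sqr (a : l2 E) : norm a ^ 2 = Series (fun n => norm (a n) ^ 2).
Proof. exact (l2norm_sqr a). Qed.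

Lemma norm_l2_cons (e : E) (a : l2 E) : norm (l2_cons e a) ^ 2 = norm e ^ 2 + norm a ^ 2.
Proof. now rewrite !norm_l2_sqr, Series_incr_1 by exact (cons_summable e a). Qed.

Lemma is_linear_l2_cons (U : NormedModule C_AbsRing) (f : U -> E) (g : U -> l2 E) :
  is_linear f -> is_linear g -> is_linear (fun x => l2_cons (f x) (g x)).
Proof.
intros hf hg; split.
- intros x y; apply l2_eq; intros [| n]; simpl.
  + exact (linear_plus _ hf x y).
  + exact (f_equal (fun a : l2 E => a n) (linear_plus _ hg x y)).
- intros c x; apply l2_eq; intros [| n]; simpl.
  + exact (linear_scal _ hf c x).
  + exact (f_equal (fun a : l2 E => a n) (linear_scal _ hg c x)).
- destruct (linear_norm _ hf) as [M [hM h]], (linear_norm _ hg) as [N [hN k]].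
  exists (M + N); split; [lra |]; intros x.
  specialize (h x); specialize (k x).
  pose proof (norm_l2_cons (f x) (g x)) as e.
  assert (0 <= norm (f x)) by exact (norm_ge_0 (f x)).
  assert (0 <= norm (g x)) by exact (norm_ge_0 (g x)).
  assert (0 <= norm (l2_cons (f x) (g x))) by exact (norm_ge_0 (l2_cons (f x) (g x))).
  assert (norm (l2_cons (f x) (g x)) <= norm (f x) + norm (g x)).
  { apply Rnot_lt_le; intros hl; nra. }
  lra.
Qed.

Lemma l2_tail_linear : is_linear l2_tail.
Proof.
split; [intros x y; now apply l2_eq | intros c x; now apply l2_eq |].
exists 1; split; [lra |]; intros a; rewrite Rmult_1_l.
pose proof (norm_l2_sqr a) as h; rewrite (Series_incr_1 _ (l2_summable a)) in h.
pose proof (norm_l2_sqr (l2_tail a)) as k; simpl in k.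
pose proof (pow2_ge_0 (norm (a O))).
assert (0 <= norm a) by exact (norm_ge_0 a).
assert (0 <= norm (l2_tail a)) by exact (norm_ge_0 (l2_tail a)).
apply Rnot_lt_le; intros hl; simpl in *; nra.
Qed.

Lemma l2_head_linear : is_linear (fun a : l2 E => a O).
Proof.
split; [reflexivity | reflexivity |].
exists 1; split; [lra |]; intros a; rewrite Rmult_1_l; exact (norm_le_l2norm a 0).
Qed.

Variables (F : Hilbert) (T : bop E F).

Lemma l2_map_summable (a : l2 E) :
  ex_series (fun n => norm (T (a n)) ^ 2) /\
  exists M, 0 < M /\ forall a : l2 E,
    Series (fun n => norm (T (a n)) ^ 2) <= (M * norm a) ^ 2.
Proof.
destruct (linear_norm _ (bop_linear T)) as [M [hM h]].
assert (b : forall (a : l2 E) n, 0 <= norm (T (a n)) ^ 2 <= M ^ 2 * norm (a n) ^ 2).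
{ intros a' n; split; [apply pow2_ge_0 |].
  rewrite <- Rpow_mult_distr; apply pow_incr; split;
    [exact (norm_ge_0 (T (a' n))) | exact (h (a' n))]. }
assert (s : forall a : l2 E, ex_series (fun n => M ^ 2 * norm (a n) ^ 2)).
{ intros a'; apply (ex_series_scal_l (M ^ 2) (fun n => norm (a' n) ^ 2)); exact (l2_summable a'). }
split.
- exact (ex_series_pos_le (b a) (s a)).
- exists M; split; [exact hM |]; intros a'.
  rewrite Rpow_mult_distr, norm_l2_sqr, <- Series_scal_l.
  exact (Series_le _ _ (b a') (s a')).
Qed.

Definition l2_map_fun (a : l2 E) : l2 F := L2Seq (proj1 (l2_map_summable a)).

Lemma l2_map_linear : is_linear l2_map_fun.
Proof.
split.
- intros x y; apply l2_eq; intros n; exact (linear_plus _ (bop_linear T) _ _).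
- intros c x; apply l2_eq; intros n; exact (linear_scal _ (bop_linear T) _ _).
- destruct (proj2 (l2_map_summable zero)) as [M [hM h]]; exists M; split; [exact hM |].
  intros a; specialize (h a).
  assert (e : norm (l2_map_fun a) ^ 2 <= (M * norm a) ^ 2).
  { eapply Rle_trans; [right | exact h]; exact (l2norm_sqr (l2_map_fun a)). }
  assert (0 <= norm a) by exact (norm_ge_0 a).
  assert (0 <= norm (l2_map_fun a)) by exact (norm_ge_0 (l2_map_fun a)).
  assert (0 <= M * norm a) by (apply Rmult_le_pos; lra).
  apply Rnot_lt_le; intros hl; nra.
Qed.

Definition l2_map : bop (l2 E) (l2 F) := Bop l2_map_linear.

End SequenceOperators.

Definition mat2 (a11 a12 a21 a22 : C) (v : C * C) : C * C :=
  (a11 * fst v + a12 * snd v, a21 * fst v + a22 * snd v)%C.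

Definition tetrablock (z : C * C * C) : Prop :=
  exists a11 a12 a21 a22 : C,
    Rbar_lt (opnorm (mat2 a11 a12 a21 a22)) 1 /\
    z = (a11, a22, a11 * a22 - a12 * a21)%C.

Definition closed_tetrablock : C * C * C -> Prop := closure tetrablock.

Definition holomorphic_on (D : C * C * C -> Prop) (f : C * C * C -> C) : Prop :=
  forall z, D z -> ex_filterdiff (K := C_AbsRing) f (locally z).

Definition tetrablock_boundary_set (S : C * C * C -> Prop) : Prop :=
  closed S /\ (forall z, S z -> closed_tetrablock z) /\
  forall f : C * C * C -> C,
    continuous_on closed_tetrablock f -> holomorphic_on tetrablock f ->
    exists z, S z /\ forall w, closed_tetrablock w -> Cmod (f w) <= Cmod (f z).

(** By Shilov's theorem there is a smallest boundary set, hence it is the intersection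
    of all of them. *)
Definition distinguished_boundary (z : C * C * C) : Prop :=
  forall S, tetrablock_boundary_set S -> S z.

Section Koszul.

Variables (H : Hilbert) (T1 T2 T3 : bop H H).

Definition koszul0 (x : H) : H * H * H := (T1 x, T2 x, T3 x).

(** Components along [e1/\e2], [e1/\e3], [e2/\e3]. *)
Definition koszul1 (x : H * H * H) : H * H * H :=
  let '(x1, x2, x3) := x in
  (minus (T1 x2) (T2 x1), minus (T1 x3) (T3 x1), minus (T2 x3) (T3 x2)).

Definition koszul2 (y : H * H * H) : H :=
  let '(y12, y13, y23) := y in plus (minus (T1 y23) (T2 y13)) (T3 y12).

Definition koszul_exact : Prop :=
  (forall x, koszul0 x = (zero, zero, zero) -> x = zero) /\
  (forall x, koszul1 x = (zero, zero, zero) -> exists w, x = koszul0 w) /\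
  (forall y, koszul2 y = zero -> exists x, y = koszul1 x) /\
  (forall z, exists y, z = koszul2 y).

End Koszul.

Section Triples.

Variables (H : Hilbert) (A B P : bop H H).

Definition commuting_triple : Prop := commute A B /\ commute A P /\ commute B P.

(** For a commuting triple, the set of points where the Koszul complex
    [0 -> H -> H^3 -> H^3 -> H -> 0] is not exact. *)
Definition taylor_spectrum (z : C * C * C) : Prop :=
  let '(z1, z2, z3) := z in
  ~ koszul_exact (A - z1 *: 1)%B (B - z2 *: 1)%B (P - z3 *: 1)%B.

End Triples.

(** Polynomials in three variables, as finite lists of terms [c z1^i z2^j z3^k]. *)
Definition poly3 : Type := list (C * (nat * nat * nat)).

Definition peval (p : poly3) (z : C * C * C) : C :=
  fold_right (fun t s => let '(c, (i, j, k)) := t in let '(z1, z2, z3) := z in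
    c * (z1 ^ i * z2 ^ j * z3 ^ k) + s)%C (RtoC 0) p.

Definition pevalop (H : Hilbert) (p : poly3) (A B P : bop H H) : bop H H :=
  fold_right (fun t S => let '(c, (i, j, k)) := t in
    c *: (A ^ i * B ^ j * P ^ k) + S)%B 0%B p.

Definition tetrablock_contraction (H : Hilbert) (A B P : bop H H) : Prop :=
  commuting_triple A B P /\
  (forall z, taylor_spectrum A B P z -> closed_tetrablock z) /\
  forall p : poly3,
    Rbar_le (opnorm (pevalop p A B P))
      (Lub_Rbar (fun r => exists z, closed_tetrablock z /\ r = Cmod (peval p z))).

Definition tetrablock_unitary (K : Hilbert) (N1 N2 N3 : bop K K) : Prop :=
  commuting_triple N1 N2 N3 /\ normal N1 /\ normal N2 /\ normal N3 /\
  (forall z, taylor_spectrum N1 N2 N3 z -> distinguished_boundary z).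

(** A space [K] containing [H] is given by an isometry [j : H -> K]; then [j^*] is the
    orthogonal projection of [K] onto [H]. *)
Definition tetrablock_unitary_dilation (H K : Hilbert) (j : bop H K)
    (A B P : bop H H) (N1 N2 N3 : bop K K) : Prop :=
  isometric j /\ tetrablock_unitary N1 N2 N3 /\
  forall m n l : nat,
    (A ^ m * B ^ n * P ^ l = j^* * (N1 ^ m * N2 ^ n * N3 ^ l) * j)%B.

Definition unitary_pow (K : Hilbert) (U : bop K K) (m : Z) : bop K K :=
  match m with
  | Z0 => 1
  | Zpos p => U ^ Pos.to_nat p
  | Zneg p => U^* ^ Pos.to_nat p
  end%B.

Definition minimal_unitary_dilation (H K : Hilbert) (j : bop H K) (P : bop H H)
    (U : bop K K) : Prop :=
  isometric j /\ unitary U /\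
  (forall m : nat, P ^ m = j^* * U ^ m * j)%B /\
  (forall x : K, closure (span (fun y => exists (m : Z) (h : H), y = unitary_pow U m (j h))) x).

Definition unitarily_equivalent (K1 K2 : Hilbert) (X1 X2 X3 : bop K1 K1)
    (Y1 Y2 Y3 : bop K2 K2) : Prop :=
  exists W : bop K1 K2, unitary W /\
    (W * X1 * W^* = Y1)%B /\ (W * X2 * W^* = Y2)%B /\ (W * X3 * W^* = Y3)%B.

Definition defect (H : Hilbert) (P : bop H H) : bop H H := bsqrt (1 - P^* * P)%B.

Definition defect_space (H : Hilbert) (P : bop H H) : Hilbert := ranH (defect P).

Definition to_defect (H : Hilbert) (P : bop H H) : bop H (defect_space P) :=
  corestrict (defect P).

Definition of_defect (H : Hilbert) (P : bop H H) : bop (defect_space P) H :=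
  ran_incl (defect P).

Definition fundamental_operators (H : Hilbert) (A B P : bop H H)
    (F1 F2 : bop (defect_space P) (defect_space P)) : Prop :=
  (A - B^* * P = defect P * of_defect P * F1 * to_defect P)%B /\
  (B - A^* * P = defect P * of_defect P * F2 * to_defect P)%B.

Arguments fundamental_operators {H} A B P F1 F2.

Section ExplicitDilation.

Variables (H : Hilbert) (P : bop H H).

Local Notation DP := (defect_space P).
Local Notation DPs := (defect_space P^*).

Definition dil_space0 : Hilbert := hsum H (l2 DP).
Definition dil_space : Hilbert := hsum dil_space0 (l2 DPs).

(** [h (+) a] goes to [T h (+) (S^* D_P h + F a_0, S^* a_0 + F a_1, ...)]. *)
Definition dil_V_fun (T : bop H H) (F S : bop DP DP) (x : dil_space0) : dil_space0 :=
  (T (fst x), plus (l2_map S^* (l2_cons (to_defect P (fst x)) (snd x))) (l2_map F (snd x))).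

Lemma dil_V_linear T F S : is_linear (dil_V_fun T F S).
Proof.
assert (hf : is_linear (fun x : dil_space0 => fst x)) by exact is_linear_fst.
assert (hs : is_linear (fun x : dil_space0 => snd x)) by exact is_linear_snd.
apply (is_linear_prod (K := C_AbsRing) (T := dil_space0) (U := H) (V := l2 DP)).
- exact (is_linear_comp _ _ hf (bop_linear T)).
- apply (is_linear_add (U := dil_space0) (V := l2 DP)).
  + refine (is_linear_comp _ _ _ (bop_linear (l2_map S^*))).
    apply is_linear_l2_cons; [| exact hs].
    exact (is_linear_comp _ _ hf (bop_linear (to_defect P))).
  + exact (is_linear_comp _ _ hs (bop_linear (l2_map F))).
Qed.

Definition dil_V (T : bop H H) (F S : bop DP DP) : bop dil_space0 dil_space0 :=
  Bop (dil_V_linear T F S).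

Definition dil_V3_fun (x : dil_space0) : dil_space0 :=
  (P (fst x), l2_cons (to_defect P (fst x)) (snd x)).

Lemma dil_V3_linear : is_linear dil_V3_fun.
Proof.
assert (hf : is_linear (fun x : dil_space0 => fst x)) by exact is_linear_fst.
apply (is_linear_prod (K := C_AbsRing) (T := dil_space0) (U := H) (V := l2 DP)).
- exact (is_linear_comp _ _ hf (bop_linear P)).
- apply is_linear_l2_cons; [| exact is_linear_snd].
  exact (is_linear_comp _ _ hf (bop_linear (to_defect P))).
Qed.

Definition dil_V3 : bop dil_space0 dil_space0 := Bop dil_V3_linear.

(** [P^*] as an operator from [DPs] to [DP]. It maps the former into the latter since
    [P^* D_{P^*} = D_P P^*], so the projection [of_defect P ^*] only restricts the codomain. *)
Definition adj_defect : bop DPs DP := ((of_defect P)^* * P^* * of_defect P^*)%B.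

(** [a] goes to [D_{P^*} G a_0 (+) (- F^* P^* a_0, 0, ...)]. *)
Definition dil_C_fun (G : bop DPs DPs) (F : bop DP DP) (a : l2 DPs) : dil_space0 :=
  (defect P^* (of_defect P^* (G (a O))), l2_cons (opp (F^* (adj_defect (a O)))%B) zero).

Lemma dil_C_linear G F : is_linear (dil_C_fun G F).
Proof.
pose proof (l2_head_linear DPs) as h0.
apply (is_linear_prod (K := C_AbsRing) (T := l2 DPs) (U := H) (V := l2 DP)).
- exact (is_linear_comp _ _ h0 (bop_linear (defect P^* * of_defect P^* * G)%B)).
- apply is_linear_l2_cons; [| exact is_linear_zero].
  exact (is_linear_comp _ _ h0 (bop_linear (- (F^* * adj_defect))%B)).
Qed.

Definition dil_C (G : bop DPs DPs) (F : bop DP DP) : bop (l2 DPs) dil_space0 :=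
  Bop (dil_C_linear G F).

Definition dil_C3_fun (a : l2 DPs) : dil_space0 :=
  (defect P^* (of_defect P^* (a O)), l2_cons (opp (adj_defect (a O))) zero).

Lemma dil_C3_linear : is_linear dil_C3_fun.
Proof.
pose proof (l2_head_linear DPs) as h0.
apply (is_linear_prod (K := C_AbsRing) (T := l2 DPs) (U := H) (V := l2 DP)).
- exact (is_linear_comp _ _ h0 (bop_linear (defect P^* * of_defect P^*)%B)).
- apply is_linear_l2_cons; [| exact is_linear_zero].
  exact (is_linear_comp _ _ h0 (bop_linear (- adj_defect)%B)).
Qed.

Definition dil_C3 : bop (l2 DPs) dil_space0 := Bop dil_C3_linear.

Definition dil_D3 : bop (l2 DPs) (l2 DPs) := Bop (l2_tail_linear DPs).

(** [a] goes to [(G^* a_0 + G' a_1, G^* a_1 + G' a_2, ...)]. *)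
Definition dil_D (G G' : bop DPs DPs) : bop (l2 DPs) (l2 DPs) :=
  (l2_map G^* + l2_map G' * dil_D3)%B.

(** The block operator with rows [(V, Z)] and [(0, D)]. *)
Definition upper_block_fun (V : bop dil_space0 dil_space0) (Z : bop (l2 DPs) dil_space0)
    (D : bop (l2 DPs) (l2 DPs)) (x : dil_space) : dil_space :=
  (plus (V (fst x)) (Z (snd x)), D (snd x)).

Lemma upper_block_linear V Z D : is_linear (upper_block_fun V Z D).
Proof.
assert (hf : is_linear (fun x : dil_space => fst x)) by exact is_linear_fst.
assert (hs : is_linear (fun x : dil_space => snd x)) by exact is_linear_snd.
apply (is_linear_prod (K := C_AbsRing) (T := dil_space) (U := dil_space0) (V := l2 DPs)).
- apply (is_linear_add (U := dil_space) (V := dil_space0)).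
  + exact (is_linear_comp _ _ hf (bop_linear V)).
  + exact (is_linear_comp _ _ hs (bop_linear Z)).
- exact (is_linear_comp _ _ hs (bop_linear D)).
Qed.

Definition upper_block V Z D : bop dil_space dil_space := Bop (upper_block_linear V Z D).

Definition dil_R1 (A : bop H H) (F1 F2 : bop DP DP) (G1 G2 : bop DPs DPs) :
    bop dil_space dil_space :=
  upper_block (dil_V A F1 F2) (dil_C G2 F2) (dil_D G1 G2).

Definition dil_R2 (B : bop H H) (F1 F2 : bop DP DP) (G1 G2 : bop DPs DPs) :
    bop dil_space dil_space :=
  upper_block (dil_V B F2 F1) (dil_C G1 F1) (dil_D G2 G1).

Definition dil_U : bop dil_space dil_space := upper_block dil_V3 dil_C3 dil_D3.

Lemma dil_embed_linear : is_linear (fun h : H => ((h, zero), zero) : dil_space).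
Proof.
apply (is_linear_prod (K := C_AbsRing) (T := H) (U := dil_space0) (V := l2 DPs));
  [| exact is_linear_zero].
apply (is_linear_prod (K := C_AbsRing) (T := H) (U := H) (V := l2 DP));
  [exact is_linear_id | exact is_linear_zero].
Qed.

Definition dil_embed : bop H dil_space := Bop dil_embed_linear.

End ExplicitDilation.

Arguments dil_R1 {H} P A F1 F2 G1 G2.
Arguments dil_R2 {H} P B F1 F2 G1 G2.

(* Main.v *)
(** Let [U] be the Schaeffer unitary dilation of [P]. The joint spectrum of a tetrablock unitary
    [(N1, N2, U)] lies in [{(conj x2 * x3, x2, x3) : |x2| <= 1, |x3| = 1}], hence [N1 = N2^* U].
    Therefore [<N1 h, U^m h'>] is [<A P^k h, h'>] for [m = - k <= 0] and [<B^* h, P^(m-1) h'>]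
    for [m > 0]. Since the vectors [U^m h'] span the dilation space and [N1] commutes with [U],
    this determines [N1]; the explicit [R1] commutes with [U] and has the same inner products.
    Part (ii) follows by transport along the unitary between two minimal unitary dilations.

    The spectral step rests on Fuglede's theorem and on joint approximate eigenvectors, at which
    the Koszul complex is not exact. The description of the distinguished boundary is the maximum
    principle on a rational analytic disc through a given point of the tetrablock. *)

From Stdlib Require Import Reals Lra Lia List Classical ClassicalEpsilon
  FunctionalExtensionality PropExtensionality.
From Coquelicot Require Import Coquelicot.
Require Import Defs.

Set Implicit Arguments.
Unset Strict Implicit.
Open Scope R_scope.

(** * Hilbert spaces and adjoints *)

(** The relation [N1 = N2^* U] matters because the dilation property of [N1] does not reach its
    moments against positive powers: <N1 h, U^m h'> = <N2^* h, U^(m-1) h'> = <h, B P^(m-1) h'>, so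
    these are read off from [N2]. On the explicit side the same value comes from d^* F2^* d = B^* -
    P^* A, where d is [D_P] with the defect space as codomain.

    The obstacle is to turn a relation between spectral points into one between operators without a
    spectral theorem. If D = N1 - N2^* N3 were nonzero, the top q of the form of D^* D on unit
    vectors would be positive; vectors nearly attaining q are refined to joint approximate
    eigenvectors of N1, N2, N3. Each refinement asks that the next operator and its adjoint commute
    with all earlier ones, which Fuglede's theorem supplies. At the joint eigenvalue the relation
    makes D nearly vanish, against q > 0.

    [adj] and [bsqrt] are choices by [epsilon]: they say nothing until existence, and for [bsqrt]
    also uniqueness, is proved. *)

Notation contraction T := (forall x, norm (bop_fun T x) <= norm x) (only parsing).

Lemma inner_plus_r (H : Hilbert) (x y z : H) :
  inner x (plus y z) = (inner x y + inner x z)%C.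
Proof. exact (ip_plus_r (inner_product_Hilbert H) x y z). Qed.

Lemma inner_scal_r (H : Hilbert) (c : C) (x y : H) :
  inner x (scal c y) = (Cconj c * inner x y)%C.
Proof. exact (ip_scal_r (inner_product_Hilbert H) c x y). Qed.

Lemma inner_zero_l (H : Hilbert) (y : H) : inner zero y = 0%C.
Proof.
assert (h : (inner zero y + inner zero y = inner zero y)%C)
  by (rewrite <- inner_plus_l; now rewrite plus_zero_l).
replace (inner zero y) with ((inner zero y + inner zero y) - inner zero y)%C by ring.
rewrite h; ring.
Qed.

Lemma hplus_opp_r (H : Hilbert) (x : H) : plus x (opp x) = zero.
Proof. exact (plus_opp_r (x : CompleteNormedModule.AbelianGroup C_AbsRing H)). Qed.

Lemma inner_opp_l (H : Hilbert) (x y : H) : inner (opp x) y = (- inner x y)%C.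
Proof.
assert (h : (inner x y + inner (opp x) y = 0)%C).
{ rewrite <- inner_plus_l. rewrite hplus_opp_r. apply inner_zero_l. }
replace (inner (opp x) y) with ((inner x y + inner (opp x) y) - inner x y)%C by ring.
rewrite h; ring.
Qed.

Lemma inner_opp_r (H : Hilbert) (x y : H) : inner x (opp y) = (- inner x y)%C.
Proof. now rewrite (inner_conj (opp y) x), inner_opp_l, Copp_conj, <- inner_conj. Qed.

Lemma inner_zero_r (H : Hilbert) (x : H) : inner x zero = 0%C.
Proof. rewrite (inner_conj zero x), inner_zero_l; apply injective_projections; simpl; ring. Qed.

Lemma inner_self_zero (H : Hilbert) (x : H) : inner x x = 0%C -> x = zero.
Proof.
intros h; apply (ip_eq0 (inner_product_Hilbert H)); now rewrite h.
Qed.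

Lemma inner_ext (H : Hilbert) (x y : H) : (forall z, inner x z = inner y z) -> x = y.
Proof.
intros h.
assert (e : minus x y = zero).
{ apply inner_self_zero; unfold minus at 1; rewrite inner_plus_l, inner_opp_l, h; ring. }
rewrite <- (minus_plusK x y), e; apply plus_zero_l.
Qed.

(* Testing a vector identity against inner products turns it into a [ring] identity in [C]. *)
Ltac hvec := apply inner_ext; intros ?; unfold minus;
  repeat first [rewrite inner_plus_l | rewrite inner_opp_l | rewrite inner_scal_l | rewrite inner_zero_l]; try ring.

Lemma bop_plus (H K : Hilbert) (T : bop H K) (x y : H) : T (plus x y) = plus (T x) (T y).
Proof. exact (linear_plus _ (bop_linear T) x y). Qed.

Lemma bop_scal (H K : Hilbert) (T : bop H K) (c : C) (x : H) : T (scal c x) = scal c (T x).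
Proof. exact (linear_scal _ (bop_linear T) c x). Qed.

Lemma bop_zero (H K : Hilbert) (T : bop H K) : T zero = zero.
Proof. exact (linear_zero _ (bop_linear T)). Qed.

Lemma bop_opp (H K : Hilbert) (T : bop H K) (x : H) : T (opp x) = opp (T x).
Proof. exact (linear_opp _ x (bop_linear T)). Qed.

Lemma bop_minus (H K : Hilbert) (T : bop H K) (x y : H) : T (minus x y) = minus (T x) (T y).
Proof. unfold minus; now rewrite bop_plus, bop_opp. Qed.

Lemma bop_bound (H K : Hilbert) (T : bop H K) :
  exists M, 0 < M /\ forall x, norm (T x) <= M * norm x.
Proof. exact (linear_norm _ (bop_linear T)). Qed.

Lemma hnorm_ge0 (H : Hilbert) (x : H) : 0 <= norm x.
Proof. exact (norm_ge_0 x). Qed.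

Lemma hnorm_triangle (H : Hilbert) (x y : H) : norm (plus x y) <= norm x + norm y.
Proof. exact (norm_triangle x y). Qed.

Lemma hnorm_opp (H : Hilbert) (x : H) : norm (opp x) = norm x.
Proof. exact (norm_opp x). Qed.

Lemma hnorm_zero (H : Hilbert) : norm (zero : H) = 0.
Proof. exact (@norm_zero C_AbsRing H). Qed.

Lemma hnorm_eq0 (H : Hilbert) (x : H) : norm x = 0 -> x = zero.
Proof. exact (@norm_eq_zero C_AbsRing H x). Qed.

Lemma hnorm_sqr (H : Hilbert) (x : H) : norm x ^ 2 = Re (inner x x).
Proof. now rewrite inner_norm. Qed.

Lemma minus_swap_norm (H : Hilbert) (x y : H) : norm (minus x y) = norm (minus y x).
Proof. rewrite <- hnorm_opp; f_equal; exact (opp_minus x y). Qed.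

Lemma hnorm_plus_sqr (H : Hilbert) (x y : H) :
  norm (plus x y) ^ 2 = norm x ^ 2 + norm y ^ 2 + 2 * Re (inner x y).
Proof.
rewrite !hnorm_sqr, inner_plus_l, !inner_plus_r, (inner_conj x y).
destruct (inner x y), (inner x x), (inner y y); simpl; ring.
Qed.

Lemma hnorm_unique (H K : Hilbert) (x : H) (y : K) :
  inner x x = inner y y -> norm x = norm y.
Proof.
intros h.
assert (e : norm x ^ 2 = norm y ^ 2) by now rewrite !hnorm_sqr, h.
pose proof (hnorm_ge0 x); pose proof (hnorm_ge0 y).
apply Rsqr_inj; trivial; unfold Rsqr; nra.
Qed.

Lemma inner_eq0_of_small (H : Hilbert) (x y : H) :
  (forall e : posreal, exists z, inner z y = 0%C /\ norm (minus z x) < e) -> inner x y = 0%C.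
Proof.
intros h; apply Cmod_eq_0; apply Rle_antisym; [| apply Cmod_ge_0].
apply Rnot_lt_le; intros hp.
assert (pos : 0 < Cmod (inner x y) / (norm y + 1)).
{ apply Rdiv_lt_0_compat; [exact hp | pose proof (hnorm_ge0 y); lra]. }
destruct (h (mkposreal _ pos)) as [z [hz1 hz2]]; simpl in hz2.
assert (e : inner x y = (- inner (minus z x) y)%C).
{ unfold minus; rewrite inner_plus_l, inner_opp_l, hz1; ring. }
pose proof (inner_CS (minus z x) y) as cs.
rewrite e, Cmod_opp in hp, hz2.
pose proof (hnorm_ge0 y).
apply (Rmult_lt_compat_r (norm y + 1)) in hz2; [| lra].
unfold Rdiv in hz2; rewrite Rmult_assoc, Rinv_l, Rmult_1_r in hz2 by lra.
pose proof (hnorm_ge0 (minus z x)); nra.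
Qed.

Lemma inv_INR_pos (n : nat) : 0 < / INR (S n).
Proof. apply Rinv_0_lt_compat, lt_0_INR, Nat.lt_0_succ. Qed.

Lemma inv_INR_small (e : R) : 0 < e -> exists N : nat, forall n, (N <= n)%nat -> / INR (S n) < e.
Proof.
intros he; destruct (archimed_cor1 e he) as [N [h1 h2]]; exists N; intros n hn.
eapply Rle_lt_trans; [| exact h1].
apply Rinv_le_contravar; [now apply lt_0_INR | apply le_INR; lia].
Qed.

(** * The Riesz representation theorem *)

Section Riesz.

Variables (H : Hilbert) (phi : H -> C) (M : R).
Hypotheses (phi_plus : forall x y, phi (plus x y) = (phi x + phi y)%C)
  (phi_scal : forall (c : C) x, phi (scal c x) = (c * phi x)%C)
  (phi_bound : forall x, Cmod (phi x) <= M * norm x).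

(** If y0 represents [phi], then F y = |y - y0|^2 - |y0|^2, so the representing vector is sought as
    the minimizer of [F]. *)
Let F (y : H) : R := norm y ^ 2 - 2 * Re (phi y).

Lemma riesz_lower (y : H) : - M ^ 2 <= F y.
Proof.
unfold F.
pose proof (phi_bound y); pose proof (re_le_Cmod (phi y)).
pose proof (Rle_abs (Re (phi y))); pose proof (pow2_ge_0 (norm y - M)); nra.
Qed.

Lemma riesz_expand (y x : H) (t : R) :
  F (plus y (scal (RtoC t) x)) = F y + 2 * t * (Re (inner y x) - Re (phi x)) + t ^ 2 * norm x ^ 2.
Proof.
unfold F.
rewrite hnorm_plus_sqr, norm_scal_Hilbert, inner_scal_r, phi_plus, phi_scal, Cmod_R.
rewrite Rpow_mult_distr, pow2_abs.
destruct (inner y x), (phi x), (phi y); simpl; ring.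
Qed.

Lemma riesz_parallelogram (y z : H) :
  norm (minus y z) ^ 2 = 2 * (F y + F z - 2 * F (scal (RtoC (/ 2)) (plus y z))).
Proof.
unfold F, minus.
rewrite norm_scal_Hilbert, !hnorm_plus_sqr, hnorm_opp, inner_opp_r, Rpow_mult_distr, phi_scal, phi_plus, Cmod_R.
rewrite pow2_abs, hnorm_plus_sqr.
destruct (inner y z), (phi y), (phi z); simpl; field.
Qed.

Lemma riesz : exists y : H, forall x, phi x = inner x y.
Proof.
destruct (completeness (fun r => exists y, r = - F y)) as [m [ub lub]].
{ exists (M ^ 2); intros r [y ->]; pose proof (riesz_lower y); lra. }
{ exists (- F zero); now exists zero. }
assert (lo : forall y, - m <= F y) by (intros y; specialize (ub (- F y) (ex_intro _ y eq_refl)); lra).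
assert (near : forall n : nat, exists y, F y < - m + / INR (S n)).
{ intros n; apply NNPP; intros hn.
  pose proof (inv_INR_pos n) as p.
  assert (m <= m - / INR (S n)); [| lra].
  apply lub; intros r [y ->]; apply Rnot_lt_le; intros hl; apply hn; exists y; lra. }
destruct (choice _ near) as [u hu].
destruct (@Hilbert_cauchy_seq H u) as [y hy].
{ intros e; destruct (inv_INR_small (e := e ^ 2 / 4)) as [N hN].
  { pose proof (cond_pos e); nra. }
  exists N; intros n k hn hk.
  (* The midpoint value is at least -m, so |u_k - u_n|^2 is at most twice the sum of the two
     excesses over the infimum, each below e^2/4 past [N]. *)
  pose proof (riesz_parallelogram (u k) (u n)) as hp.
  pose proof (lo (scal (RtoC (/ 2)) (plus (u k) (u n)))).
  pose proof (hu n); pose proof (hu k); pose proof (hN n hn); pose proof (hN k hk).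
  pose proof (cond_pos e); pose proof (hnorm_ge0 (minus (u k) (u n))).
  apply Rnot_le_lt; intros hl; nra. }
assert (key : forall x, Re (inner y x) = Re (phi x)).
{ intros x.
  assert (approx : forall e, 0 < e -> Rabs (Re (inner y x) - Re (phi x)) <= e * (norm x ^ 2 + norm x + 1)).
  { intros e he.
    (* With F (u n) within e^2 of the infimum, steps of length [e] along x and -x bound the
       first-order term by a multiple of [e]. *)
    destruct (inv_INR_small (e := e ^ 2)) as [N1 h1]; [nra |].
    destruct (hy (mkposreal e he)) as [N2 h2]; simpl in h2.
    set (n := max N1 N2).
    specialize (h1 n (Nat.le_max_l _ _)); specialize (h2 n (Nat.le_max_r _ _)).
    specialize (hu n).
    pose proof (lo (plus (u n) (scal (RtoC e) x))) as l1; rewrite riesz_expand in l1.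
    pose proof (lo (plus (u n) (scal (RtoC (- e)) x))) as l2; rewrite riesz_expand in l2.
    assert (c : Rabs (Re (inner (u n) x) - Re (inner y x)) <= e * norm x).
    { eapply Rle_trans; [| apply Rmult_le_compat_r; [apply hnorm_ge0 | left; exact h2]].
      eapply Rle_trans; [| apply inner_CS].
      eapply Rle_trans; [| apply re_le_Cmod].
      right; unfold minus; rewrite inner_plus_l, inner_opp_l; f_equal; destruct (inner (u n) x), (inner y x); simpl; ring. }
    assert (d : Rabs (Re (inner (u n) x) - Re (phi x)) <= e * (norm x ^ 2 + 1)).
    { set (a := Re (inner (u n) x) - Re (phi x)) in *; set (b := norm x ^ 2) in *.
      apply Rabs_le; split; nra. }
    apply Rabs_le_between in c; apply Rabs_le_between in d; apply Rabs_le; lra. }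
  apply Rminus_diag_uniq; apply Rabs_eq_0; apply Rle_antisym; [| apply Rabs_pos].
  apply Rnot_lt_le; intros hl.
  set (a := Rabs _) in *; set (b := norm x ^ 2 + norm x + 1) in *.
  assert (bp : 0 < b) by (unfold b; pose proof (hnorm_ge0 x); pose proof (pow2_ge_0 (norm x)); lra).
  assert (q : 0 < a / (2 * b)) by (apply Rdiv_lt_0_compat; lra).
  specialize (approx _ q).
  replace (a / (2 * b) * b) with (a / 2) in approx by (field; lra); lra. }
exists y; intros x.
(* Only real parts are matched so far; the vector [scal Ci x] yields the imaginary parts. *)
pose proof (key x) as k1; pose proof (key (scal Ci x)) as k2.
rewrite inner_scal_r, phi_scal in k2.
rewrite (inner_conj y x).
destruct (inner y x) as [a b], (phi x) as [c d]; simpl in *.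
unfold Cconj; simpl; apply injective_projections; simpl; lra.
Qed.

End Riesz.

Section Adjoint.

Variables (H K : Hilbert) (T : bop H K).

(** [adj] is a choice by [epsilon]; the witness that gives it meaning is the Riesz vector of x |->
    <T x, y>. *)
Lemma adj_exists : exists S : bop K H, forall x y, inner (T x) y = inner x (S y).
Proof.
destruct (bop_bound T) as [M [Mpos hM]].
assert (h : forall y, exists z, forall x, inner (T x) y = inner x z).
{ intros y; apply (@riesz H (fun x => inner (T x) y) (M * norm y)).
  - intros u v; now rewrite bop_plus, inner_plus_l.
  - intros c u; now rewrite bop_scal, inner_scal_l.
  - intros x; eapply Rle_trans; [apply inner_CS |].
    pose proof (hM x); pose proof (hnorm_ge0 y); nra. }
destruct (choice _ h) as [S hS].
assert (lin : is_linear S).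
{ split.
  - intros y z; apply inner_ext; intros x.
    rewrite inner_conj, (inner_conj x (plus _ _)); f_equal.
    now rewrite <- hS, !inner_plus_r, !hS.
  - intros c y; apply inner_ext; intros x.
    rewrite inner_conj, (inner_conj x (scal _ _)); f_equal.
    now rewrite <- hS, !inner_scal_r, !hS.
  - exists M; split; [exact Mpos |]; intros y.
    change (norm (S y) <= M * norm y).
    pose proof (hnorm_ge0 (S y)) as p; pose proof (hnorm_ge0 y).
    assert (q : norm (S y) ^ 2 <= M * norm (S y) * norm y).
    { rewrite hnorm_sqr, <- hS.
      eapply Rle_trans; [apply Rle_abs |].
      eapply Rle_trans; [apply re_le_Cmod |].
      eapply Rle_trans; [apply inner_CS |].
      apply Rmult_le_compat_r; [apply hnorm_ge0 | apply hM]. }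
    destruct p as [p | p]; [| rewrite <- p; nra].
    apply Rmult_le_reg_l with (norm (S y)); [exact p |]; nra. }
exists (Bop lin); intros x y; exact (hS y x).
Qed.

Lemma adjP (x : H) (y : K) : inner (T x) y = inner x (T^*%B y).
Proof.
exact (epsilon_spec (inhabits bzero)
  (fun S : bop K H => forall x y, inner (T x) y = inner x (S y)) adj_exists x y).
Qed.

Lemma adjP' (x : H) (y : K) : inner (T^*%B y) x = inner y (T x).
Proof. now rewrite inner_conj, <- adjP, <- inner_conj. Qed.

Lemma adj_unique (S : bop K H) : (forall x y, inner (T x) y = inner x (S y)) -> (T^* = S)%B.
Proof.
intros h; apply bop_eq; intros y; apply inner_ext; intros x.
now rewrite adjP', inner_conj, h, <- inner_conj.
Qed.

End Adjoint.

Lemma adj_adj (H K : Hilbert) (T : bop H K) : (T^*^* = T)%B.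
Proof. apply adj_unique; intros x y; apply adjP'. Qed.

Lemma adj_comp (H K L : Hilbert) (S : bop K L) (T : bop H K) : ((S * T)^* = T^* * S^*)%B.
Proof. apply adj_unique; intros x y; simpl; now rewrite !adjP. Qed.

Lemma adj_add (H K : Hilbert) (S T : bop H K) : ((S + T)^* = S^* + T^*)%B.
Proof. apply adj_unique; intros x y; simpl; now rewrite inner_plus_l, inner_plus_r, !adjP. Qed.

Lemma adj_opp (H K : Hilbert) (T : bop H K) : ((- T)^* = - T^*)%B.
Proof. apply adj_unique; intros x y; simpl; now rewrite inner_opp_l, inner_opp_r, !adjP. Qed.

Lemma adj_scal (H K : Hilbert) (c : C) (T : bop H K) : ((c *: T)^* = Cconj c *: T^*)%B.
Proof.
apply adj_unique; intros x y; simpl.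
now rewrite inner_scal_l, inner_scal_r, Cconj_conj, adjP.
Qed.

Lemma adj_id (H : Hilbert) : (1^* = (1 : bop H H))%B.
Proof. now apply adj_unique. Qed.

Lemma bcompA (H K L M : Hilbert) (R : bop L M) (S : bop K L) (T : bop H K) :
  (R * (S * T) = R * S * T)%B.
Proof. now apply bop_eq. Qed.

Lemma bcomp1l (H K : Hilbert) (T : bop H K) : (1 * T = T)%B.
Proof. now apply bop_eq. Qed.

Lemma bcomp1r (H K : Hilbert) (T : bop H K) : (T * 1 = T)%B.
Proof. now apply bop_eq. Qed.

Lemma bop_fun_eq (H K : Hilbert) (S T : bop H K) : S = T -> forall x, S x = T x.
Proof. now intros ->. Qed.

Ltac hvec_push := unfold minus;
  repeat first [rewrite bop_plus | rewrite bop_opp | rewrite bop_scal | rewrite bop_zero].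
Ltac hbop := apply bop_eq; intros ?; simpl; hvec_push; hvec.

Lemma hdist_triangle (H : Hilbert) (x y z : H) :
  norm (minus x z) <= norm (minus x y) + norm (minus y z).
Proof.
replace (minus x z) with (plus (minus x y : H) (minus y z)) by hvec.
apply hnorm_triangle.
Qed.

Lemma hminus_plusK (H : Hilbert) (x y : H) : plus (minus x y : H) y = x.
Proof. hvec. Qed.

Lemma hminus_eq0 (H : Hilbert) (x y : H) : minus x y = zero -> x = y.
Proof. intros h; rewrite <- (hminus_plusK x y), h; hvec. Qed.

Lemma C_eq_of_small (a b : C) (K : R) :
  (forall e, 0 < e -> Cmod (a - b) <= e * K) -> a = b.
Proof.
intros h.
assert (z : (a - b = 0)%C).
{ apply Cmod_eq_0; apply Rle_antisym; [| apply Cmod_ge_0]; apply Rnot_lt_le; intros hp.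
  set (m := Cmod (a - b)) in *.
  assert (0 < Rabs K + 1) by (pose proof (Rabs_pos K); lra).
  assert (q : 0 < m / (2 * (Rabs K + 1))) by (apply Rdiv_lt_0_compat; lra).
  specialize (h _ q).
  assert (m / (2 * (Rabs K + 1)) * K <= m / (2 * (Rabs K + 1)) * (Rabs K + 1)).
  { apply Rmult_le_compat_l; [lra | pose proof (Rle_abs K); lra]. }
  replace (m / (2 * (Rabs K + 1)) * (Rabs K + 1)) with (m / 2) in H0 by (field; lra).
  lra. }
replace a with (a - b + b)%C by ring; rewrite z; ring.
Qed.

Lemma inner_minus_l (H : Hilbert) (x y z : H) : inner (minus x y) z = (inner x z - inner y z)%C.
Proof. unfold minus; now rewrite inner_plus_l, inner_opp_l. Qed.

Lemma inner_minus_r (H : Hilbert) (x y z : H) : inner x (minus y z) = (inner x y - inner x z)%C.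
Proof. unfold minus; now rewrite inner_plus_r, inner_opp_r. Qed.

Lemma hminus_zero (H : Hilbert) (x : H) : minus x zero = x.
Proof. hvec. Qed.

Lemma hminus_eq_zero (H : Hilbert) (x : H) : minus x x = zero.
Proof. hvec. Qed.

Lemma bcompE (H K L : Hilbert) (S : bop K L) (T : bop H K) x : (S * T)%B x = S (T x).
Proof. reflexivity. Qed.
Lemma baddE (H K : Hilbert) (S T : bop H K) x : (S + T)%B x = plus (S x) (T x).
Proof. reflexivity. Qed.
Lemma boppE (H K : Hilbert) (T : bop H K) x : (- T)%B x = opp (T x).
Proof. reflexivity. Qed.
Lemma bscalE (H K : Hilbert) c (T : bop H K) x : (c *: T)%B x = scal c (T x).
Proof. reflexivity. Qed.
Lemma bidE (H : Hilbert) (x : H) : (1 : bop H H)%B x = x.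
Proof. reflexivity. Qed.

(* Unlike [simpl], leaves named operators folded. *)
Ltac bopE := repeat first
  [rewrite bcompE | rewrite baddE | rewrite boppE | rewrite bscalE | rewrite bidE].
Ltac bopE_in h := repeat first
  [rewrite bcompE in h | rewrite baddE in h | rewrite boppE in h | rewrite bscalE in h | rewrite bidE in h].
(* Turns an equation of operators into a rewrite rule for applied vectors, with composites expanded
   so as to match terms unfolded by [bopE]. *)
Tactic Notation "pointwise" constr(h) "as" ident(e) :=
  pose proof (bop_fun_eq h) as e;
  let x := fresh in let k := fresh in
  match type of e with forall y : ?A, _ =>
    eassert (k : forall x : A, _) by (intros x; generalize (e x); intros k; bopE_in k; exact k);
    clear e; rename k into e end.

(** * Positive square roots *)

Definition hlim (H : Hilbert) (u : nat -> H) (x : H) : Prop :=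
  forall e, 0 < e -> exists N : nat, forall n, (N <= n)%nat -> norm (minus (u n) x) < e.

Lemma hlim_unique (H : Hilbert) (u : nat -> H) (x y : H) : hlim u x -> hlim u y -> x = y.
Proof.
intros hx hy.
assert (h : norm (minus x y) = 0).
{ apply Rle_antisym; [| apply hnorm_ge0]; apply Rnot_lt_le; intros hp.
  destruct (hx (norm (minus x y) / 2)) as [N1 h1]; [lra |].
  destruct (hy (norm (minus x y) / 2)) as [N2 h2]; [lra |].
  specialize (h1 _ (Nat.le_max_l N1 N2)); specialize (h2 _ (Nat.le_max_r N1 N2)).
  rewrite minus_swap_norm in h1.
  pose proof (hdist_triangle x (u (max N1 N2)) y); lra. }
exact (hminus_eq0 (hnorm_eq0 h)).
Qed.

Lemma hlim_plus (H : Hilbert) (u v : nat -> H) (x y : H) :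
  hlim u x -> hlim v y -> hlim (fun n => plus (u n) (v n)) (plus x y).
Proof.
intros hx hy e he.
destruct (hx (e / 2)) as [N1 h1]; [lra |].
destruct (hy (e / 2)) as [N2 h2]; [lra |].
exists (max N1 N2); intros n hn.
replace (minus (plus (u n) (v n)) (plus x y)) with (plus (minus (u n) x) (minus (v n) y)).
2: { apply inner_ext; intros z; unfold minus; rewrite !inner_plus_l, !inner_opp_l, !inner_plus_l; ring. }
eapply Rle_lt_trans; [apply hnorm_triangle |].
specialize (h1 n ltac:(lia)); specialize (h2 n ltac:(lia)); lra.
Qed.

Lemma hlim_const (H : Hilbert) (x : H) : hlim (fun _ => x) x.
Proof.
intros e he; exists O; intros n _.
replace (minus x x) with (zero : H) by hvec.
now rewrite hnorm_zero.
Qed.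

Lemma hlim_bop (H K : Hilbert) (T : bop H K) (u : nat -> H) (x : H) :
  hlim u x -> hlim (fun n => T (u n)) (T x).
Proof.
intros hx e he; destruct (bop_bound T) as [M [hM hT]].
destruct (hx (e / M)) as [N hN]; [now apply Rdiv_lt_0_compat |].
exists N; intros n hn; rewrite <- bop_minus.
eapply Rle_lt_trans; [apply hT |].
specialize (hN n hn).
apply (Rmult_lt_compat_l M) in hN; [| exact hM].
replace (M * (e / M)) with e in hN by (field; lra); exact hN.
Qed.

Lemma hlim_ext (H : Hilbert) (u v : nat -> H) (x : H) :
  (forall n, u n = v n) -> hlim u x -> hlim v x.
Proof. intros h hx e he; destruct (hx e he) as [N hN]; exists N; intros n hn; rewrite <- h; auto. Qed.

Lemma hlim_S (H : Hilbert) (u : nat -> H) (x : H) : hlim u x -> hlim (fun n => u (S n)) x.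
Proof. intros hx e he; destruct (hx e he) as [N hN]; exists N; intros n hn; apply hN; lia. Qed.

Lemma hlim_norm_le (H : Hilbert) (u : nat -> H) (x : H) (M : R) :
  hlim u x -> (forall n, norm (u n) <= M) -> norm x <= M.
Proof.
intros hx hM; apply Rnot_lt_le; intros hl.
destruct (hx (norm x - M)) as [N hN]; [lra |].
specialize (hN N (le_n N)); specialize (hM N).
pose proof (hnorm_triangle (minus x (u N)) (u N)) as t.
rewrite hminus_plusK, minus_swap_norm in t; lra.
Qed.

Lemma hlim_cauchy (H : Hilbert) (u : nat -> H) (a : nat -> R) :
  ex_finite_lim_seq a ->
  (forall n m, (n <= m)%nat -> norm (minus (u m) (u n)) <= a m - a n) ->
  exists x, hlim u x.
Proof.
intros ha hu.
apply ex_lim_seq_cauchy_corr in ha.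
destruct (@Hilbert_cauchy_seq H u) as [x hx].
{ intros e; destruct (ha e) as [N hN]; exists N; intros n m hn hm.
  destruct (Nat.le_ge_cases n m) as [h | h].
  - eapply Rle_lt_trans; [now apply hu |].
    eapply Rle_lt_trans; [apply Rle_abs | now apply hN].
  - rewrite minus_swap_norm.
    eapply Rle_lt_trans; [now apply hu |].
    eapply Rle_lt_trans; [apply Rle_abs | now apply hN]. }
exists x; intros e he; exact (hx (mkposreal e he)).
Qed.

Lemma bop_limit (H : Hilbert) (Y : nat -> bop H H) :
  (forall n x, norm (Y n x) <= norm x) ->
  (forall x, exists y, hlim (fun n => Y n x) y) ->
  exists L : bop H H, (forall x, hlim (fun n => Y n x) (L x)) /\ forall x, norm (L x) <= norm x.
Proof.
intros hb hc; destruct (choice _ hc) as [L hL].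
assert (lin : is_linear L).
{ split.
  - intros x y; apply (@hlim_unique _ (fun n => Y n (plus x y))); [apply hL |].
    apply hlim_ext with (fun n => plus (Y n x) (Y n y)); [intros n; symmetry; apply bop_plus |].
    now apply hlim_plus.
  - intros c x; apply (@hlim_unique _ (fun n => Y n (scal c x))); [apply hL |].
    apply hlim_ext with (fun n => scal c (Y n x)); [intros n; symmetry; apply bop_scal |].
    exact (@hlim_bop H H (c *: 1)%B _ _ (hL x)).
  - exists 1; split; [lra |]; intros x; rewrite Rmult_1_l.
    apply (hlim_norm_le (hL x)); intros n; apply hb. }
exists (Bop lin); split; [exact hL |].
intros x; apply (hlim_norm_le (hL x)); intros n; apply hb.
Qed.

Lemma hlim_inner_eq (H : Hilbert) (u v : nat -> H) (x y a b : H) :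
  hlim u x -> hlim v y -> (forall n, inner (u n) b = inner a (v n)) -> inner x b = inner a y.
Proof.
intros hu hv h; apply C_eq_of_small with (norm b + norm a); intros e he.
destruct (hu e he) as [N1 h1]; destruct (hv e he) as [N2 h2].
specialize (h1 _ (Nat.le_max_l N1 N2)); specialize (h2 _ (Nat.le_max_r N1 N2)).
set (n := max N1 N2) in *.
replace (inner x b - inner a y)%C with (- inner (minus (u n) x) b + inner a (minus (v n) y))%C.
2: { rewrite inner_minus_l, inner_minus_r, h; ring. }
eapply Rle_trans; [apply Cmod_triangle |]; rewrite Cmod_opp.
pose proof (inner_CS (minus (u n) x) b); pose proof (inner_CS a (minus (v n) y)).
pose proof (hnorm_ge0 a); pose proof (hnorm_ge0 b); nra.
Qed.

Section SquareRoot.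

Variables (H : Hilbert) (X : bop H H).
Hypotheses (X_contr : contraction X) (X_self : (X^* = X)%B).

(* [1 - Y] is a square root of [1 - X] when [Y] is a fixed point of [Y |-> (X + Y^2) / 2];
   [y_iter] is the scalar majorant, obtained for [X = 1]. *)
Fixpoint Y_iter (n : nat) : bop H H :=
  match n with O => 0 | S k => RtoC (/ 2) *: (X + Y_iter k * Y_iter k) end%B.

Fixpoint y_iter (n : nat) : R :=
  match n with O => 0 | S k => / 2 * (1 + y_iter k * y_iter k) end.

Lemma y_iter_bounds n : 0 <= y_iter n <= 1.
Proof. induction n as [| n IH]; simpl; [lra | nra]. Qed.

Lemma y_iter_incr n : y_iter n <= y_iter (S n).
Proof.
pose proof (y_iter_bounds n); simpl; pose proof (pow2_ge_0 (1 - y_iter n)); nra.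
Qed.

Lemma Y_iter_S n x :
  Y_iter (S n) x = scal (RtoC (/ 2)) (plus (X x) (Y_iter n (Y_iter n x))).
Proof. reflexivity. Qed.

Lemma Y_iter_bound n x : norm (Y_iter n x) <= y_iter n * norm x.
Proof.
revert x; induction n as [| n IH]; intros x.
- change (y_iter 0) with 0; rewrite Rmult_0_l; right; exact (hnorm_zero H).
- change (y_iter (S n)) with (/ 2 * (1 + y_iter n * y_iter n)).
  rewrite Y_iter_S, norm_scal_Hilbert, Cmod_R, Rabs_pos_eq by lra.
  pose proof (hnorm_triangle (X x) (Y_iter n (Y_iter n x))).
  pose proof (X_contr x); pose proof (IH x); pose proof (IH (Y_iter n x)).
  pose proof (y_iter_bounds n).
  assert (y_iter n * norm (Y_iter n x) <= y_iter n * (y_iter n * norm x)).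
  { apply Rmult_le_compat_l; lra. }
  lra.
Qed.

Lemma Y_iter_contr n x : norm (Y_iter n x) <= norm x.
Proof.
pose proof (Y_iter_bound n x); pose proof (y_iter_bounds n); pose proof (hnorm_ge0 x); nra.
Qed.

(** Twice the next difference is Y_{n+1}^2 - Y_n^2 = Y_{n+1} (Y_{n+1} - Y_n) + (Y_{n+1} - Y_n) Y_n,
    a factorization that does not presuppose commutation; the scalars [y_iter] satisfy the same
    identity, so the bound propagates. *)
Lemma Y_iter_step n x :
  norm (minus (Y_iter (S n) x) (Y_iter n x)) <= (y_iter (S n) - y_iter n) * norm x.
Proof.
revert x; induction n as [| n IH]; intros x.
- assert (e : minus (Y_iter 1 x) (Y_iter 0 x) = Y_iter 1 x).
  { change (Y_iter 0 x) with (zero : H); hvec. }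
  rewrite e; change (y_iter 0) with 0; rewrite Rminus_0_r; apply Y_iter_bound.
- set (a := y_iter (S n)); set (b := y_iter n).
  assert (e : minus (Y_iter (S (S n)) x) (Y_iter (S n) x) =
    scal (RtoC (/ 2)) (plus (Y_iter (S n) (minus (Y_iter (S n) x) (Y_iter n x)))
                    (minus (Y_iter (S n) (Y_iter n x)) (Y_iter n (Y_iter n x))))).
  { rewrite bop_minus, (Y_iter_S (S n) x).
    apply inner_ext; intros z; rewrite inner_minus_l.
    rewrite (Y_iter_S n x) at 2.
    unfold minus; rewrite !inner_scal_l, !inner_plus_l, !inner_opp_l; ring. }
  rewrite e, norm_scal_Hilbert, Cmod_R, Rabs_pos_eq by lra.
  pose proof (hnorm_triangle (Y_iter (S n) (minus (Y_iter (S n) x) (Y_iter n x)))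
                 (minus (Y_iter (S n) (Y_iter n x)) (Y_iter n (Y_iter n x)))) as t.
  pose proof (IH x) as i1; pose proof (IH (Y_iter n x)) as i2.
  pose proof (Y_iter_bound (S n) (minus (Y_iter (S n) x) (Y_iter n x))) as j1.
  pose proof (Y_iter_bound n x) as j2.
  pose proof (y_iter_bounds (S n)) as b1; pose proof (y_iter_bounds n) as b2.
  pose proof (y_iter_incr n) as b3.
  fold a b in i1, i2, j1, j2, b1, b2, b3.
  change (y_iter (S (S n))) with (/ 2 * (1 + a * a)).
  assert (ea : a = / 2 * (1 + b * b)) by reflexivity.
  assert (k1 : a * norm (minus (Y_iter (S n) x) (Y_iter n x)) <= a * ((a - b) * norm x))
    by (apply Rmult_le_compat_l; lra).
  assert (k2 : (a - b) * norm (Y_iter n x) <= (a - b) * (b * norm x))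
    by (apply Rmult_le_compat_l; lra).
  clearbody a b.
  apply Rle_trans with (/ 2 * (a * ((a - b) * norm x) + (a - b) * (b * norm x))); [lra |].
  right; rewrite ea at 6; field.
Qed.

Lemma Y_iter_cauchy x n m : (n <= m)%nat ->
  norm (minus (Y_iter m x) (Y_iter n x)) <= y_iter m * norm x - y_iter n * norm x.
Proof.
induction 1 as [| m hm IH].
- replace (minus (Y_iter n x) (Y_iter n x)) with (zero : H) by hvec.
  rewrite hnorm_zero; lra.
- replace (minus (Y_iter (S m) x) (Y_iter n x)) with
    (plus (minus (Y_iter (S m) x) (Y_iter m x)) (minus (Y_iter m x) (Y_iter n x))) by hvec.
  eapply Rle_trans; [apply hnorm_triangle |].
  pose proof (Y_iter_step m x); lra.
Qed.

Lemma Y_exists : exists Y : bop H H,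
  (forall x, hlim (fun n => Y_iter n x) (Y x)) /\ forall x, norm (Y x) <= norm x.
Proof.
apply bop_limit; [exact Y_iter_contr |]; intros x.
apply (@hlim_cauchy H _ (fun n => y_iter n * norm x)).
- apply (ex_finite_lim_seq_incr _ (norm x)).
  + intros n; apply Rmult_le_compat_r; [apply hnorm_ge0 | apply y_iter_incr].
  + intros n; pose proof (y_iter_bounds n); pose proof (hnorm_ge0 x); nra.
- intros n m; apply Y_iter_cauchy.
Qed.

Definition Y_lim : bop H H := epsilon (inhabits bzero) (fun Y : bop H H =>
  (forall x, hlim (fun n => Y_iter n x) (Y x)) /\ forall x, norm (Y x) <= norm x).

Lemma Y_limP : (forall x, hlim (fun n => Y_iter n x) (Y_lim x)) /\ forall x, norm (Y_lim x) <= norm x.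
Proof. apply (epsilon_spec (inhabits bzero) (fun Y : bop H H =>
  (forall x, hlim (fun n => Y_iter n x) (Y x)) /\ forall x, norm (Y x) <= norm x) Y_exists). Qed.

Lemma Y_lim_fixed : (Y_lim = RtoC (/ 2) *: (X + Y_lim * Y_lim))%B.
Proof.
destruct Y_limP as [hY hb].
apply bop_eq; intros x; apply (hlim_unique (u := fun n => Y_iter (S n) x)).
- exact (hlim_S (hY x)).
- apply (@hlim_bop H H (RtoC (/ 2) *: 1)%B
    (fun n => plus (X x) (Y_iter n (Y_iter n x))) (plus (X x) (Y_lim (Y_lim x)))).
  apply (hlim_plus (hlim_const (X x))).
  (* Y_n Y_n x is split as Y_n (Y_n x - Y x) + Y_n Y x; the first term tends to zero because all Y_n
     are contractions. *)
  apply hlim_ext with (fun n => plus (Y_iter n (minus (Y_iter n x) (Y_lim x))) (Y_iter n (Y_lim x))).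
  { intros n; rewrite <- bop_plus, hminus_plusK; reflexivity. }
  replace (Y_lim (Y_lim x)) with (plus (zero : H) (Y_lim (Y_lim x))) by hvec.
  apply hlim_plus; [| apply hY].
  intros e he; destruct (hY x e he) as [N hN]; exists N; intros n hn.
  rewrite hminus_zero.
  eapply Rle_lt_trans; [apply Y_iter_contr | now apply hN].
Qed.

Lemma Y_iter_self n : ((Y_iter n)^* = Y_iter n)%B.
Proof.
induction n as [| n IH]; simpl.
- apply adj_unique; intros x y; simpl; now rewrite inner_zero_l, inner_zero_r.
- rewrite adj_scal, adj_add, adj_comp, IH, X_self; f_equal.
  apply injective_projections; simpl; ring.
Qed.

Lemma Y_lim_self : (Y_lim^* = Y_lim)%B.
Proof.
destruct Y_limP as [hY _].
apply adj_unique; intros x y; apply (hlim_inner_eq (hY x) (hY y)); intros n.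
rewrite adjP; f_equal; now rewrite Y_iter_self.
Qed.

End SquareRoot.

Lemma Y_iter_intertwine (H K : Hilbert) (X : bop H H) (Z : bop K K) (T : bop H K) :
  (T * X = Z * T)%B -> forall n, (T * Y_iter X n = Y_iter Z n * T)%B.
Proof.
intros h n; induction n as [| n IH].
- hbop.
- pose proof (bop_fun_eq h) as h'; pose proof (bop_fun_eq IH) as i; simpl in h', i.
  apply bop_eq; intros x; simpl.
  now rewrite bop_scal, bop_plus, h', !i.
Qed.

(** The iterates are polynomials in [X], so an intertwining relation passes through each of them and
    to the limit. This stands in for functional calculus: it gives both the uniqueness of the root
    and P^* D_{P^*} = D_P P^*. *)
Lemma Y_lim_intertwine (H K : Hilbert) (X : bop H H) (Z : bop K K) (T : bop H K) :
  contraction X -> contraction Z ->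
  (T * X = Z * T)%B -> (T * Y_lim X = Y_lim Z * T)%B.
Proof.
intros hX hZ h.
apply bop_eq; intros x; simpl.
apply (hlim_unique (u := fun n => T (Y_iter X n x))).
- apply hlim_bop, Y_limP, hX.
- apply hlim_ext with (fun n => Y_iter Z n (T x)); [| apply Y_limP, hZ].
  intros n; symmetry; exact (bop_fun_eq (Y_iter_intertwine h n) x).
Qed.

(** Polarization: reality of the form at x + y and at x + i y fixes the imaginary and the real part
    of <S x, y> - <x, S y>. *)
Lemma positive_self (H : Hilbert) (S : bop H H) : positive S -> (S^* = S)%B.
Proof.
intros hS; apply adj_unique; intros x y.
pose proof (proj1 (hS x)) as e1; pose proof (proj1 (hS y)) as e2.
pose proof (proj1 (hS (plus x y))) as e3.
pose proof (proj1 (hS (plus x (scal Ci y)))) as e4.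
rewrite bop_plus, inner_plus_l, !inner_plus_r in e3.
rewrite bop_plus, bop_scal, inner_plus_l, !inner_plus_r, !inner_scal_l, !inner_scal_r in e4.
rewrite (inner_conj (S y) x).
destruct (inner (S x) x), (inner (S y) y), (inner (S x) y), (inner (S y) x).
unfold Cconj; simpl in *; apply injective_projections; simpl; lra.
Qed.

(** Along y + t S y the form is 2 t |S y|^2 + t^2 <S S y, S y>; a nonnegative quadratic without
    constant term has no linear term. *)
Lemma positive_null (H : Hilbert) (S : bop H H) (y : H) :
  positive S -> Re (inner (S y) y) = 0 -> S y = zero.
Proof.
intros hS h0.
set (a := norm (S y) ^ 2); set (b := Re (inner (S (S y)) (S y))).
assert (q : forall t : R, 0 <= 2 * t * a + t ^ 2 * b).
{ intros t; pose proof (proj2 (hS (plus y (scal (RtoC t) (S y))))) as h.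
  rewrite bop_plus, bop_scal, inner_plus_l, !inner_plus_r, !inner_scal_l, !inner_scal_r in h.
  rewrite (adjP S (S y) y), (positive_self hS) in h.
  unfold a, b; rewrite hnorm_sqr.
  eapply Rle_trans; [exact h |]; right.
  destruct (inner (S y) y), (inner (S y) (S y)), (inner (S (S y)) (S y)); simpl in *.
  rewrite h0; ring. }
apply hnorm_eq0.
assert (b0 : 0 <= b) by exact (proj2 (hS (S y))).
assert (a0 : 0 <= a) by apply pow2_ge_0.
assert (az : a = 0).
(* The minimizer -a/b with b + 1 in place of [b], which may vanish; the value there is -(a/(b+1))^2
   (b+2). *)
{ specialize (q (- a / (b + 1))).
  assert (e : 2 * (- a / (b + 1)) * a + (- a / (b + 1)) ^ 2 * b
            = - (a / (b + 1)) ^ 2 * (b + 2)) by (field; lra).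
  rewrite e in q.
  assert (z : a / (b + 1) = 0) by nra.
  replace a with (a / (b + 1) * (b + 1)) by (field; lra); rewrite z; ring. }
unfold a in az; pose proof (hnorm_ge0 (S y)); nra.
Qed.

(** For y = (S - R) x the hypotheses give (S + R) y = 0, so both nonnegative forms vanish at y and S
    y = R y = 0; then |y|^2 = <x, (S - R) y> = 0. *)
Lemma positive_sqrt_unique (H : Hilbert) (S R : bop H H) :
  positive S -> positive R -> (S * R = R * S)%B -> (S * S = R * R)%B -> S = R.
Proof.
intros hS hR hc he.
pose proof (bop_fun_eq hc) as c; pose proof (bop_fun_eq he) as e; simpl in c, e.
assert (null : forall x, S (minus (S x) (R x)) = zero /\ R (minus (S x) (R x)) = zero).
{ intros x; set (y := minus (S x) (R x)).
  assert (k : plus (S y) (R y) = zero).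
  { unfold y; rewrite !bop_minus, <- e, c; hvec. }
  assert (k' : Re (inner (S y) y) + Re (inner (R y) y) = 0).
  { rewrite <- re_plus, <- inner_plus_l, k, inner_zero_l; reflexivity. }
  pose proof (proj2 (hS y)); pose proof (proj2 (hR y)).
  split; apply positive_null; trivial; lra. }
apply bop_eq; intros x.
apply hminus_eq0, inner_self_zero.
rewrite inner_minus_l, (adjP S), (adjP R), (positive_self hS), (positive_self hR).
destruct (null x) as [-> ->]; rewrite !inner_zero_r; ring.
Qed.

Section RootOfComplement.

Variables (H : Hilbert) (X : bop H H).
Hypotheses (X_contr : contraction X) (X_self : (X^* = X)%B).

Lemma root_positive : positive (1 - Y_lim X)%B.
Proof.
intros x; simpl; rewrite inner_plus_l, inner_opp_l, inner_norm.
pose proof (adjP' (Y_lim X) x x) as h; rewrite Y_lim_self, (inner_conj (Y_lim X x) x) in h by trivial.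
pose proof (inner_CS (Y_lim X x) x) as cs.
pose proof (proj2 (Y_limP X_contr) x) as b.
pose proof (re_le_Cmod (inner (Y_lim X x) x)) as r; apply Rabs_le_between in r.
assert (norm (Y_lim X x) * norm x <= norm x * norm x).
{ apply Rmult_le_compat_r; [apply hnorm_ge0 | exact b]. }
destruct (inner (Y_lim X x) x) as [u v]; unfold Cconj in h; simpl in *.
injection h; intros; split; lra.
Qed.

(** The fixed-point equation 2 Y = X + Y^2, rearranged. *)
Lemma root_square : ((1 - Y_lim X) * (1 - Y_lim X) = 1 - X)%B.
Proof.
pose proof (bop_fun_eq (Y_lim_fixed X_contr)) as e; simpl in e.
apply bop_eq; intros x; simpl; rewrite bop_plus, bop_opp.
set (y := Y_lim X x) in *.
assert (k : plus y y = plus (X x) (Y_lim X y)).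
{ unfold y at 1 2; rewrite e; fold y.
  apply inner_ext; intros z; rewrite !inner_plus_l, !inner_scal_l, !inner_plus_l.
  destruct (inner (X x) z), (inner (Y_lim X y) z); apply injective_projections; simpl; field. }
apply inner_ext; intros z; pose proof (f_equal (fun v => inner v z) k) as kz; simpl in kz.
repeat first [rewrite inner_plus_l in * | rewrite inner_opp_l in *].
replace (inner (Y_lim X y) z) with (inner (X x) z + inner (Y_lim X y) z - inner (X x) z)%C by ring.
rewrite <- kz; ring.
Qed.

(** Identifies the [epsilon] choice with the constructed root. Any positive root S commutes with S^2
    = 1 - X, hence with [X] and with the limit [Y_lim X], so uniqueness among commuting roots
    applies. *)
Lemma bsqrtP : bsqrt (1 - X)%B = (1 - Y_lim X)%B.
Proof.
assert (ex : exists S : bop H H, positive S /\ (S * S = 1 - X)%B).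
{ exists (1 - Y_lim X)%B; split; [exact root_positive | exact root_square]. }
pose proof (epsilon_spec (inhabits bzero) _ ex) as [h1 h2].
change (epsilon (inhabits bzero) (fun S : bop H H => positive S /\ (S * S)%B = (1 - X)%B))
  with (bsqrt (1 - X)%B) in h1, h2.
apply positive_sqrt_unique; [exact h1 | exact root_positive | | now rewrite h2, root_square].
set (S := bsqrt (1 - X)%B) in *.
assert (c : (S * X = X * S)%B).
{ assert (k : (S * (1 - X) = (1 - X) * S)%B) by (rewrite <- h2; apply bcompA).
  pose proof (bop_fun_eq k) as k'; simpl in k'.
  apply bop_eq; intros x; specialize (k' x); simpl; rewrite bop_plus, bop_opp in k'.
  apply inner_ext; intros z; pose proof (f_equal (fun v => inner v z) k') as kz; simpl in kz.
  rewrite !inner_plus_l, !inner_opp_l in kz.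
  replace (inner (S (X x)) z) with (inner (S x) z - (inner (S x) z + - inner (S (X x)) z))%C by ring.
  rewrite kz; ring. }
pose proof (bop_fun_eq (Y_lim_intertwine X_contr X_contr c)) as y; simpl in y.
apply bop_eq; intros x; simpl; now rewrite bop_plus, bop_opp, y.
Qed.

End RootOfComplement.

Lemma bsqrt_intertwine (H K : Hilbert) (X : bop H H) (Z : bop K K) (T : bop H K) :
  contraction X -> (X^* = X)%B ->
  contraction Z -> (Z^* = Z)%B ->
  (T * X = Z * T)%B -> (T * bsqrt (1 - X) = bsqrt (1 - Z) * T)%B.
Proof.
intros hX sX hZ sZ h; rewrite !bsqrtP by trivial.
pose proof (bop_fun_eq (Y_lim_intertwine hX hZ h)) as y; simpl in y.
apply bop_eq; intros x; simpl; now rewrite bop_plus, bop_opp, y.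
Qed.

(** * Defect and fundamental operators *)

Lemma adj_contr (H K : Hilbert) (T : bop H K) :
  contraction T -> forall y, norm (T^*%B y) <= norm y.
Proof.
intros hT y.
assert (h : norm (T^*%B y) ^ 2 <= norm (T^*%B y) * norm y).
{ rewrite hnorm_sqr, <- adjP.
  eapply Rle_trans; [apply Rle_abs |].
  eapply Rle_trans; [apply re_le_Cmod |].
  eapply Rle_trans; [apply inner_CS |].
  apply Rmult_le_compat_r; [apply hnorm_ge0 | apply hT]. }
pose proof (hnorm_ge0 (T^*%B y)); pose proof (hnorm_ge0 y); nra.
Qed.

(** A corestricted operator has dense range, and the kernel of its adjoint is the orthogonal
    complement of that range. *)
Lemma corestrict_adj_inj (H K : Hilbert) (T : bop H K) (y : ranH T) :
  (corestrict T)^*%B y = zero -> y = zero.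
Proof.
intros h; apply inner_self_zero.
change (inner (proj1_sig y) (proj1_sig y) = 0%C).
apply inner_eq0_of_small; intros e.
destruct (proj1 (closed_rangeP T (proj1_sig y)) (proj2_sig y) e) as [x hx].
exists (T x); split; [| exact hx].
change (inner (corestrict T x) y = 0%C).
now rewrite adjP, h, inner_zero_r.
Qed.

(** Identities on a defect space are checked after composition with the defect map: density of its
    range allows cancelling it on the right, and [corestrict_adj_mono] cancels its adjoint on the
    left. *)
Lemma corestrict_epi (H K L : Hilbert) (T : bop H K) (S R : bop (ranH T) L) :
  (S * corestrict T = R * corestrict T)%B -> S = R.
Proof.
intros h.
assert (e : (S^* = R^*)%B).
{ pose proof (f_equal (@adj _ _) h) as h0; rewrite !adj_comp in h0; pointwise h0 as h'.
  apply bop_eq; intros z.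
  apply hminus_eq0, (@corestrict_adj_inj _ _ T); rewrite bop_minus, h'; hvec. }
now rewrite <- (adj_adj S), e, adj_adj.
Qed.

Lemma corestrict_adj_mono (H K L : Hilbert) (T : bop H K) (S R : bop L (ranH T)) :
  ((corestrict T)^* * S = (corestrict T)^* * R)%B -> S = R.
Proof.
intros h; pose proof (bop_fun_eq h) as h'; simpl in h'.
apply bop_eq; intros z.
apply hminus_eq0, (@corestrict_adj_inj _ _ T); rewrite bop_minus, h'; hvec.
Qed.

Lemma corestrict_adj (H : Hilbert) (T : bop H H) :
  (T^* = T)%B -> ((corestrict T)^* = T * ran_incl T)%B.
Proof.
intros sT; apply adj_unique; intros x y.
change (inner (T x) (ran_incl T y) = inner x (T (ran_incl T y))).
now rewrite adjP, sT.
Qed.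

Lemma ran_incl_isometry (H K : Hilbert) (T : bop H K) : ((ran_incl T)^* * ran_incl T = 1)%B.
Proof.
apply bop_eq; intros y; apply inner_ext; intros z; bopE.
now rewrite adjP'.
Qed.

Section Defect.

Variables (H : Hilbert) (P : bop H H).
Hypothesis P_contr : contraction P.

Local Notation d := (to_defect P).
Local Notation ds := (to_defect P^*).
Local Notation Th := (adj_defect P).

Lemma adj_mul_contr (H' : Hilbert) (T : bop H' H') : contraction T ->
  forall x, norm ((T^* * T)%B x) <= norm x.
Proof.
intros hT x; simpl; eapply Rle_trans; [now apply adj_contr | apply hT].
Qed.

Lemma adj_mul_self (H' : Hilbert) (T : bop H' H') : ((T^* * T)^* = T^* * T)%B.
Proof. now rewrite adj_comp, adj_adj. Qed.

Lemma defectP (H' : Hilbert) (T : bop H' H') : contraction T ->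
  ((defect T)^* = defect T)%B /\ (defect T * defect T = 1 - T^* * T)%B.
Proof.
intros hT; unfold defect.
pose proof (adj_mul_contr hT); pose proof (adj_mul_self T).
rewrite bsqrtP by trivial; split.
- now apply positive_self, root_positive.
- now apply root_square.
Qed.

Lemma to_defect_adj (H' : Hilbert) (T : bop H' H') : contraction T ->
  ((to_defect T)^* = defect T * of_defect T)%B.
Proof. intros hT; now apply corestrict_adj, defectP. Qed.

Lemma to_defect_sqr (H' : Hilbert) (T : bop H' H') : contraction T ->
  ((to_defect T)^* * to_defect T = 1 - T^* * T)%B.
Proof.
intros hT; rewrite to_defect_adj by trivial.
rewrite <- (proj2 (defectP hT)); now apply bop_eq.
Qed.

Lemma defect_intertwine : (P^* * defect P^* = defect P * P^*)%B.
Proof.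
pose proof (adj_contr P_contr) as hs.
apply bsqrt_intertwine; try apply adj_mul_self; try (now apply adj_mul_contr).
rewrite adj_adj; now apply bop_eq.
Qed.

(** Since P^* D_{P^*} = D_P P^* takes values in the range of [D_P], the projection inside
    [adj_defect] acts as the identity. *)
Lemma adj_defect_to : (Th * ds = d * P^*)%B.
Proof.
pointwise defect_intertwine as e.
pointwise (ran_incl_isometry (defect P)) as i.
apply bop_eq; intros x; unfold adj_defect; bopE.
change (of_defect P^* (ds x)) with (defect P^* x).
rewrite e.
change (defect P (P^*%B x)) with (of_defect P (d (P^*%B x))).
apply i.
Qed.

Lemma to_adj_defect : (d^* * Th = P^* * ds^*)%B.
Proof.
pose proof (adj_contr P_contr) as hs.
apply (@corestrict_epi _ _ _ (defect P^*)).
change ((d^* * Th) * ds = P^* * ds^* * ds)%B.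
rewrite <- !bcompA, adj_defect_to, bcompA, !to_defect_sqr, adj_adj by trivial.
apply bop_eq; intros x; bopE; hvec_push; hvec.
Qed.

Lemma adj_defect_adj_to : (Th^* * d = ds * P)%B.
Proof.
pose proof (f_equal (@adj _ _) to_adj_defect) as h.
now rewrite !adj_comp, !adj_adj in h.
Qed.

Lemma to_adj_to (x : H) : d^*%B (d x) = minus x (P^*%B (P x)).
Proof. exact (bop_fun_eq (to_defect_sqr P_contr) x). Qed.

Lemma tos_adj_tos (x : H) : ds^*%B (ds x) = minus x (P (P^*%B x)).
Proof.
pose proof (bop_fun_eq (to_defect_sqr (adj_contr P_contr)) x) as h.
now rewrite adj_adj in h.
Qed.

(** Together with [to_adj_defect], [to_adj_to], [julia_right] and their companions this says that
    the Julia operator with rows [P, ds^*] and [d, -Th] is unitary; it is the part of [dil_U] that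
    is not a shift. *)
Lemma julia_left : (ds * ds^* + Th^* * Th = 1)%B.
Proof.
apply (@corestrict_epi _ _ _ (defect P^*)).
change ((ds * ds^* + Th^* * Th) * ds = 1 * ds)%B.
pointwise adj_defect_to as e1; pointwise adj_defect_adj_to as e2.
apply bop_eq; intros x; bopE.
rewrite tos_adj_tos, e1, e2; hvec_push; hvec.
Qed.

Lemma julia_right : (d * d^* + Th * Th^* = 1)%B.
Proof.
apply (@corestrict_epi _ _ _ (defect P)).
change ((d * d^* + Th * Th^*) * d = 1 * d)%B.
pointwise adj_defect_to as e1; pointwise adj_defect_adj_to as e2.
apply bop_eq; intros x; bopE.
rewrite to_adj_to, e2, e1; hvec_push; hvec.
Qed.

End Defect.

Lemma fundamental_adj (H : Hilbert) (A B P : bop H H) F1 F2 :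
  contraction P -> fundamental_operators A B P F1 F2 ->
  (forall x, (to_defect P)^*%B (F1 (to_defect P x)) = minus (A x) (B^*%B (P x))) /\
  (forall x, (to_defect P)^*%B (F2^*%B (to_defect P x)) = minus (B^*%B x) (P^*%B (A x))).
Proof.
intros hP [h1 h2]; rewrite <- to_defect_adj in h1, h2 by trivial.
assert (h2' := f_equal (@adj _ _) h2).
rewrite adj_add, adj_opp, !adj_comp, !adj_adj in h2'.
pointwise h1 as e1; pointwise h2' as e2.
split; intros x; symmetry; [apply e1 | apply e2].
Qed.

Lemma fundamental_swap (H : Hilbert) (A B P : bop H H) F1 F2 :
  fundamental_operators A B P F1 F2 -> fundamental_operators B A P F2 F1.
Proof. now intros [h1 h2]. Qed.

(** After composition with d^* on the left, which can be cancelled, it reads (1 - P^* P) A = (A -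
    B^* P) + (B^* - P^* A) P, true because A P = P A. *)
Lemma fundamental_relation (H : Hilbert) (A B P : bop H H) F1 F2 :
  contraction P -> commute A P -> fundamental_operators A B P F1 F2 ->
  (to_defect P * A = F1 * to_defect P + F2^* * to_defect P * P)%B.
Proof.
intros hP hc hF; destruct (fundamental_adj hP hF) as [e1 e2].
pointwise hc as c; pose proof (to_adj_to hP) as s.
apply (@corestrict_adj_mono _ _ _ (defect P)).
change ((to_defect P)^* * (to_defect P * A)
  = (to_defect P)^* * (F1 * to_defect P + F2^* * to_defect P * P))%B.
apply bop_eq; intros x; bopE; rewrite bop_plus, s, e1, e2, c; hvec.
Qed.

Lemma commute_adj (H : Hilbert) (S T : bop H H) : commute S T -> commute S^*%B T^*%B.
Proof. unfold commute; intros h; now rewrite <- !adj_comp, h. Qed.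

Section Relations.

Variables (H : Hilbert) (A B P : bop H H).
Variables (F1 F2 : bop (defect_space P) (defect_space P))
  (G1 G2 : bop (defect_space P^*) (defect_space P^*)).
Hypotheses (P_contr : contraction P)
  (AP : commute A P) (BP : commute B P)
  (hF : fundamental_operators A B P F1 F2)
  (hG : fundamental_operators A^* B^* P^* G1 G2).

Local Notation d := (to_defect P).
Local Notation ds := (to_defect P^*).
Local Notation Th := (adj_defect P).

(** The adjoint of [fundamental_relation] for the triple of adjoints. *)
Lemma fundamental_relation_adj (x : defect_space P^*) :
  A (ds^*%B x) = plus (P (ds^*%B (G2 x))) (ds^*%B (G1^*%B x)).
Proof.
pose proof (fundamental_relation (adj_contr P_contr) (commute_adj AP) hG) as h.
apply (f_equal (@adj _ _)) in h.
rewrite adj_add, !adj_comp, !adj_adj in h.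
pointwise h as e; rewrite e; hvec.
Qed.

Lemma fundamental_star :
  (forall x, ds^*%B (G1^*%B (ds x)) = minus (A x) (P (B^*%B x))) /\
  (forall x, ds^*%B (G2 (ds x)) = minus (B^*%B x) (A (P^*%B x))).
Proof.
pose proof (adj_contr P_contr) as hs.
destruct (fundamental_adj hs (fundamental_swap hG)) as [e2 e1].
rewrite !adj_adj in e1; rewrite adj_adj in e2; split; [exact e1 | exact e2].
Qed.

(** Compressed between d^* on the left and ds on the right, both sides equal P^* B^* - P^* A P^*. *)
Lemma fundamental_exchange : (F2^* * Th = Th * G2)%B.
Proof.
pointwise (to_adj_defect P_contr) as t; pointwise (adj_defect_to P_contr) as u.
destruct (fundamental_adj P_contr hF) as [_ e2]; destruct fundamental_star as [_ g2].

apply (@corestrict_epi _ _ _ (defect P^*)); apply (@corestrict_adj_mono _ _ _ (defect P)).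
change (d^* * (F2^* * Th * ds) = d^* * (Th * G2 * ds))%B.
apply bop_eq; intros x; bopE.
rewrite u, t, g2, e2; hvec_push; pointwise (commute_adj BP) as c; rewrite c; hvec.
Qed.

(** This and [fundamental_exchange] are the coefficients of b_0 and b_1 in the first entry of the
    middle component when R1 U is compared with U R1; they tie the fundamental operators of the
    triple to those of its adjoint. *)
Lemma fundamental_corner :
  (F2^* * d * ds^* - F1 * Th = d * ds^* * G2 - Th * G1^*)%B.
Proof.
pointwise (to_adj_defect P_contr) as t; pointwise (adj_defect_to P_contr) as u.
destruct (fundamental_adj P_contr hF) as [e1 e2]; destruct fundamental_star as [g1 g2].
pose proof (to_adj_to P_contr) as s; pose proof (tos_adj_tos P_contr) as s'.

apply (@corestrict_epi _ _ _ (defect P^*)); apply (@corestrict_adj_mono _ _ _ (defect P)).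
change (d^* * ((F2^* * d * ds^* - F1 * Th) * ds) = d^* * ((d * ds^* * G2 - Th * G1^*) * ds))%B.
apply bop_eq; intros x; bopE; hvec_push.
rewrite u, s', s, t; hvec_push; rewrite !e2, e1, g1, g2; hvec_push; pointwise AP as c; rewrite !c; hvec.
Qed.

End Relations.

Lemma inner_l2_cons (E : Hilbert) (e f : E) (a b : l2 E) :
  inner (l2_cons e a) (l2_cons f b) = (inner e f + inner a b)%C.
Proof.
apply injective_projections.
- change (Series (fun n => Re (inner (l2_cons e a n) (l2_cons f b n)))
          = Re (inner e f) + Series (fun n => Re (inner (a n) (b n)))).
  exact (Series_incr_1 _ (l2_ex_Re (l2_cons e a) (l2_cons f b))).
- change (Series (fun n => Im (inner (l2_cons e a n) (l2_cons f b n)))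
          = Im (inner e f) + Series (fun n => Im (inner (a n) (b n)))).
  exact (Series_incr_1 _ (l2_ex_Im (l2_cons e a) (l2_cons f b))).
Qed.

(** * The minimal unitary dilation *)

Lemma l2_cons_O (E : Hilbert) (e : E) (a : l2 E) : l2_cons e a O = e.
Proof. reflexivity. Qed.

Lemma l2_cons_S (E : Hilbert) (e : E) (a : l2 E) n : l2_cons e a (S n) = a n.
Proof. reflexivity. Qed.

Lemma l2_eta (E : Hilbert) (a : l2 E) : l2_cons (a O) (l2_tail a) = a.
Proof. now apply l2_eq; intros [| n]. Qed.

Lemma unitary_of_isometry_onto (H K : Hilbert) (W : bop H K) :
  (forall x y, inner (W x) (W y) = inner x y) -> (forall y, exists x, W x = y) -> unitary W.
Proof.
intros iso onto.
assert (l : (W^* * W = 1)%B).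
{ apply bop_eq; intros x; apply inner_ext; intros z; bopE; now rewrite adjP', iso, <- inner_conj || rewrite adjP', iso. }
split; [exact l |].
pointwise l as e.
apply bop_eq; intros y; bopE; destruct (onto y) as [x <-]; now rewrite e.
Qed.

Lemma unitary_inner (H K : Hilbert) (W : bop H K) (x y : H) :
  unitary W -> inner (W x) (W y) = inner x y.
Proof. intros [h _]; rewrite adjP; pointwise h as e; now rewrite e. Qed.

Section MinimalDilation.

Variables (H : Hilbert) (P : bop H H).
Hypothesis P_contr : contraction P.

Local Notation DP := (defect_space P).
Local Notation DPs := (defect_space P^*).
Local Notation d := (to_defect P).
Local Notation ds := (to_defect P^*).
Local Notation Th := (adj_defect P).
Local Notation K := (dil_space P).
Local Notation U := (dil_U P).

Definition dil_elem (h : H) (a : l2 DP) (b : l2 DPs) : K := ((h, a), b).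

Lemma dil_elemE (x : K) : exists h a b, x = dil_elem h a b.
Proof. destruct x as [[h a] b]; now exists h, a, b. Qed.

Lemma inner_dil_elem h a b h' a' b' :
  inner (dil_elem h a b) (dil_elem h' a' b') = (inner h h' + inner a a' + inner b b')%C.
Proof. reflexivity. Qed.

Lemma tos_adjE (x : DPs) : defect P^* (of_defect P^* x) = ds^*%B x.
Proof.
pose proof (to_defect_adj (adj_contr P_contr)) as h; pointwise h as e; now rewrite e.
Qed.

(** The Julia operator acts on the pair of h and b_0; its second output is pushed onto the sequence
    a, and b moves down to supply the next b_0. *)
Lemma dil_U_elem (h : H) (a : l2 DP) (b : l2 DPs) :
  U (dil_elem h a b) =
  dil_elem (plus (P h) (ds^*%B (b O))) (l2_cons (minus (d h) (Th (b O))) a) (l2_tail b).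
Proof.
unfold dil_elem; rewrite <- tos_adjE.
apply injective_projections; [apply injective_projections |]; [reflexivity | | reflexivity].
apply l2_eq; intros [| n]; [reflexivity |].
exact (plus_zero_r (a n)).
Qed.

Lemma dil_embedE h : dil_embed P h = dil_elem h zero zero.
Proof. reflexivity. Qed.

(** The preimage is the adjoint Julia operator applied to h and a_0, with the shifts reversed; it
    supplies surjectivity of [dil_U] and then the formula for its adjoint. *)
Lemma dil_U_inv (h : H) (a : l2 DP) (b : l2 DPs) :
  U (dil_elem (plus (P^*%B h) (d^*%B (a O))) (l2_tail a)
       (l2_cons (minus (ds h) (Th^*%B (a O))) b)) = dil_elem h a b.
Proof.
rewrite dil_U_elem, l2_cons_O.
pose proof (f_equal (@adj _ _) (adj_defect_to P_contr)) as e0.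
rewrite !adj_comp, adj_adj in e0.
pointwise e0 as e; pointwise (adj_defect_to P_contr) as e1.
pose proof (tos_adj_tos P_contr) as s; pointwise (julia_right P_contr) as j.
unfold dil_elem; f_equal; [f_equal |].
- hvec_push; rewrite s, e; hvec.
- rewrite <- (l2_eta a) at 4; f_equal.
  transitivity (plus (d (d^*%B (a O))) (Th (Th^*%B (a O)))); [| apply j].
  hvec_push; rewrite e1; hvec.
- now apply l2_eq.
Qed.

Lemma dil_U_isometry (x y : K) : inner (U x) (U y) = inner x y.
Proof.
destruct (dil_elemE x) as (h & a & b & ->), (dil_elemE y) as (h' & a' & b' & ->).
rewrite !dil_U_elem, !inner_dil_elem, inner_l2_cons.
assert (eb : inner b b' = (inner (b O) (b' O) + inner (l2_tail b) (l2_tail b'))%C).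
{ rewrite <- inner_l2_cons; now rewrite !l2_eta. }
rewrite eb.
pointwise (to_adj_defect P_contr) as t; pointwise (adj_defect_adj_to P_contr) as u.
pose proof (to_adj_to P_contr) as s; pointwise (julia_left P_contr) as j.
unfold minus; rewrite !inner_plus_l, !inner_plus_r, !inner_opp_l, !inner_opp_r.
rewrite (adjP' ds (P h')), (adjP' ds (ds^*%B (b' O))), !(adjP P), !(adjP d), !(adjP Th).
rewrite t, u, s, inner_minus_r.
replace (inner (b O) (b' O)) with (inner (b O) (plus (ds (ds^*%B (b' O))) (Th^*%B (Th (b' O)))))
  by now rewrite j.
rewrite inner_plus_r; ring.
Qed.

Lemma dil_U_unitary : unitary U.
Proof.
apply unitary_of_isometry_onto; [exact dil_U_isometry |].
intros y; destruct (dil_elemE y) as (h & a & b & ->); eexists; apply dil_U_inv.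
Qed.

Lemma dil_U_adj (h : H) (a : l2 DP) (b : l2 DPs) :
  U^*%B (dil_elem h a b) = dil_elem (plus (P^*%B h) (d^*%B (a O))) (l2_tail a)
       (l2_cons (minus (ds h) (Th^*%B (a O))) b).
Proof.
pose proof (proj1 dil_U_unitary) as e0; pointwise e0 as e.
now rewrite <- (dil_U_inv h a b), e.
Qed.

End MinimalDilation.

Lemma unitary_pow_nat (K : Hilbert) (U : bop K K) (n : nat) :
  unitary_pow U (Z.of_nat n) = (U ^ n)%B.
Proof. destruct n; [reflexivity |]; simpl unitary_pow; now rewrite SuccNat2Pos.id_succ. Qed.

Lemma unitary_pow_opp_nat (K : Hilbert) (U : bop K K) (n : nat) :
  unitary_pow U (- Z.of_nat n) = (U^* ^ n)%B.
Proof. destruct n; [reflexivity |]; simpl unitary_pow; now rewrite SuccNat2Pos.id_succ. Qed.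

Lemma Z_nat_cases (m : Z) : (exists n, m = Z.of_nat n) \/ (exists n, m = (- Z.of_nat (S n))%Z).
Proof.
destruct (Z.le_gt_cases 0 m).
- left; exists (Z.to_nat m); lia.
- right; exists (pred (Z.to_nat (- m))); lia.
Qed.

Lemma unitary_pow_succ (K : Hilbert) (U : bop K K) (m : Z) : unitary U ->
  unitary_pow U (m + 1) = (U * unitary_pow U m)%B.
Proof.
intros [_ h]; destruct (Z_nat_cases m) as [[n ->] | [n ->]].
- replace (Z.of_nat n + 1)%Z with (Z.of_nat (S n)) by lia.
  now rewrite !unitary_pow_nat.
- replace (- Z.of_nat (S n) + 1)%Z with (- Z.of_nat n)%Z by lia.
  rewrite !unitary_pow_opp_nat.
  change (U^* ^ S n)%B with (U^* * U^* ^ n)%B; now rewrite bcompA, h, bcomp1l.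
Qed.

Lemma unitary_pow_pred (K : Hilbert) (U : bop K K) (m : Z) : unitary U ->
  unitary_pow U (m - 1) = (U^* * unitary_pow U m)%B.
Proof.
intros h; replace m with (m - 1 + 1)%Z at 2 by lia.
rewrite (unitary_pow_succ _ h); destruct h as [h _]; now rewrite bcompA, h, bcomp1l.
Qed.

(* The orthogonal-complement form of minimality of a unitary dilation. *)
Definition total_orbit (H K : Hilbert) (j : bop H K) (U : bop K K) : Prop :=
  forall x, (forall (m : Z) h, inner x (unitary_pow U m (j h)) = 0%C) -> x = zero.

(** A vector orthogonal to the orbit stays so under [U] and [U^*], and its [H]-component vanishes.
    The [H]-components of its images are then ds^* b_0 and d^* a_0, so b_0 = a_0 = 0; further shifts
    bring every entry into these positions. *)
Lemma dil_U_total (H : Hilbert) (P : bop H H) :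
  contraction P -> total_orbit (dil_embed P) (dil_U P).
Proof.
intros P_contr; pose proof (dil_U_unitary P_contr) as uU.
set (U := dil_U P) in *.
set (perp := fun x : dil_space P => forall (m : Z) h, inner x (unitary_pow U m (dil_embed P h)) = 0%C).
assert (pU : forall x, perp x -> perp (U x)).
{ intros x hx m h; rewrite adjP, <- (bcompE U^*), <- (unitary_pow_pred _ uU); apply hx. }
assert (pUs : forall x, perp x -> perp (U^*%B x)).
{ intros x hx m h; rewrite adjP', <- (bcompE U), <- (unitary_pow_succ _ uU); apply hx. }
assert (head : forall (h : H) (a : l2 (defect_space P)) (b : l2 (defect_space P^*)),
  perp (dil_elem h a b) -> h = zero).
{ intros h a b hx; specialize (hx 0%Z h); simpl unitary_pow in hx.
  rewrite bidE, dil_embedE, inner_dil_elem, !inner_zero_r in hx.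
  apply inner_self_zero; rewrite <- hx; ring. }
assert (headU : forall (h : H) (a : l2 (defect_space P)) (b : l2 (defect_space P^*)),
  perp (dil_elem h a b) -> b O = zero).
{ intros h a b hx; pose proof (head _ _ _ hx) as ->.
  apply pU in hx; unfold U in hx; rewrite (dil_U_elem P_contr), bop_zero in hx; apply head in hx.
  apply corestrict_adj_inj; rewrite <- hx; symmetry; apply plus_zero_l. }
assert (headUs : forall (h : H) (a : l2 (defect_space P)) (b : l2 (defect_space P^*)),
  perp (dil_elem h a b) -> a O = zero).
{ intros h a b hx; pose proof (head _ _ _ hx) as ->.
  apply pUs in hx; unfold U in hx; rewrite (dil_U_adj P_contr), bop_zero in hx; apply head in hx.
  apply corestrict_adj_inj; rewrite <- hx; symmetry; apply plus_zero_l. }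
intros x hx; destruct (dil_elemE x) as (h & a & b & ->).
change (perp (dil_elem h a b)) in hx.
rewrite (head _ _ _ hx); unfold dil_elem.
apply injective_projections; [apply injective_projections; [reflexivity |] |].
- apply l2_eq; intros n; change (a n = zero).
  revert h a b hx; induction n as [| n IH]; intros h a b hx; [eapply headUs, hx |].
  apply pUs in hx; unfold U in hx; rewrite (dil_U_adj P_contr) in hx; exact (IH _ _ _ hx).
- apply l2_eq; intros n; change (b n = zero).
  revert h a b hx; induction n as [| n IH]; intros h a b hx; [eapply headU, hx |].
  apply pU in hx; unfold U in hx; rewrite (dil_U_elem P_contr) in hx; exact (IH _ _ _ hx).
Qed.

Lemma adj_pow (H : Hilbert) (T : bop H H) (n : nat) (x y : H) :
  inner ((T ^ n)%B x) y = inner x ((T^* ^ n)%B y).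
Proof.
revert x y; induction n as [| n IH]; intros x y; [reflexivity |].
change ((T ^ S n)%B x) with (T ((T ^ n)%B x)); rewrite adjP, IH; f_equal.
generalize y; clear; induction n as [| n IH]; intros y; [reflexivity |].
change (T^*%B ((T^* ^ n)%B (T^*%B y)) = T^*%B ((T^* ^ S n)%B y)); now rewrite IH.
Qed.

Lemma commute_pow (H : Hilbert) (S T : bop H H) (n : nat) : commute S T -> commute S (T ^ n)%B.
Proof.
intros h; pointwise h as c; induction n as [| n IH]; [now apply bop_eq |].
pointwise IH as i; apply bop_eq; intros x.
change (S (T ((T ^ n)%B x)) = T ((T ^ n)%B (S x))); now rewrite c, i.
Qed.

(** * Commutation and moments of the explicit operator *)

Section CommutesWithShift.

Variables (H : Hilbert) (A B P : bop H H).
Variables (F1 F2 : bop (defect_space P) (defect_space P))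
  (G1 G2 : bop (defect_space P^*) (defect_space P^*)).
Hypotheses (P_contr : contraction P)
  (AP : commute A P) (BP : commute B P)
  (hF : fundamental_operators A B P F1 F2)
  (hG : fundamental_operators A^* B^* P^* G1 G2).

Local Notation DP := (defect_space P).
Local Notation DPs := (defect_space P^*).
Local Notation d := (to_defect P).
Local Notation ds := (to_defect P^*).
Local Notation Th := (adj_defect P).
Local Notation U := (dil_U P).
Local Notation R1 := (dil_R1 P A F1 F2 G1 G2).

Definition dil_R1_mid (h : H) (a : l2 DP) (b : l2 DPs) : l2 DP :=
  plus (plus (l2_map F2^*%B (l2_cons (d h) a)) (l2_map F1 a))
    (l2_cons (opp (F2^*%B (Th (b O)))) zero).

Lemma dil_R1_elem (h : H) (a : l2 DP) (b : l2 DPs) :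
  R1 (dil_elem h a b) =
  dil_elem (plus (A h) (ds^*%B (G2 (b O)))) (dil_R1_mid h a b) (dil_D G1 G2 b).
Proof. unfold dil_elem; now rewrite <- (tos_adjE P_contr). Qed.

Lemma dil_R1_mid_O h a b :
  dil_R1_mid h a b O = minus (plus (F2^*%B (d h)) (F1 (a O))) (F2^*%B (Th (b O))).
Proof. reflexivity. Qed.

Lemma dil_R1_mid_S h a b n :
  dil_R1_mid h a b (S n) = plus (F2^*%B (a n)) (F1 (a (S n))).
Proof. exact (plus_zero_r (plus (F2^*%B (a n) : DP) (F1 (a (S n))))). Qed.

Lemma dil_D_nth b n : dil_D G1 G2 b n = plus (G1^*%B (b n)) (G2 (b (S n))).
Proof. reflexivity. Qed.

(** Away from the junction of the summands the entries agree formally. The [H]-component needs [e2];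
    in the first entry of the middle component the coefficients of h, b_0 and b_1 agree by [e1],
    [e4] and [e3]. *)
Lemma dil_R1_commute : commute R1 U.
Proof.
pointwise (fundamental_relation P_contr AP hF) as e1.
pose proof (fundamental_relation_adj P_contr AP hG) as e2.
pointwise (fundamental_exchange P_contr BP hF hG) as e3.
pointwise (fundamental_corner P_contr AP hF hG) as e4.
pointwise AP as c.
apply bop_eq; intros x; bopE; destruct (dil_elemE x) as (h & a & b & ->).
rewrite (dil_U_elem P_contr), !dil_R1_elem, (dil_U_elem P_contr).
unfold dil_elem; f_equal; [f_equal |].
- change (l2_tail b O) with (b 1%nat); rewrite dil_D_nth.
  hvec_push; rewrite e2, c; hvec.
- apply l2_eq; intros [| n].
  + rewrite dil_R1_mid_O, !l2_cons_O.
    change (l2_tail b O) with (b 1%nat).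
    rewrite dil_D_nth; hvec_push; rewrite e1, e3.
    (* What is left is [fundamental_corner] at b_0 up to the order of terms; it is used as a linear
       relation between inner products. *)
    apply inner_ext; intros z; pose proof (f_equal (fun v => inner v z) (e4 (b O))) as k; cbv beta in k.
    repeat first [rewrite inner_plus_l in * | rewrite inner_opp_l in *].
    match goal with |- ?l = ?r =>
      match type of k with ?u = ?v =>
        transitivity (l - u + v)%C; [rewrite <- k; ring | ring] end end.
  + rewrite dil_R1_mid_S, !l2_cons_S; destruct n as [| n].
    * rewrite l2_cons_O, dil_R1_mid_O; hvec_push; hvec.
    * now rewrite l2_cons_S, dil_R1_mid_S.
- now apply l2_eq.
Qed.

Lemma dil_U_pow_embed (n : nat) (h : H) :
  exists a, (U ^ n)%B (dil_embed P h) = dil_elem ((P ^ n)%B h) a zero.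
Proof.
induction n as [| n [a IH]].
- now exists zero.
- eexists; change ((U ^ S n)%B (dil_embed P h)) with (U ((U ^ n)%B (dil_embed P h))).
  rewrite IH, (dil_U_elem P_contr).
  change ((zero : l2 DPs) O) with (zero : DPs).
  rewrite bop_zero; unfold dil_elem; f_equal; [f_equal |].
  + apply plus_zero_r.
  + now apply l2_eq.
Qed.

Lemma dil_R1_embed (h : H) : exists a, R1 (dil_embed P h) = dil_elem (A h) a zero /\
  a O = F2^*%B (d h) /\ l2_tail a = zero.
Proof.
exists (dil_R1_mid h zero zero); split; [| split].
- rewrite dil_embedE, dil_R1_elem; unfold dil_elem; f_equal; [f_equal |].
  + change ((zero : l2 DPs) O) with (zero : DPs); rewrite !bop_zero; apply plus_zero_r.
  + apply bop_zero.
- transitivity (minus (plus (F2^*%B (d h)) (F1 zero)) (F2^*%B (Th zero))); [reflexivity |].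
  rewrite !bop_zero; hvec.
- apply l2_eq; intros n.
  change (dil_R1_mid h zero zero (S n) = zero); rewrite dil_R1_mid_S.
  transitivity (plus (F2^*%B zero) (F1 zero)); [reflexivity |].
  rewrite !bop_zero; apply plus_zero_r.
Qed.

(** Once the powers are moved to the left, the third component of U^n h is still zero, so [R1] sees
    only A P^n h in the [H]-component. *)
Lemma dil_R1_moment_nonpos (n : nat) (h h' : H) :
  inner (R1 (dil_embed P h)) ((U^* ^ n)%B (dil_embed P h')) = inner (A ((P ^ n)%B h)) h'.
Proof.
rewrite <- adj_pow.
pointwise (commute_pow n dil_R1_commute) as c; rewrite <- c.
destruct (dil_U_pow_embed n h) as [a ->].
rewrite dil_R1_elem, dil_embedE, inner_dil_elem, !inner_zero_r.
transitivity (inner (plus (A ((P ^ n)%B h)) (ds^*%B (G2 zero))) h' + 0 + 0)%C; [reflexivity |].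
rewrite !bop_zero, inner_plus_l, inner_zero_l; ring.
Qed.

(** One factor [U^*] brings the entry F2^* d h back to [H] as d^* F2^* d h = B^* h - P^* A h, which
    completes P^* A h to B^* h and leaves the middle component zero. *)
Lemma dil_R1_moment_pos (n : nat) (h h' : H) :
  inner (R1 (dil_embed P h)) ((U ^ S n)%B (dil_embed P h')) = inner (B^*%B h) ((P ^ n)%B h').
Proof.
change ((U ^ S n)%B (dil_embed P h')) with (U ((U ^ n)%B (dil_embed P h'))).
rewrite <- adjP'.
destruct (dil_R1_embed h) as (a & -> & ha & ta), (dil_U_pow_embed n h') as [a' ->].
destruct (fundamental_adj P_contr hF) as [_ e2].
rewrite (dil_U_adj P_contr), inner_dil_elem, ha, ta, e2, inner_zero_l, inner_zero_r.
unfold minus; rewrite !inner_plus_l, inner_opp_l; ring.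
Qed.

End CommutesWithShift.

(** Totality and the moments give [X j = Y j]; commutation extends this to every U^m j h. Since
    totality speaks of vectors tested against the orbit, the conclusion is drawn for the
    adjoints. *)
Lemma lift_unique (H K : Hilbert) (j : bop H K) (U X Y : bop K K) :
  unitary U -> total_orbit j U -> commute X U -> commute Y U ->
  (forall (m : Z) h h', inner (X (j h)) (unitary_pow U m (j h'))
                      = inner (Y (j h)) (unitary_pow U m (j h'))) -> X = Y.
Proof.
intros uU tot cX cY he.
assert (e : forall h, X (j h) = Y (j h)).
{ intros h; apply hminus_eq0, tot; intros m h'; rewrite inner_minus_l, he; ring. }
assert (cm : forall T : bop K K, commute T U -> forall m, commute T (unitary_pow U m)).
{ intros T cT m; destruct (Z_nat_cases m) as [[n ->] | [n ->]].
  - rewrite unitary_pow_nat; now apply commute_pow.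
  - rewrite unitary_pow_opp_nat; apply commute_pow.
    destruct uU as [u1 u2]; unfold commute in *.
    (* T U^* = U^* U T U^* = U^* T U U^* = U^* T. *)
    rewrite <- (bcomp1l (T * U^*)%B), <- u1, <- !bcompA, (bcompA U T), <- cT.
    now rewrite <- !bcompA, u2, bcomp1r. }
assert (ea : (X^* = Y^*)%B).
{ apply bop_eq; intros z.
  apply hminus_eq0, tot; intros m h; rewrite inner_minus_l, !adjP'.
  pointwise (cm X cX m) as c1; pointwise (cm Y cY m) as c2.
  rewrite c1, c2, e; ring. }
now rewrite <- (adj_adj X), ea, adj_adj.
Qed.

(* The inner products of [X h] with the vectors [U^m h'] that span the dilation space are
   forced: for [m <= 0] by the dilation property of [X], and for [m > 0], because
   [X = Y^* U], by that of [Y]. *)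
Lemma dil_R1_unique (H : Hilbert) (A B P : bop H H)
    (F1 F2 : bop (defect_space P) (defect_space P))
    (G1 G2 : bop (defect_space P^*) (defect_space P^*)) (X Y : bop (dil_space P) (dil_space P)) :
  contraction P -> commute A P -> commute B P ->
  fundamental_operators A B P F1 F2 -> fundamental_operators A^* B^* P^* G1 G2 ->
  commute X (dil_U P) -> commute Y (dil_U P) -> (X = Y^* * dil_U P)%B ->
  (forall n, A * P ^ n = (dil_embed P)^* * (X * dil_U P ^ n) * dil_embed P)%B ->
  (forall n, B * P ^ n = (dil_embed P)^* * (Y * dil_U P ^ n) * dil_embed P)%B ->
  X = dil_R1 P A F1 F2 G1 G2.
Proof.
intros P_contr AP BP hF hG cX cY e mX mY.
set (U := dil_U P) in *; set (j := dil_embed P) in *.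
pose proof (dil_U_unitary P_contr) as uU.
apply (lift_unique uU (dil_U_total P_contr) cX (dil_R1_commute P_contr AP BP hF hG)).
fold U j; intros m h h'; destruct (Z_nat_cases m) as [[[| n] ->] | [n ->]].
- rewrite unitary_pow_nat.
  (* Both zeroth powers are the identity, so m = 0 falls under the nonpositive case. *)
  change (U ^ 0)%B with (U^* ^ 0)%B.
  unfold U, j; rewrite (dil_R1_moment_nonpos P_contr AP BP hF hG 0); fold U j.
  pointwise (mX O) as k; rewrite k, adjP'.
  reflexivity.
- rewrite unitary_pow_nat.
  unfold U, j; rewrite (dil_R1_moment_pos G1 G2 P_contr hF n); fold U j.
  rewrite e; bopE; rewrite adjP'.
  pointwise cY as c.
  change ((U ^ S n)%B (j h')) with (U ((U ^ n)%B (j h'))).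
  rewrite c, (unitary_inner _ _ uU), adjP'.
  pointwise (mY n) as k; rewrite k; now rewrite <- adjP.
- rewrite unitary_pow_opp_nat.
  unfold U, j; rewrite (dil_R1_moment_nonpos P_contr AP BP hF hG (S n)); fold U j.
  rewrite <- adj_pow.
  pointwise (commute_pow (S n) cX) as c; rewrite <- c.
  pointwise (mX (S n)) as k; rewrite k; now rewrite adjP'.
Qed.

(** * Unitaries from equal Gram matrices *)

Section GramUnitary.

Variables (I : Type) (K1 K2 : Hilbert) (e : I -> K1) (f : I -> K2).
Hypotheses (gram : forall i k, inner (e i) (e k) = inner (f i) (f k))
  (dense_e : forall x, closure (span (fun y => exists i, y = e i)) x)
  (total_f : forall y, (forall i, inner y (f i) = 0%C) -> y = zero).

Local Notation sp := (span (fun y => exists i, y = e i)).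

Lemma span_plus (x y : K1) : sp x -> sp y -> sp (plus x y).
Proof.
intros hx hy; induction hx as [| c v x hv hx IH].
- rewrite plus_zero_l; exact hy.
- rewrite <- plus_assoc; now apply span_add.
Qed.

Lemma span_opp (x : K1) : sp x -> sp (opp x).
Proof.
intros hx; induction hx as [| c v x hv hx IH].
- assert (E : opp (zero : K1) = zero) by hvec; rewrite E; apply span_zero.
- change (sp (opp (plus (scal c v : K1) x))).
  assert (E : opp (plus (scal c v : K1) x) = plus (scal (- c)%C v : K1) (opp x)) by hvec.
  rewrite E; now apply span_add.
Qed.

(* [y] has to be the image of [x] under the unitary mapping each [e i] to [f i]. *)
Definition gram_rel (x : K1) (y : K2) : Prop := forall i, inner x (e i) = inner y (f i).

Lemma gram_rel_unique x y y' : gram_rel x y -> gram_rel x y' -> y = y'.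
Proof.
intros h h'; apply hminus_eq0, total_f; intros i; rewrite inner_minus_l, <- h, <- h'; ring.
Qed.

Lemma gram_rel_minus x y x' y' :
  gram_rel x y -> gram_rel x' y' -> gram_rel (minus x x') (minus y y').
Proof. intros h h' i; now rewrite !inner_minus_l, h, h'. Qed.

Lemma gram_rel_plus x y x' y' :
  gram_rel x y -> gram_rel x' y' -> gram_rel (plus x x') (plus y y').
Proof. intros h h' i; now rewrite !inner_plus_l, h, h'. Qed.

Lemma gram_rel_scal (c : C) x y : gram_rel x y -> gram_rel (scal c x) (scal c y).
Proof. intros h i; now rewrite !inner_scal_l, h. Qed.

Lemma gram_rel_span x : sp x -> exists y, gram_rel x y /\ norm y = norm x.
Proof.
intros hx; cut (exists y, gram_rel x y /\ inner y y = inner x x).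
{ intros (y & h1 & h2); exists y; split; [exact h1 | now apply hnorm_unique]. }
induction hx as [| c v x [i ->] hx (y & h1 & h2)].
- exists zero; split; [intros i |]; now rewrite !inner_zero_l.
- exists (plus (scal c (f i) : K2) y).
  change (gram_rel (plus (scal c (e i) : K1) x) (plus (scal c (f i) : K2) y) /\
    inner (plus (scal c (f i) : K2) y) (plus (scal c (f i) : K2) y)
    = inner (plus (scal c (e i) : K1) x) (plus (scal c (e i) : K1) x)); split.
  + apply gram_rel_plus; [| exact h1]; apply gram_rel_scal; intros k; apply gram.
  + rewrite !inner_plus_l, !inner_plus_r, !inner_scal_l, !inner_scal_r, h2, gram, (h1 i).
    rewrite (inner_conj y (f i)), <- (h1 i), <- inner_conj; ring.
Qed.

Lemma span_approx (x : K1) (r : R) : 0 < r -> exists z, sp z /\ norm (minus z x) < r.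
Proof.
intros hr.
destruct (dense_e (locally_le_locally_norm (V := K1) x _
  (ex_intro _ (mkposreal r hr) (fun y h => h)))) as [z [h1 h2]].
now exists z.
Qed.

(** Approximate [x] from the span: differences of approximants lie in the span, where the relation
    preserves norms, so their images are Cauchy. Only a norm bound is recorded here; isometry is
    recovered in [gram_unitary]. *)
Lemma gram_rel_total x : exists y, gram_rel x y /\ norm y <= norm x.
Proof.
assert (h : forall n : nat, exists p : K1 * K2,
  sp (fst p) /\ norm (minus (fst p) x) < / INR (S n) /\ gram_rel (fst p) (snd p) /\
  norm (snd p) = norm (fst p)).
{ intros n; destruct (span_approx x (inv_INR_pos n)) as [z [h1 h2]].
  destruct (gram_rel_span h1) as [y [h3 h4]]; now exists (z, y). }
destruct (choice _ h) as [p hp]; clear h.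
assert (xlim : hlim (fun n => fst (p n)) x).
{ intros r hr; destruct (inv_INR_small hr) as [N hN]; exists N; intros n hn.
  eapply Rlt_trans; [apply hp | now apply hN]. }
assert (iso : forall n m, norm (minus (snd (p m)) (snd (p n))) = norm (minus (fst (p m)) (fst (p n)))).
{ intros n m.
  destruct (@gram_rel_span (minus (fst (p m)) (fst (p n)))) as [y [h1 h2]].
  { apply span_plus; [apply hp | apply span_opp, hp]. }
  rewrite <- h2; f_equal; apply (@gram_rel_unique (minus (fst (p m)) (fst (p n)))); [| exact h1].
  apply gram_rel_minus; apply hp. }
destruct (@Hilbert_cauchy_seq K2 (fun n => snd (p n))) as [y hy].
{ intros r; destruct (xlim (r / 2)) as [N hN]; [pose proof (cond_pos r); lra |].
  exists N; intros n m hn hm; rewrite iso.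
  eapply Rle_lt_trans; [apply (hdist_triangle _ x) |].
  pose proof (hN n hn) as a1; pose proof (hN m hm) as a2; rewrite minus_swap_norm in a1; lra. }
assert (ylim : hlim (fun n => snd (p n)) y) by (intros r hr; exact (hy (mkposreal r hr))).
exists y; split.
- intros i; apply C_eq_of_small with (norm (e i) + norm (f i)); intros r hr.
  destruct (xlim r hr) as [N1 h1], (ylim r hr) as [N2 h2].
  specialize (h1 _ (Nat.le_max_l N1 N2)); specialize (h2 _ (Nat.le_max_r N1 N2)).
  set (n := max N1 N2) in *.
  assert (g : gram_rel (fst (p n)) (snd (p n))) by apply hp.
  replace (inner x (e i) - inner y (f i))%C
    with (- inner (minus (fst (p n)) x) (e i) + inner (minus (snd (p n)) y) (f i))%C.
  2: { rewrite !inner_minus_l, g; ring. }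
  eapply Rle_trans; [apply Cmod_triangle |]; rewrite Cmod_opp.
  pose proof (inner_CS (minus (fst (p n)) x) (e i)).
  pose proof (inner_CS (minus (snd (p n)) y) (f i)).
  pose proof (hnorm_ge0 (e i)); pose proof (hnorm_ge0 (f i)); nra.
- apply Rnot_lt_le; intros hl.
  destruct (xlim ((norm y - norm x) / 2)) as [N1 h1]; [lra |].
  destruct (ylim ((norm y - norm x) / 2)) as [N2 h2]; [lra |].
  specialize (h1 _ (Nat.le_max_l N1 N2)); specialize (h2 _ (Nat.le_max_r N1 N2)).
  set (n := max N1 N2) in *.
  assert (g : norm (snd (p n)) = norm (fst (p n))) by apply hp.
  pose proof (hnorm_triangle (minus (fst (p n)) x) x) as t1; rewrite hminus_plusK in t1.
  pose proof (hnorm_triangle (minus y (snd (p n))) (snd (p n))) as t2.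
  rewrite hminus_plusK, minus_swap_norm in t2; lra.
Qed.

Lemma gram_unitary : exists W : bop K1 K2, unitary W /\ forall i, W (e i) = f i.
Proof.
destruct (choice _ gram_rel_total) as [W hW].
assert (lin : is_linear W).
{ split.
  - intros x y; apply (@gram_rel_unique (plus x y)); [apply hW |].
    apply gram_rel_plus; apply hW.
  - intros c x; apply (@gram_rel_unique (scal c x)); [apply hW |].
    apply gram_rel_scal; apply hW.
  - exists 1; split; [lra |]; intros x; rewrite Rmult_1_l; apply hW. }
exists (Bop lin); set (V := Bop lin).
assert (hV : forall x i, inner (V x) (f i) = inner x (e i)).
{ intros x i; symmetry; exact (proj1 (hW x) i). }
assert (Ve : forall i, V (e i) = f i).
{ intros i; apply (@gram_rel_unique (e i)); [exact (proj1 (hW (e i))) |]; intros k; apply gram. }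
assert (Vf : forall i, V^*%B (f i) = e i).
{ intros i; apply inner_ext; intros z; now rewrite adjP', (inner_conj (V z)), hV, <- inner_conj. }
split; [| exact Ve].
assert (l : (V^* * V = 1)%B).
(* V^* V - 1 kills each [e i], hence the span. The operator is moved onto [z] so that x can be
   replaced by nearby span vectors, and moved back afterwards. *)
{ assert (l0 : (V^* * V - 1 = 0)%B).
  { apply bop_eq; intros x; apply inner_ext; intros z.
    change ((0 : bop K1 K1)%B x) with (zero : K1).
    rewrite (adjP (V^* * V - 1)%B), inner_zero_l.
    apply inner_eq0_of_small; intros r; destruct (span_approx x (cond_pos r)) as [y [h1 h2]].
    exists y; split; [| exact h2]; clear h2; rewrite <- adjP.
    induction h1 as [| c v y [i ->] h1 IH]; [now rewrite bop_zero, inner_zero_l |].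
    change (inner ((V^* * V - 1)%B (plus (scal c (e i) : K1) y)) z = 0%C).
    rewrite bop_plus, bop_scal, inner_plus_l, IH; bopE; rewrite Ve, Vf.
    change (plus (e i) (opp (e i))) with (minus (e i) (e i)).
    rewrite hminus_eq_zero, inner_scal_l, inner_zero_l; ring. }
  pointwise l0 as k; apply bop_eq; intros x; apply hminus_eq0, k. }
split; [exact l |].
pointwise l as k; apply bop_eq; intros y; bopE.
apply hminus_eq0, total_f; intros i; rewrite inner_minus_l, hV, adjP', Ve; ring.
Qed.

End GramUnitary.

Lemma adj_pow' (H : Hilbert) (T : bop H H) (n : nat) (x y : H) :
  inner ((T^* ^ n)%B x) y = inner x ((T ^ n)%B y).
Proof. rewrite adj_pow, adj_adj; reflexivity. Qed.

(** [unitary_pow] is applied to the contraction [P] as well, where negative exponents mean powers of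
    [P^*]. Unitarity of [U] makes the Gram matrix depend on m - n alone, so it is determined by
    [P]. *)
Lemma dilation_gram (H K : Hilbert) (j : bop H K) (P : bop H H) (U : bop K K) :
  unitary U -> (forall n : nat, P ^ n = j^* * U ^ n * j)%B ->
  forall m n h h', inner (unitary_pow U m (j h)) (unitary_pow U n (j h'))
                 = inner (unitary_pow P (m - n) h) h'.
Proof.
intros uU hP.
assert (shift : forall (k : nat) m n x y,
  inner (unitary_pow U (m + Z.of_nat k) x) (unitary_pow U (n + Z.of_nat k) y)
  = inner (unitary_pow U m x) (unitary_pow U n y)).
{ intros k; induction k as [| k IH]; intros m n x y; [now rewrite !Z.add_0_r |].
  replace (m + Z.of_nat (S k))%Z with (m + Z.of_nat k + 1)%Z by lia.
  replace (n + Z.of_nat (S k))%Z with (n + Z.of_nat k + 1)%Z by lia.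
  rewrite !(unitary_pow_succ _ uU); bopE; now rewrite (unitary_inner _ _ uU). }
assert (base : forall k h h', inner (unitary_pow U k (j h)) (j h') = inner (unitary_pow P k h) h').
{ intros k h h'; destruct (Z_nat_cases k) as [[n ->] | [n ->]].
  - rewrite !unitary_pow_nat; pointwise (hP n) as e; now rewrite e, adjP'.
  - rewrite !unitary_pow_opp_nat, !adj_pow'; pointwise (hP (S n)) as e; now rewrite e, <- adjP. }
intros m n h h'; rewrite <- base; destruct (Z_nat_cases n) as [[k ->] | [k ->]].
- transitivity (inner (unitary_pow U (m - Z.of_nat k) (j h)) (unitary_pow U 0 (j h'))); [| reflexivity].
  rewrite <- (shift k (m - Z.of_nat k)%Z 0%Z); now replace (m - Z.of_nat k + Z.of_nat k)%Z with m by lia.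
- transitivity (inner (unitary_pow U (m - - Z.of_nat (S k)) (j h)) (unitary_pow U 0 (j h'))); [| reflexivity].
  rewrite <- (shift (S k) m).
  replace (- Z.of_nat (S k) + Z.of_nat (S k))%Z with 0%Z by lia.
  now replace (m - - Z.of_nat (S k))%Z with (m + Z.of_nat (S k))%Z by lia.
Qed.

Lemma dil_U_dilation (H : Hilbert) (P : bop H H) : contraction P ->
  forall n : nat, (P ^ n = (dil_embed P)^* * dil_U P ^ n * dil_embed P)%B.
Proof.
intros hP n; apply bop_eq; intros h; bopE; apply inner_ext; intros h'.
rewrite adjP'; destruct (dil_U_pow_embed hP n h) as [a ->].
rewrite dil_embedE, inner_dil_elem, !inner_zero_r; ring.
Qed.

Lemma minimal_dilation_equiv (H K : Hilbert) (j : bop H K) (P : bop H H) (U : bop K K) :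
  contraction P -> minimal_unitary_dilation j P U ->
  exists W : bop K (dil_space P), unitary W /\ (W * j = dil_embed P)%B /\ (W * U = dil_U P * W)%B.
Proof.
intros hP (_ & uU & hU & hc).
pose proof (dil_U_unitary hP) as uD.
set (e := fun p : Z * H => unitary_pow U (fst p) (j (snd p))).
set (f := fun p : Z * H => unitary_pow (dil_U P) (fst p) (dil_embed P (snd p))).
assert (De : (fun y => exists (m : Z) (h : H), y = unitary_pow U m (j h)) = fun y => exists i, y = e i).
{ apply functional_extensionality; intros y; apply propositional_extensionality; split.
  - intros (m & h & ->); now exists (m, h).
  - intros ((m & h) & ->); now exists m, h. }
rewrite De in hc.
destruct (@gram_unitary (Z * H) K (dil_space P) e f) as [W [uW hW]].
- intros [m h] [n h']; unfold e, f; simpl fst; simpl snd.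
  rewrite (dilation_gram uU hU); symmetry; apply (dilation_gram uD), dil_U_dilation, hP.
- exact hc.
- intros y hy; apply (dil_U_total hP); intros m h; exact (hy (m, h)).
- exists W; split; [exact uW | split].
  + apply bop_eq; intros h; exact (hW (0%Z, h)).
  + pointwise (proj1 uW) as w.
    (* Totality tests against orbit vectors, so the adjoints are compared: W^* carries the orbit of
       [dil_U] to that of [U], [U] raises the exponent by one, and W carries the result back. *)
    assert (q : ((W * U * W^*)^* = (dil_U P)^*)%B).
    { apply bop_eq; intros y.
      apply hminus_eq0, (dil_U_total hP); intros m h; rewrite inner_minus_l, !adjP'; bopE.
      pose proof (hW (m, h)) as e1; pose proof (hW ((m + 1)%Z, h)) as e2.
      unfold e, f in e1, e2; simpl fst in e1, e2; simpl snd in e1, e2.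
      rewrite (unitary_pow_succ _ uU), (unitary_pow_succ _ uD) in e2; bopE_in e2.
      rewrite <- e1, w, e2, <- e1; ring. }
    apply (f_equal (@adj _ _)) in q; rewrite !adj_adj in q.
    now rewrite <- q, <- (bcompA (W * U)%B), (proj1 uW), bcomp1r.
Qed.

(** * The maximum modulus principle *)

Section Goursat.

Variables (u v beta : R -> R -> R) (gu gv : R -> R -> R) (a0 b0 c0 d0 : R).
Hypotheses (hu : forall x y, a0 <= x <= b0 -> c0 <= y <= d0 ->
    differentiable_pt_lim u x y (beta x y) (gu x y))
  (hv : forall x y, a0 <= x <= b0 -> c0 <= y <= d0 ->
    differentiable_pt_lim v x y (gv x y) (beta x y)).

(* The flux of the field [(u, -v)], whose divergence [u_x - v_y] vanishes, across the boundary
   of a rectangle; the partial derivatives need not be continuous. *)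
Definition flux (a b c d : R) : R :=
  RInt (fun t => u b t - u a t) c d - RInt (fun s => v s d - v s c) a b.

Lemma continuity_2d_section_r (f : R -> R -> R) x y :
  continuity_2d_pt f x y -> continuous (fun t => f x t) y.
Proof.
intros h; apply continuity_pt_filterlim; intros e he.
destruct (h (mkposreal e he)) as [del hd]; exists del; split; [apply cond_pos |].
intros t [_ ht]; apply hd; [rewrite Rminus_eq_0, Rabs_R0; apply cond_pos | exact ht].
Qed.

Lemma continuity_2d_section_l (f : R -> R -> R) x y :
  continuity_2d_pt f x y -> continuous (fun t => f t y) x.
Proof.
intros h; apply continuity_pt_filterlim; intros e he.
destruct (h (mkposreal e he)) as [del hd]; exists del; split; [apply cond_pos |].
intros t [_ ht]; apply hd; [exact ht | rewrite Rminus_eq_0, Rabs_R0; apply cond_pos].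
Qed.

Lemma goursat_int_u a b c d : a0 <= a <= b0 -> a0 <= b <= b0 -> c0 <= c -> c <= d -> d <= d0 ->
  ex_RInt (fun t => u b t - u a t) c d.
Proof.
intros ha hb h1 h2 h3; apply (ex_RInt_continuous (V := R_CompleteNormedModule)).
rewrite Rmin_left, Rmax_right by lra; intros t ht.
apply (continuous_minus (V := R_NormedModule) (fun t => u b t) (fun t => u a t));
  apply continuity_2d_section_r; eapply differentiable_continuity_pt;
  eexists; eexists; apply hu; lra.
Qed.

Lemma goursat_int_v a b c d : a0 <= a -> a <= b -> b <= b0 -> c0 <= c <= d0 -> c0 <= d <= d0 ->
  ex_RInt (fun s => v s d - v s c) a b.
Proof.
intros h1 h2 h3 hc hd; apply (ex_RInt_continuous (V := R_CompleteNormedModule)).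
rewrite Rmin_left, Rmax_right by lra; intros t ht.
apply (continuous_minus (V := R_NormedModule) (fun s => v s d) (fun s => v s c));
  apply continuity_2d_section_l; eapply differentiable_continuity_pt;
  eexists; eexists; apply hv; lra.
Qed.

Lemma flux_split_x a m b c d : a0 <= a -> a <= m -> m <= b -> b <= b0 ->
  c0 <= c -> c <= d -> d <= d0 -> flux a b c d = flux a m c d + flux m b c d.
Proof.
intros; unfold flux.
rewrite <- (RInt_Chasles (fun s => v s d - v s c) a m b) by (apply goursat_int_v; lra).
assert (e : RInt (fun t => u b t - u a t) c d
  = RInt (fun t => u m t - u a t) c d + RInt (fun t => u b t - u m t) c d).
{ eapply eq_trans; [| exact (RInt_plus (V := R_CompleteNormedModule) (fun t => u m t - u a t)
    (fun t => u b t - u m t) c d ltac:(apply goursat_int_u; lra) ltac:(apply goursat_int_u; lra))].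
  apply RInt_ext; intros t _; change plus with Rplus; simpl; ring. }
rewrite e; change plus with Rplus; simpl; ring.
Qed.

Lemma flux_split_y a b c m d : a0 <= a -> a <= b -> b <= b0 ->
  c0 <= c -> c <= m -> m <= d -> d <= d0 -> flux a b c d = flux a b c m + flux a b m d.
Proof.
intros; unfold flux.
rewrite <- (RInt_Chasles (fun t => u b t - u a t) c m d) by (apply goursat_int_u; lra).
assert (e : RInt (fun s => v s d - v s c) a b
  = RInt (fun s => v s m - v s c) a b + RInt (fun s => v s d - v s m) a b).
{ eapply eq_trans; [| exact (RInt_plus (V := R_CompleteNormedModule) (fun s => v s m - v s c)
    (fun s => v s d - v s m) a b ltac:(apply goursat_int_v; lra) ltac:(apply goursat_int_v; lra))].
  apply RInt_ext; intros t _; change plus with Rplus; simpl; ring. }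
rewrite e; change plus with Rplus; simpl; ring.
Qed.

(** The linear parts of [u] and [v] contribute B (b - a) (d - c) each, with the same B because they
    share the partial derivative [beta], and cancel. *)
Lemma flux_local x y : a0 <= x <= b0 -> c0 <= y <= d0 -> forall e, 0 < e ->
  exists del, 0 < del /\ forall a b c d L, a0 <= a -> a <= x <= b -> b <= b0 ->
    c0 <= c -> c <= y <= d -> d <= d0 -> b - a <= L -> d - c <= L -> L < del ->
    Rabs (flux a b c d) <= e * L ^ 2.
Proof.
intros hx hy e he.
(* Two values enter each of the two integrands, so e/4 per value adds up to e. *)
assert (e4 : 0 < e / 4) by lra.
destruct (hu hx hy (mkposreal _ e4)) as [d1 h1], (hv hx hy (mkposreal _ e4)) as [d2 h2].
simpl in h1, h2.
exists (Rmin d1 d2); split; [apply Rmin_pos; apply cond_pos |].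
intros a b c d L la lx lb lc ly ld lba ldc lL.
assert (l1 : L < d1) by (pose proof (Rmin_l d1 d2); lra).
assert (l2 : L < d2) by (pose proof (Rmin_r d1 d2); lra).
set (B := beta x y) in *.
assert (near : forall (f : R -> R -> R) (p q : R) (del : posreal), L < del ->
  (forall s t, Rabs (s - x) < del -> Rabs (t - y) < del ->
    Rabs (f s t - f x y - (p * (s - x) + q * (t - y)))
      <= e / 4 * Rmax (Rabs (s - x)) (Rabs (t - y))) ->
  forall s t, a <= s <= b -> c <= t <= d ->
    - (e / 4 * L) <= f s t - f x y - (p * (s - x) + q * (t - y)) <= e / 4 * L).
{ intros f p q del hL hf s t hs ht; apply Rabs_le_between.
  assert (Rabs (s - x) <= L) by (apply Rabs_le; lra).
  assert (Rabs (t - y) <= L) by (apply Rabs_le; lra).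
  eapply Rle_trans; [apply hf; lra |].
  apply Rmult_le_compat_l; [lra | now apply Rmax_lub]. }
assert (nu := near _ _ _ _ l1 h1); assert (nv := near _ _ _ _ l2 h2); clear near.
assert (bu : Rabs (RInt (fun t => u b t - u a t - B * (b - a)) c d) <= (d - c) * (e / 2 * L)).
{ apply abs_RInt_le_const; [lra | |].
  - apply (ex_RInt_minus (V := R_NormedModule) (fun t => u b t - u a t) (fun _ => B * (b - a)));
      [apply goursat_int_u; lra | apply ex_RInt_const].
  - intros t ht; pose proof (nu b t ltac:(lra) ht); pose proof (nu a t ltac:(lra) ht).
    apply Rabs_le; lra. }
assert (bv : Rabs (RInt (fun s => v s d - v s c - B * (d - c)) a b) <= (b - a) * (e / 2 * L)).
{ apply abs_RInt_le_const; [lra | |].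
  - apply (ex_RInt_minus (V := R_NormedModule) (fun s => v s d - v s c) (fun _ => B * (d - c)));
      [apply goursat_int_v; lra | apply ex_RInt_const].
  - intros s hs; pose proof (nv s d hs ltac:(lra)); pose proof (nv s c hs ltac:(lra)).
    apply Rabs_le; lra. }
assert (E : flux a b c d = RInt (fun t => u b t - u a t - B * (b - a)) c d
                         - RInt (fun s => v s d - v s c - B * (d - c)) a b).
{ unfold flux.
  rewrite (RInt_minus (V := R_CompleteNormedModule) (fun t => u b t - u a t) (fun _ => B * (b - a)));
    [| apply goursat_int_u; lra | apply ex_RInt_const].
  rewrite (RInt_minus (V := R_CompleteNormedModule) (fun s => v s d - v s c) (fun _ => B * (d - c)));
    [| apply goursat_int_v; lra | apply ex_RInt_const].
  rewrite !RInt_const; change minus with Rminus; change scal with Rmult; simpl; ring. }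
rewrite E; eapply Rle_trans; [apply Rabs_triang |]; rewrite Rabs_Ropp.
assert ((d - c) * (e / 2 * L) <= L * (e / 2 * L)) by (apply Rmult_le_compat_r; nra).
assert ((b - a) * (e / 2 * L) <= L * (e / 2 * L)) by (apply Rmult_le_compat_r; nra).
simpl; lra.
Qed.

Let w (n : nat) := (b0 - a0) * (/ 2) ^ n.
Let k (n : nat) := (d0 - c0) * (/ 2) ^ n.

Lemma pow_half_pos n : 0 < (/ 2) ^ n.
Proof. apply pow_lt; lra. Qed.

Definition bad_cell (J : R) (n : nat) (p : R * R) : Prop :=
  a0 <= fst p /\ fst p + w n <= b0 /\ c0 <= snd p /\ snd p + k n <= d0 /\
  J * (/ 4) ^ n <= Rabs (flux (fst p) (fst p + w n) (snd p) (snd p + k n)).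

Lemma bad_cell_step J n p : a0 <= b0 -> c0 <= d0 -> bad_cell J n p -> exists q,
  bad_cell J (S n) q /\ fst p <= fst q /\ fst q + w (S n) <= fst p + w n /\
  snd p <= snd q /\ snd q + k (S n) <= snd p + k n.
Proof.
intros hab hcd (h1 & h2 & h3 & h4 & h5); destruct p as [x y]; simpl fst in *; simpl snd in *.
assert (ew : w n = 2 * w (S n)) by (unfold w; simpl; lra).
assert (ek : k n = 2 * k (S n)) by (unfold k; simpl; lra).
assert (w0 : 0 <= w (S n)) by (unfold w; pose proof (pow_half_pos (S n)); nra).
assert (k0 : 0 <= k (S n)) by (unfold k; pose proof (pow_half_pos (S n)); nra).
rewrite ew in h2, h5; rewrite ek in h4, h5.
rewrite (@flux_split_x x (x + w (S n))) in h5 by lra.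
rewrite (@flux_split_y x (x + w (S n)) y (y + k (S n))) in h5 by lra.
rewrite (@flux_split_y (x + w (S n)) (x + 2 * w (S n)) y (y + k (S n))) in h5 by lra.
replace (x + 2 * w (S n)) with (x + w (S n) + w (S n)) in * by ring.
replace (y + 2 * k (S n)) with (y + k (S n) + k (S n)) in * by ring.
set (f1 := flux x (x + w (S n)) y (y + k (S n))) in *.
set (f2 := flux x (x + w (S n)) (y + k (S n)) (y + k (S n) + k (S n))) in *.
set (f3 := flux (x + w (S n)) (x + w (S n) + w (S n)) y (y + k (S n))) in *.
set (f4 := flux (x + w (S n)) (x + w (S n) + w (S n)) (y + k (S n)) (y + k (S n) + k (S n))) in *.
assert (big : J * (/ 4) ^ S n <= Rabs f1 \/ J * (/ 4) ^ S n <= Rabs f2 \/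
              J * (/ 4) ^ S n <= Rabs f3 \/ J * (/ 4) ^ S n <= Rabs f4).
{ apply NNPP; intros hn; apply not_or_and in hn; destruct hn as [n1 hn].
  apply not_or_and in hn; destruct hn as [n2 hn]; apply not_or_and in hn; destruct hn as [n3 n4].
  apply Rnot_le_lt in n1; apply Rnot_le_lt in n2; apply Rnot_le_lt in n3; apply Rnot_le_lt in n4.
  pose proof (Rabs_triang (f1 + f2) (f3 + f4)); pose proof (Rabs_triang f1 f2).
  pose proof (Rabs_triang f3 f4); simpl in *; lra. }
unfold bad_cell; destruct big as [b | [b | [b | b]]];
  [exists (x, y) | exists (x, y + k (S n)) | exists (x + w (S n), y)
  | exists (x + w (S n), y + k (S n))]; simpl fst; simpl snd; repeat split; trivial; lra.
Qed.

(** Goursat's quartering: some quarter keeps at least a fourth of the flux, and the nested cells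
    shrink to a point, near which [flux_local] makes the flux smaller than J / 4^n. *)
Lemma goursat_rectangle : a0 <= b0 -> c0 <= d0 -> flux a0 b0 c0 d0 = 0.
Proof.
intros hab hcd; apply NNPP; intros hne.
set (J := Rabs (flux a0 b0 c0 d0)).
assert (Jpos : 0 < J) by now apply Rabs_pos_lt.
assert (start : bad_cell J 0 (a0, c0)).
{ unfold bad_cell, w, k; simpl; rewrite !Rmult_1_r.
  replace (a0 + (b0 - a0)) with b0 by ring; replace (c0 + (d0 - c0)) with d0 by ring.
  unfold J; repeat split; lra. }
(* Stated for all cells to obtain a total step function from [choice]; its value on cells that are
   not bad is arbitrary. *)
assert (st : forall np : nat * (R * R), exists q, bad_cell J (fst np) (snd np) ->
  bad_cell J (S (fst np)) q /\ fst (snd np) <= fst q /\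
  fst q + w (S (fst np)) <= fst (snd np) + w (fst np) /\
  snd (snd np) <= snd q /\ snd q + k (S (fst np)) <= snd (snd np) + k (fst np)).
{ intros [n p]; simpl fst; simpl snd.
  destruct (classic (bad_cell J n p)) as [hb | hb]; [| now exists p].
  destruct (bad_cell_step hab hcd hb) as [q hq]; now exists q. }
destruct (choice _ st) as [step hstep]; clear st.
set (p := nat_rect (fun _ => (R * R)%type) (a0, c0) (fun n q => step (n, q))).
assert (hp : forall n, bad_cell J n (p n)).
{ intros n; induction n as [| n IH]; [exact start |]; exact (proj1 (hstep (n, p n) IH)). }
assert (hs : forall n, fst (p n) <= fst (p (S n)) /\ fst (p (S n)) + w (S n) <= fst (p n) + w n /\
   snd (p n) <= snd (p (S n)) /\ snd (p (S n)) + k (S n) <= snd (p n) + k n).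
{ intros n; exact (proj2 (hstep (n, p n) (hp n))). }
assert (w0 : forall n, 0 <= w n) by (intros n; unfold w; pose proof (pow_half_pos n); nra).
assert (k0 : forall n, 0 <= k n) by (intros n; unfold k; pose proof (pow_half_pos n); nra).
assert (lim : forall (x l : nat -> R), (forall n, 0 <= l n) ->
  (forall n, x n <= x (S n) /\ x (S n) + l (S n) <= x n + l n) ->
  exists X, forall n, x n <= X <= x n + l n).
{ intros x l l0 hx.
  assert (mono : forall n m, (n <= m)%nat -> x n <= x m /\ x m + l m <= x n + l n).
  { intros n m hm; induction hm as [| m hm IH]; [lra |]; pose proof (hx m); lra. }
  destruct (ex_finite_lim_seq_incr x (x O + l O)) as [X hX].
  - intros n; apply hx.
  - intros n; pose proof (mono O n ltac:(lia)); pose proof (l0 n); lra.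
  - exists X; intros n; split.
    + apply (is_lim_seq_incr_compare x X hX); intros m; apply hx.
    + apply (is_lim_seq_le_loc x (fun _ => x n + l n) X (x n + l n)); [| exact hX | apply is_lim_seq_const].
      exists n; intros m hm; pose proof (mono n m hm); pose proof (l0 m); lra. }
destruct (lim (fun n => fst (p n)) w w0) as [X hX]; [intros n; split; apply hs |].
destruct (lim (fun n => snd (p n)) k k0) as [Y hY]; [intros n; split; apply hs |].
assert (p0 : p O = (a0, c0)) by reflexivity.
assert (X0 : a0 <= X <= b0).
{ pose proof (hX O) as h; rewrite p0 in h; unfold w in h; simpl in h; lra. }
assert (Y0 : c0 <= Y <= d0).
{ pose proof (hY O) as h; rewrite p0 in h; unfold k in h; simpl in h; lra. }
(* S0 / 2^n bounds both sides of the n-th cell, and the summand 1 keeps S0 positive for degenerate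
   rectangles. The tolerance J / (2 S0^2) then turns the local bound into half of J / 4^N. *)
set (S0 := (b0 - a0) + (d0 - c0) + 1).
assert (Spos : 0 < S0) by (unfold S0; lra).
assert (epos : 0 < J / (2 * S0 ^ 2)) by (apply Rdiv_lt_0_compat; nra).
destruct (flux_local X0 Y0 epos) as [del [dpos hdel]].
destruct (pow_lt_1_zero (/ 2)) with (y := del / S0) as [N hN].
{ rewrite Rabs_pos_eq; lra. }
{ now apply Rdiv_lt_0_compat. }
specialize (hN N (le_n N)); rewrite Rabs_pos_eq in hN by (left; apply pow_half_pos).
destruct (hp N) as (q1 & q2 & q3 & q4 & q5).
pose proof (pow_half_pos N) as pN.
assert (F : Rabs (flux (fst (p N)) (fst (p N) + w N) (snd (p N)) (snd (p N) + k N))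
            <= J / (2 * S0 ^ 2) * (S0 * (/ 2) ^ N) ^ 2).
{ apply hdel; trivial; try apply hX; try apply hY; unfold w, k, S0.
  - nra.
  - nra.
  - apply (Rmult_lt_compat_l S0) in hN; [| exact Spos].
    replace (S0 * (del / S0)) with del in hN by (field; lra); exact hN. }
assert (e2 : J / (2 * S0 ^ 2) * (S0 * (/ 2) ^ N) ^ 2 = J / 2 * (/ 4) ^ N).
{ replace (/ 4) with (/ 2 * / 2) by lra; rewrite !Rpow_mult_distr; field; lra. }
rewrite e2 in F.
assert (0 < (/ 4) ^ N) by (apply pow_lt; lra); nra.
Qed.

End Goursat.

Definition cdiff (g : C -> C) (z : C) : Prop :=
  exists l : C, forall e, 0 < e -> exists del, 0 < del /\ forall w, Cmod (w - z) < del ->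
    Cmod (g w - g z - l * (w - z)) <= e * Cmod (w - z).

Lemma sqrt2_le2 : sqrt 2 <= 2.
Proof. rewrite <- (sqrt_pow2 2) at 2 by lra; apply sqrt_le_1_alt; lra. Qed.

Lemma Cmod_le_2Rmax (z : C) : Cmod z <= 2 * Rmax (Rabs (fst z)) (Rabs (snd z)).
Proof.
eapply Rle_trans; [apply Cmod_2Rmax |]; apply Rmult_le_compat_r; [| apply sqrt2_le2].
eapply Rle_trans; [apply Rabs_pos | apply Rmax_l].
Qed.

Lemma cdiff_CR (g : C -> C) (x y : R) : cdiff g (x, y) -> exists a b : R,
  differentiable_pt_lim (fun u v => Re (g (u, v))) x y a (- b) /\
  differentiable_pt_lim (fun u v => Im (g (u, v))) x y b a.
Proof.
intros [[a b] h]; exists a, b.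
assert (key : forall e : posreal, locally_2d (fun u v =>
  Cmod (g (u, v) - g (x, y) - (a, b) * ((u, v) - (x, y)))%C
    <= e * Rmax (Rabs (u - x)) (Rabs (v - y))) x y).
{ intros e; destruct (h (e / 2)) as [del [dpos hd]]; [pose proof (cond_pos e); lra |].
  assert (d4 : 0 < del / 4) by lra.
  exists (mkposreal _ d4); simpl; intros u v hu hv.
  assert (m : Cmod ((u, v) - (x, y))%C <= 2 * Rmax (Rabs (u - x)) (Rabs (v - y))).
  { exact (Cmod_le_2Rmax ((u, v) - (x, y))%C). }
  assert (m2 : Rmax (Rabs (u - x)) (Rabs (v - y)) < del / 4) by now apply Rmax_lub_lt.
  eapply Rle_trans; [apply hd; lra |].
  apply Rle_trans with (e / 2 * (2 * Rmax (Rabs (u - x)) (Rabs (v - y)))).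
  - apply Rmult_le_compat_l; [pose proof (cond_pos e); lra | exact m].
  - lra. }
split; intros e; destruct (key e) as [del hd]; exists del; intros u v hu hv;
  (eapply Rle_trans; [| exact (hd u v hu hv)]).
- eapply Rle_trans; [| apply re_le_Cmod]; right; f_equal.
  destruct (g (u, v)), (g (x, y)); simpl; ring.
- eapply Rle_trans; [| apply Rabs_Im_le]; right; f_equal.
  destruct (g (u, v)), (g (x, y)); simpl; ring.
Qed.

Lemma differentiable_product (h k : R -> R) (r t h' k' : R) :
  is_derive h r h' -> is_derive k t k' ->
  differentiable_pt_lim (fun r t => h r * k t) r t (h' * k t) (h r * k').
Proof.
intros hh hk; apply filterdiff_differentiable_pt_lim.
eapply filterdiff_ext_lin.
- apply (filterdiff_mult_fct (K := R_AbsRing) (fun u : R * R => h (fst u)) (fun u : R * R => k (snd u)) (r, t)).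
  + exact Rmult_comm.
  + apply (filterdiff_comp' (fun u : R * R => fst u) h (r, t) fst (fun d => scal d h')); [| exact hh].
    apply filterdiff_linear, is_linear_fst.
  + apply (filterdiff_comp' (fun u : R * R => snd u) k (r, t) snd (fun d => scal d k')); [| exact hk].
    apply filterdiff_linear, is_linear_snd.
- intros [u v]; unfold plus, mult, scal; simpl; unfold mult; simpl.
  match goal with |- ?x = ?y => change (@eq R x y) end; ring.
Qed.

Definition polar (r t : R) : C := (r * cos t, r * sin t).

Lemma Cmod_polar r t : 0 <= r -> Cmod (polar r t) = r.
Proof.
intros hr; unfold Cmod, polar; simpl fst; simpl snd.
replace ((r * cos t) ^ 2 + (r * sin t) ^ 2) with (r ^ 2 * (Rsqr (sin t) + Rsqr (cos t)))
  by (unfold Rsqr; ring).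
rewrite sin2_cos2, Rmult_1_r; now apply sqrt_pow2.
Qed.

Lemma polar_lipschitz (t s : R) : Cmod (polar 1 t - polar 1 s) <= 2 * Rabs (t - s).
Proof.
eapply Rle_trans; [apply Cmod_le_2Rmax |]; apply Rmult_le_compat_l; [lra |]; simpl.
destruct (MVT_abs cos (fun x => - sin x) s t) as [c1 [e1 _]]; [intros; apply derivable_pt_lim_cos |].
destruct (MVT_abs sin cos s t) as [c2 [e2 _]]; [intros; apply derivable_pt_lim_sin |].
assert (b : forall x y, Rabs x <= 1 -> Rabs x * Rabs y <= Rabs y)
  by (intros x y hx; pose proof (Rabs_pos y); nra).
apply Rmax_lub.
- replace (1 * cos t + - (1 * cos s)) with (cos t - cos s) by ring; rewrite e1; apply b.
  rewrite Rabs_Ropp; apply Rabs_le, SIN_bound.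
- replace (1 * sin t + - (1 * sin s)) with (sin t - sin s) by ring; rewrite e2; apply b.
  apply Rabs_le, COS_bound.
Qed.

Lemma differentiable_polar (r t : R) :
  differentiable_pt_lim (fun r t => r * cos t) r t (cos t) (- r * sin t) /\
  differentiable_pt_lim (fun r t => r * sin t) r t (sin t) (r * cos t).
Proof.
pose proof (differentiable_product (is_derive_id r) (proj2 (is_derive_Reals _ _ _) (derivable_pt_lim_cos t))) as h1.
pose proof (differentiable_product (is_derive_id r) (proj2 (is_derive_Reals _ _ _) (derivable_pt_lim_sin t))) as h2.
change (@one R_AbsRing) with 1 in h1, h2; rewrite Rmult_1_l in h1, h2.
rewrite Ropp_mult_distr_r_reverse, Ropp_mult_distr_l in h1; now split.
Qed.

Section MeanValue.

Variable g : C -> C.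
Hypothesis hg : forall z, Cmod z < 1 -> cdiff g z.

(** In polar coordinates the Cauchy-Riemann equations say that U = Re g and V = Im g / r satisfy U_r
    = V_t, so [goursat_rectangle] applies on [a, b] x [0, 2 pi]; periodicity cancels the V-terms.
    The factor 1/r is the reason for a > 0. *)
Lemma circle_mean_const (a b : R) : 0 < a -> a <= b -> b < 1 ->
  RInt (fun t => Re (g (polar b t)) - Re (g (polar a t))) 0 (2 * PI) = 0.
Proof.
intros ha hab hb.
assert (ex : forall rt : R * R, exists q : R * R, 0 < fst rt < 1 ->
  let r := fst rt in let t := snd rt in
  differentiable_pt_lim (fun r t => Re (g (polar r t))) r t
    (fst q * cos t - snd q * sin t) (fst q * (- r * sin t) - snd q * (r * cos t)) /\
  differentiable_pt_lim (fun r t => Im (g (polar r t))) r t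
    (snd q * cos t + fst q * sin t) (snd q * (- r * sin t) + fst q * (r * cos t))).
{ intros [r t]; simpl fst; simpl snd.
  destruct (classic (0 < r < 1)) as [hr | hr]; [| now exists (0, 0)].
  destruct (@cdiff_CR g (r * cos t) (r * sin t)) as (p & q & h1 & h2).
  { apply hg; change (Cmod (polar r t) < 1); rewrite Cmod_polar; lra. }
  exists (p, q); intros _; simpl fst; simpl snd.
  pose proof (differentiable_polar r t) as [px py].
  pose proof (differentiable_pt_lim_comp _ _ _ _ _ _ _ _ _ _ _ h1 px py) as k1.
  pose proof (differentiable_pt_lim_comp _ _ _ _ _ _ _ _ _ _ _ h2 px py) as k2.
  split.
  - replace (p * cos t - q * sin t) with (p * cos t + - q * sin t) by ring.
    replace (p * (- r * sin t) - q * (r * cos t)) with (p * (- r * sin t) + - q * (r * cos t)) by ring.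
    exact k1.
  - exact k2. }
destruct (choice _ ex) as [q hq]; clear ex.
set (U := fun r t => Re (g (polar r t))).
set (V := fun r t => / r * Im (g (polar r t))).
set (be := fun r t => fst (q (r, t)) * cos t - snd (q (r, t)) * sin t).
set (gu := fun r t => fst (q (r, t)) * (- r * sin t) - snd (q (r, t)) * (r * cos t)).
assert (hU : forall r t, a <= r <= b -> 0 <= t <= 2 * PI ->
  differentiable_pt_lim U r t (be r t) (gu r t)).
{ intros r t hr _; apply (hq (r, t)); simpl; lra. }
assert (hV : exists gv, forall r t, a <= r <= b -> 0 <= t <= 2 * PI ->
  differentiable_pt_lim V r t (gv r t) (be r t)).
{ exists (fun r t => - / r ^ 2 * Im (g (polar r t))
     + / r * (snd (q (r, t)) * cos t + fst (q (r, t)) * sin t)).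
  intros r t hr _.
  destruct (hq (r, t)) as [_ h2]; [simpl; lra |]; cbv zeta in h2; simpl fst in h2; simpl snd in h2.
  assert (i : differentiable_pt_lim (fun r _ : R => / r) r t (- / r ^ 2) 0).
  { apply differentiable_pt_lim_proj1_0, is_derive_Reals.
    auto_derive; [lra | field; lra]. }
  pose proof (differentiable_product (is_derive_id (/ r)) (is_derive_id (Im (g (polar r t))))) as m.
  change (@one R_AbsRing) with 1 in m; rewrite Rmult_1_l, Rmult_1_r in m.
  pose proof (differentiable_pt_lim_comp _ _ _ _ _ _ _ _ _ _ _ m i h2) as k.
  assert (e2 : Im (g (polar r t)) * 0 + / r * (snd (q (r, t)) * (- r * sin t) + fst (q (r, t)) * (r * cos t)) = be r t).
  { unfold be; field; lra. }
  rewrite e2 in k; rewrite (Rmult_comm (- / r ^ 2)); exact k. }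
destruct hV as [gv hV].
pose proof PI_RGT_0.
pose proof (@goursat_rectangle U V be gu gv a b 0 (2 * PI) hU hV hab ltac:(lra)) as G.
unfold flux in G.
rewrite (RInt_ext (fun s => V s (2 * PI) - V s 0) (fun _ => 0)) in G.
2: { intros s _; unfold V, polar; rewrite cos_2PI, sin_2PI, cos_0, sin_0; apply Rminus_eq_0. }
rewrite RInt_const in G; unfold scal in G; simpl in G; unfold mult in G; simpl in G.
rewrite Rmult_0_r, Rminus_0_r in G; exact G.
Qed.

Hypothesis g_cont : forall z, Cmod z <= 1 -> forall e, 0 < e -> exists del, 0 < del /\
  forall w, Cmod w <= 1 -> Cmod (w - z) < del -> Cmod (g w - g z) < e.

Lemma Re_diff_le (z w : C) : Rabs (Re z - Re w) <= Cmod (z - w).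
Proof.
eapply Rle_trans; [| apply re_le_Cmod]; right; f_equal; destruct z, w; simpl; ring.
Qed.

Lemma polar_dist (r s t : R) : 0 <= r -> 0 <= s -> Cmod (polar r t - polar s t) = Rabs (r - s).
Proof.
intros hr hs.
replace (polar r t - polar s t)%C with (RtoC (r - s) * polar 1 t)%C.
2: { unfold polar; apply injective_projections; simpl; ring. }
rewrite Cmod_mult, Cmod_R, Cmod_polar; lra.
Qed.

Lemma polar_continuous_t (r t : R) : 0 < r < 1 ->
  continuous (fun t => Re (g (polar r t))) t.
Proof.
intros hr.
destruct (@cdiff_CR g (r * cos t) (r * sin t)) as (p & q & h1 & _).
{ apply hg; change (Cmod (polar r t) < 1); rewrite Cmod_polar; lra. }
pose proof (differentiable_pt_lim_comp _ _ _ _ _ _ _ _ _ _ _ h1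
  (proj1 (differentiable_polar r t)) (proj2 (differentiable_polar r t))) as k.
apply (continuity_2d_section_r (f := fun r t => Re (g (polar r t)))).
eapply differentiable_continuity_pt; eexists; eexists; exact k.
Qed.

Lemma polar_ex_RInt (r : R) : 0 < r < 1 -> ex_RInt (fun t => Re (g (polar r t))) 0 (2 * PI).
Proof.
intros hr; apply (ex_RInt_continuous (V := R_CompleteNormedModule)); intros t _.
now apply polar_continuous_t.
Qed.

(** If the real part at 0 exceeded [M], it would do so on a small circle by continuity; but its mean
    there equals the mean over the circle of radius [b]. *)
Lemma center_le_circle (b M : R) : 0 < b < 1 ->
  (forall t, 0 <= t <= 2 * PI -> Re (g (polar b t)) <= M) -> Re (g 0%C) <= M.
Proof.
intros hb hM; apply Rnot_lt_le; intros hl.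
destruct (@g_cont 0%C) with (e := Re (g 0%C) - M) as [del [dpos hd]]; [rewrite Cmod_0; lra | lra |].
set (a := Rmin b (del / 2)).
assert (ha : 0 < a) by (apply Rmin_pos; lra).
assert (ab : a <= b) by apply Rmin_l.
assert (ad : a < del) by (pose proof (Rmin_r b (del / 2)); unfold a; lra).
pose proof (circle_mean_const ha ab (proj2 hb)) as G.
pose proof PI_RGT_0.
assert (pos : 0 < RInt (fun t => Re (g (polar a t)) - Re (g (polar b t))) 0 (2 * PI)).
{ apply RInt_gt_0; [lra | |].
  - intros t ht; specialize (hM t ltac:(lra)).
    specialize (hd (polar a t)); rewrite Cmod_polar in hd by lra.
    specialize (hd ltac:(lra)).
    replace (polar a t - 0)%C with (polar a t) in hd by ring.
    rewrite Cmod_polar in hd by lra; specialize (hd ad).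
    pose proof (Re_diff_le (g (polar a t)) (g 0%C)) as k; apply Rabs_le_between in k; lra.
  - intros t ht.
    apply (continuous_minus (V := R_NormedModule)); apply polar_continuous_t; lra. }
assert (exb := @polar_ex_RInt b ltac:(lra)); assert (exa := @polar_ex_RInt a ltac:(lra)).
pose proof (RInt_minus (V := R_CompleteNormedModule) _ _ _ _ exa exb) as e1.
pose proof (RInt_minus (V := R_CompleteNormedModule) _ _ _ _ exb exa) as e2.
change minus with Rminus in e1, e2; simpl in e1, e2; lra.
Qed.

Lemma max_principle_Re (M : R) : (forall z, Cmod z = 1 -> Re (g z) <= M) -> Re (g 0%C) <= M.
Proof.
intros hM; apply Rnot_lt_le; intros hl.
set (e := (Re (g 0%C) - M) / 2).
assert (gauge : forall t : R, exists del : posreal, forall w, Cmod w <= 1 ->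
  Cmod (w - polar 1 t) < del -> Re (g w) < M + e).
{ intros t; destruct (@g_cont (polar 1 t)) with (e := e) as [del [dpos hd]];
    [rewrite Cmod_polar; lra | unfold e; lra |].
  exists (mkposreal del dpos); simpl; intros w hw hw'.
  specialize (hd w hw hw').
  pose proof (Re_diff_le (g w) (g (polar 1 t))) as k; apply Rabs_le_between in k.
  pose proof (hM (polar 1 t) (Cmod_polar t Rle_0_1)); unfold e in *; lra. }
destruct (choice _ gauge) as [del hdel]; clear gauge.
(* The point is at distance at most h + 2 |t - t0| from [polar 1 t0]; with h <= d/2, d <= del/8 and
   |t - t0| < del/8 this stays below del. *)
set (del' := fun t => mkposreal (del t / 8) ltac:(pose proof (cond_pos (del t)); lra)).
destruct (compactness_value_1d 0 (2 * PI) del') as [d hd].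
set (h := Rmin (d / 2) (/ 2)).
assert (hpos : 0 < h) by (apply Rmin_pos; [pose proof (cond_pos d) |]; lra).
assert (hd2 : h <= d / 2) by apply Rmin_l.
assert (hh : h <= / 2) by apply Rmin_r.
assert (C1 : Re (g 0%C) <= M + e); [| unfold e in C1; lra].
apply (@center_le_circle (1 - h)); [lra |]; intros t ht.
apply Rnot_lt_le; intros hbig; apply (hd t ht); intros (t0 & _ & h1 & h2).
simpl in h1, h2.
apply (Rlt_irrefl (M + e)); eapply Rlt_trans; [exact hbig |].
apply (hdel t0); [rewrite Cmod_polar; lra |].
replace (polar (1 - h) t - polar 1 t0)%C
  with ((polar (1 - h) t - polar 1 t) + (polar 1 t - polar 1 t0))%C by ring.
eapply Rle_lt_trans; [apply Cmod_triangle |].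
rewrite polar_dist by lra; replace (1 - h - 1) with (- h) by ring; rewrite Rabs_Ropp, Rabs_pos_eq by lra.
pose proof (polar_lipschitz t t0); pose proof (cond_pos d); lra.
Qed.

End MeanValue.

Lemma max_modulus (g : C -> C) (M : R) :
  (forall z, Cmod z < 1 -> cdiff g z) ->
  (forall z, Cmod z <= 1 -> forall e, 0 < e -> exists del, 0 < del /\
    forall w, Cmod w <= 1 -> Cmod (w - z) < del -> Cmod (g w - g z) < e) ->
  (forall z, Cmod z = 1 -> Cmod (g z) <= M) -> Cmod (g 0%C) <= M.
Proof.
intros hd hc hM.
destruct (Req_dec (Cmod (g 0%C)) 0) as [h0 | h0].
{ rewrite h0; eapply Rle_trans; [apply Cmod_ge_0 | apply (hM (polar 1 0)), Cmod_polar; lra]. }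
assert (gp : 0 < Cmod (g 0%C)) by (pose proof (Cmod_ge_0 (g 0%C)); lra).
(* The unimodular factor that rotates g(0) onto |g(0)|, reducing the claim to real parts. *)
set (c := (Cconj (g 0%C) / RtoC (Cmod (g 0%C)))%C).
assert (mc : Cmod c = 1).
{ unfold c; rewrite Cmod_div by (intros E; apply h0, RtoC_inj; exact E).
  rewrite Cmod_conj, Cmod_R, Rabs_pos_eq by lra; field; lra. }
assert (e0 : Re (c * g 0%C)%C = Cmod (g 0%C)).
{ replace (c * g 0%C)%C with (RtoC (Cmod (g 0%C))); [reflexivity |].
  unfold c; replace (Cconj (g 0%C) / Cmod (g 0%C) * g 0%C)%C
    with (g 0%C * Cconj (g 0%C) / Cmod (g 0%C))%C by (unfold Cdiv; ring).
  rewrite <- Cmod2_conj; unfold Cdiv; rewrite <- RtoC_inv, <- RtoC_mult by lra; f_equal; field; lra. }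
rewrite <- e0; apply (@max_principle_Re (fun z => c * g z)%C).
- intros z hz; destruct (hd z hz) as [l hl]; exists (c * l)%C; intros e he.
  destruct (hl e he) as [del [dp hdel]]; exists del; split; [exact dp |]; intros w hw.
  replace (c * g w - c * g z - c * l * (w - z))%C with (c * (g w - g z - l * (w - z)))%C by ring.
  rewrite Cmod_mult, mc, Rmult_1_l; now apply hdel.
- intros z hz e he; destruct (hc z hz e he) as [del [dp hdel]]; exists del; split; [exact dp |].
  intros w hw hw'; replace (c * g w - c * g z)%C with (c * (g w - g z))%C by ring.
  rewrite Cmod_mult, mc, Rmult_1_l; now apply hdel.
- intros z hz; eapply Rle_trans; [apply Rle_abs |]; eapply Rle_trans; [apply re_le_Cmod |].
  rewrite Cmod_mult, mc, Rmult_1_l; now apply hM.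
Qed.

(** * A calculus of complex differentiability *)

Definition ccont (g : C -> C) (z : C) : Prop :=
  forall e, 0 < e -> exists del, 0 < del /\ forall w, Cmod (w - z) < del -> Cmod (g w - g z) < e.

Lemma Cmod_dist (a b : C) : Cmod a <= Cmod b + Cmod (a - b) /\ Cmod b <= Cmod a + Cmod (a - b).
Proof.
split.
- replace a with (b + (a - b))%C at 1 by ring; apply Cmod_triangle.
- replace b with (a + - (a - b))%C at 1 by ring; rewrite <- (Cmod_opp (a - b)); apply Cmod_triangle.
Qed.

Lemma ccont_const (c z : C) : ccont (fun _ => c) z.
Proof.
intros e he; exists 1; split; [lra |]; intros w _.
replace (c - c)%C with (RtoC 0) by ring; now rewrite Cmod_0.
Qed.

Lemma ccont_id (z : C) : ccont (fun w => w) z.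
Proof. intros e he; now exists e. Qed.

Lemma ccont_continuous (g : C -> C) z : ccont g z <->
  continuous (T := AbsRing_UniformSpace C_AbsRing) (U := AbsRing_UniformSpace C_AbsRing) g z.
Proof.
split.
- intros h Q [e hQ]; destruct (h e (cond_pos e)) as [d [dp hd]].
  exists (mkposreal d dp); intros w hw; apply hQ, hd, hw.
- intros h e he; destruct (h _ (@locally_ball (AbsRing_UniformSpace C_AbsRing) (g z) (mkposreal e he))) as [d hd].
  exists d; split; [apply cond_pos | exact hd].
Qed.

Lemma ccont_plus (g h : C -> C) z : ccont g z -> ccont h z -> ccont (fun w => g w + h w)%C z.
Proof.
rewrite !ccont_continuous; exact (@continuous_plus (AbsRing_UniformSpace C_AbsRing) C_AbsRing (AbsRing_NormedModule C_AbsRing) g h z).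
Qed.

Lemma ccont_mult (g h : C -> C) z : ccont g z -> ccont h z -> ccont (fun w => g w * h w)%C z.
Proof.
rewrite !ccont_continuous; exact (@continuous_mult (AbsRing_UniformSpace C_AbsRing) C_AbsRing g h z).
Qed.

Lemma ccont_inv (h : C -> C) z : h z <> 0%C -> ccont h z -> ccont (fun w => / h w)%C z.
Proof.
intros h0 hh e he.
set (B := Cmod (h z)); assert (B0 : 0 < B) by now apply Cmod_gt_0.
(* The first bound gives |h w| > B/2; the second then gives |h w - h z| / (|h w| B) < e. *)
set (q := Rmin (B / 2) (e * B ^ 2 / 2)).
assert (q0 : 0 < q) by (apply Rmin_pos; [lra |]; apply Rdiv_lt_0_compat; [apply Rmult_lt_0_compat; [lra | now apply pow_lt] | lra]).
assert (q1 : q <= B / 2) by apply Rmin_l.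
assert (q2 : q <= e * B ^ 2 / 2) by apply Rmin_r.
destruct (hh q q0) as [d [p hd]]; exists d; split; [exact p |]; intros w hw.
specialize (hd w hw).
assert (lw : B / 2 < Cmod (h w)).
{ pose proof (proj2 (Cmod_dist (h w) (h z))) as t; fold B in t; lra. }
assert (nw : h w <> 0%C) by (intros E; rewrite E, Cmod_0 in lw; lra).
replace (/ h w - / h z)%C with (- (h w - h z) * / (h w * h z))%C by (field; now split).
rewrite Cmod_mult, Cmod_opp, Cmod_inv by now apply Cmult_neq_0.
rewrite Cmod_mult; fold B.
apply Rmult_lt_reg_r with (Cmod (h w) * B); [nra |].
rewrite Rmult_assoc, Rinv_l, Rmult_1_r by nra.
nra.
Qed.

(** Caratheodory's formulation: the difference quotient, completed by the derivative at z, is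
    continuous. It turns the rules for products, inverses and composition into algebra with [ccont]
    functions. *)
Lemma cdiff_caratheodory (g : C -> C) z :
  cdiff g z <-> exists psi, ccont psi z /\ forall w, (g w - g z = psi w * (w - z))%C.
Proof.
split.
- intros [l hl].
  exists (fun w => if excluded_middle_informative (w = z) then l else ((g w - g z) / (w - z))%C).
  split.
  + intros e he; destruct (hl (e / 2)) as [d [p hd]]; [lra |]; exists d; split; [exact p |]; intros w hw.
    destruct (excluded_middle_informative (z = z)) as [_ | c]; [| now elim c].
    destruct (excluded_middle_informative (w = z)) as [_ | c].
    * replace (l - l)%C with (RtoC 0) by ring; now rewrite Cmod_0.
    * assert (n : (w - z)%C <> 0%C) by (intros E; apply c; replace w with (w - z + z)%C by ring; rewrite E; ring).
      replace ((g w - g z) / (w - z) - l)%C with ((g w - g z - l * (w - z)) * / (w - z))%C by now field.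
      rewrite Cmod_mult, Cmod_inv by exact n.
      assert (0 < Cmod (w - z)) by now apply Cmod_gt_0.
      apply Rmult_lt_reg_r with (Cmod (w - z)); [lra |].
      rewrite Rmult_assoc, Rinv_l, Rmult_1_r by lra.
      specialize (hd w hw); nra.
  + intros w; destruct (excluded_middle_informative (w = z)) as [-> | c]; [ring |].
    field; intros E; apply c; replace w with (w - z + z)%C by ring; rewrite E; ring.
- intros [psi [hc hp]]; exists (psi z); intros e he.
  destruct (hc e he) as [d [p hd]]; exists d; split; [exact p |]; intros w hw.
  rewrite hp; replace (psi w * (w - z) - psi z * (w - z))%C with ((psi w - psi z) * (w - z))%C by ring.
  rewrite Cmod_mult; apply Rmult_le_compat_r; [apply Cmod_ge_0 | left; now apply hd].
Qed.

Lemma cdiff_ccont (g : C -> C) z : cdiff g z -> ccont g z.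
Proof.
intros hg; apply cdiff_caratheodory in hg; destruct hg as [psi [hc hp]].
assert (k : ccont (fun w => g z + psi w * (w + - z))%C z).
{ apply ccont_plus; [apply ccont_const |]; apply ccont_mult; [exact hc |].
  apply ccont_plus; [apply ccont_id | apply ccont_const]. }
intros e he; destruct (k e he) as [d [p hd]]; exists d; split; [exact p |]; intros w hw.
specialize (hd w hw); rewrite hp.
replace (psi w * (w - z))%C with (g z + psi w * (w + - z) - (g z + psi z * (z + - z)))%C by ring.
exact hd.
Qed.

Lemma cdiff_const (c z : C) : cdiff (fun _ => c) z.
Proof.
apply cdiff_caratheodory; exists (fun _ => 0%C); split; [apply ccont_const |]; intros w; ring.
Qed.

Lemma cdiff_id (z : C) : cdiff (fun w => w) z.
Proof.
apply cdiff_caratheodory; exists (fun _ => 1%C); split; [apply ccont_const |]; intros w; ring.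
Qed.

Lemma cdiff_plus (g h : C -> C) z : cdiff g z -> cdiff h z -> cdiff (fun w => g w + h w)%C z.
Proof.
rewrite !cdiff_caratheodory; intros [p [c1 h1]] [q [c2 h2]].
exists (fun w => p w + q w)%C; split; [now apply ccont_plus |]; intros w.
replace (g w + h w - (g z + h z))%C with ((g w - g z) + (h w - h z))%C by ring.
rewrite h1, h2; ring.
Qed.

Lemma cdiff_mult (g h : C -> C) z : cdiff g z -> cdiff h z -> cdiff (fun w => g w * h w)%C z.
Proof.
intros hg hh; pose proof (cdiff_ccont hh) as ch; revert hg hh.
rewrite !cdiff_caratheodory; intros [p [c1 h1]] [q [c2 h2]].
exists (fun w => p w * h w + g z * q w)%C; split.
- apply ccont_plus; apply ccont_mult; trivial; apply ccont_const.
- intros w; replace (g w * h w - g z * h z)%C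
    with ((g w - g z) * h w + g z * (h w - h z))%C by ring.
  rewrite h1, h2; ring.
Qed.

(** For inverses, whose difference quotient has its algebraic form only near z, where the
    denominator does not vanish. *)
Lemma cdiff_local (g psi : C -> C) z r : 0 < r -> ccont psi z ->
  (forall w, Cmod (w - z) < r -> (g w - g z = psi w * (w - z))%C) -> cdiff g z.
Proof.
intros hr hc hp; exists (psi z); intros e he.
destruct (hc e he) as [d [p hd]]; exists (Rmin r d); split; [now apply Rmin_pos |]; intros w hw.
rewrite hp by (eapply Rlt_le_trans; [exact hw | apply Rmin_l]).
replace (psi w * (w - z) - psi z * (w - z))%C with ((psi w - psi z) * (w - z))%C by ring.
rewrite Cmod_mult; apply Rmult_le_compat_r; [apply Cmod_ge_0 |].
left; apply hd; eapply Rlt_le_trans; [exact hw | apply Rmin_r].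
Qed.

Lemma cdiff_inv (h : C -> C) z : h z <> 0%C -> cdiff h z -> cdiff (fun w => / h w)%C z.
Proof.
intros h0 hh; pose proof (cdiff_ccont hh) as ch.
apply cdiff_caratheodory in hh; destruct hh as [p [cp hp]].
assert (B0 : 0 < Cmod (h z)) by now apply Cmod_gt_0.
destruct (ch _ B0) as [d [dp hd]].
apply (@cdiff_local _ (fun w => - (1) * p w * / (h w * h z))%C z d dp).
- apply ccont_mult; [apply ccont_mult; [apply ccont_const | exact cp] |].
  apply ccont_inv; [now apply Cmult_neq_0 |].
  apply ccont_mult; [exact ch | apply ccont_const].
- intros w hw; specialize (hd w hw).
  assert (nw : h w <> 0%C).
  { intros E; rewrite E in hd; replace (0 - h z)%C with (- h z)%C in hd by ring.
    rewrite Cmod_opp in hd; lra. }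
  replace (/ h w - / h z)%C with (- (h w - h z) * / (h w * h z))%C by (field; now split).
  rewrite hp; ring.
Qed.

Lemma cdiff_ext (g h : C -> C) z : (forall w, g w = h w) -> cdiff g z -> cdiff h z.
Proof. intros e; replace h with g; [trivial |]; now apply functional_extensionality. Qed.

(** * Fuglede's theorem *)

Ltac commute_pointwise := unfold normal, commute; intros;
  repeat match goal with h : (_ * _ = _ * _)%B |- _ =>
    let e := fresh in pointwise h as e; clear h end;
  apply bop_eq; intros x; bopE; hvec_push;
  repeat match goal with e : forall _, _ = _ |- _ => rewrite !e; clear e end; hvec.

Lemma commute_sym (H : Hilbert) (S T : bop H H) : commute S T -> commute T S.
Proof. exact (@eq_sym _ _ _). Qed.

Lemma commute_affine (H : Hilbert) (S T : bop H H) (c : C) : commute S T -> commute S (1 + c *: T)%B.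
Proof. commute_pointwise. Qed.

Lemma commute_shift (H : Hilbert) (S T : bop H H) (c : C) : commute S T -> commute (S - c *: 1)%B T.
Proof. commute_pointwise. Qed.

Lemma commute_comp (H : Hilbert) (S T R : bop H H) :
  commute S T -> commute S R -> commute S (T * R)%B.
Proof. commute_pointwise. Qed.

Lemma commute_minus (H : Hilbert) (S T R : bop H H) :
  commute S T -> commute S R -> commute S (T - R)%B.
Proof. commute_pointwise. Qed.

Lemma normal_affine (H : Hilbert) (T : bop H H) (c : C) : normal T -> normal (1 + c *: T)%B.
Proof. unfold normal; rewrite adj_add, adj_id, adj_scal; commute_pointwise. Qed.

Lemma normal_shift (H : Hilbert) (T : bop H H) (c : C) : normal T -> normal (T - c *: 1)%B.
Proof. unfold normal; rewrite adj_add, adj_opp, adj_scal, adj_id; commute_pointwise. Qed.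

Lemma normal_norm (H : Hilbert) (T : bop H H) x : normal T -> norm (T^*%B x) = norm (T x).
Proof.
intros h; apply hnorm_unique; rewrite adjP', (adjP T).
unfold normal in h; pointwise h as e; now rewrite e.
Qed.

Lemma adj_bpow (H : Hilbert) (T : bop H H) n : ((T ^ n)^* = T^* ^ n)%B.
Proof. apply adj_unique; intros x y; apply adj_pow. Qed.

Lemma normal_pow (H : Hilbert) (T : bop H H) n : normal T -> normal (T ^ n)%B.
Proof.
intros h; unfold normal; rewrite adj_bpow; apply commute_pow, commute_sym, commute_pow, commute_sym, h.
Qed.

Lemma affine_pow_bound (H : Hilbert) (T : bop H H) (c : C) (s u : R) n x :
  (forall x, norm (T x) <= s * norm x) -> 0 <= s -> Cmod c * s <= u ->
  norm (((1 + c *: T) ^ n)%B x) <= (1 + u) ^ n * norm x.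
Proof.
intros hs s0 hu; induction n as [| n IH]; [simpl; lra |].
change (((1 + c *: T) ^ S n)%B x) with ((1 + c *: T)%B (((1 + c *: T) ^ n)%B x)).
set (y := ((1 + c *: T) ^ n)%B x) in *; bopE.
eapply Rle_trans; [apply hnorm_triangle |]; rewrite norm_scal_Hilbert.
pose proof (hs y); pose proof (Cmod_ge_0 c); pose proof (hnorm_ge0 y).
assert (Cmod c * norm (T y) <= u * norm y).
{ apply Rle_trans with (Cmod c * (s * norm y)); [now apply Rmult_le_compat_l |].
  rewrite <- Rmult_assoc; now apply Rmult_le_compat_r. }
simpl; rewrite Rmult_assoc.
assert (0 <= u) by (eapply Rle_trans; [| exact hu]; now apply Rmult_le_pos).
apply Rle_trans with ((1 + u) * norm y); [lra | apply Rmult_le_compat_l; lra].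
Qed.

(** Bernoulli gives (1 - u)^n >= 1 - n u >= 1/2, while (1 + u)^n (1 - u)^n <= 1. *)
Lemma pow_one_plus_small (u : R) n : 0 <= u -> INR n * u <= / 2 -> u <= 1 -> (1 + u) ^ n <= 2.
Proof.
intros hu hn u1.
assert (b : forall m, 1 - INR m * u <= (1 - u) ^ m).
{ intros m; induction m as [| m IH]; [simpl; lra |].
  rewrite S_INR; simpl; pose proof (pos_INR m).
  apply Rle_trans with ((1 - u) * (1 - INR m * u)); [nra | apply Rmult_le_compat_l; lra]. }
assert (c : forall m, (1 + u) ^ m * (1 - u) ^ m <= 1).
{ intros m; rewrite <- Rpow_mult_distr.
  apply Rle_trans with (1 ^ m); [apply pow_incr; nra | rewrite pow1; lra]. }
specialize (b n); specialize (c n).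
assert (0 < (1 + u) ^ n) by (apply pow_lt; lra); nra.
Qed.

Lemma bpow_mult (H : Hilbert) (S T : bop H H) n : commute S T -> ((S * T) ^ n = S ^ n * T ^ n)%B.
Proof.
intros h; induction n as [| n IH]; [now apply bop_eq |].
change ((S * T) ^ Datatypes.S n)%B with (S * T * (S * T) ^ n)%B; rewrite IH.
pose proof (commute_pow n (commute_sym h)) as c; unfold commute in c; pointwise c as e.
apply bop_eq; intros x; bopE.
change (S (T ((S ^ n)%B ((T ^ n)%B x))) = S ((S ^ n)%B (T ((T ^ n)%B x)))); now rewrite e.
Qed.

(* [f] is a vector polynomial with constant term [v0] and linear coefficient [v1]; only the
   holomorphy of the remainder is recorded. *)
Definition vpoly (H : Hilbert) (f : C -> H) (v0 v1 : H) : Prop :=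
  exists q : C -> H, (forall t, f t = plus v0 (plus (scal t v1) (scal (t * t)%C (q t)))) /\
    forall y z, cdiff (fun t => inner (q t) y) z.

Lemma vpoly_bop (H K : Hilbert) (T : bop H K) (f : C -> H) v0 v1 :
  vpoly f v0 v1 -> vpoly (fun t => T (f t)) (T v0) (T v1).
Proof.
intros [q [h1 h2]]; exists (fun t => T (q t)); split.
- intros t; now rewrite h1, !bop_plus, !bop_scal.
- intros y z; apply cdiff_ext with (fun t => inner (q t) (T^*%B y)); [intros w; symmetry; apply adjP | apply h2].
Qed.

Lemma vpoly_affine (H : Hilbert) (T : bop H H) (f : C -> H) v0 v1 :
  vpoly f v0 v1 -> vpoly (fun t => (1 + t *: T)%B (f t)) v0 (plus v1 (T v0)).
Proof.
intros [q [h1 h2]]; exists (fun t => plus (q t) (plus (T v1) (scal t (T (q t))))); split.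
- intros t; bopE; rewrite h1, !bop_plus, !bop_scal; hvec.
- intros y z.
  apply cdiff_ext with (fun t => inner (q t) y + (inner (T v1) y + t * inner (q t) (T^*%B y)))%C.
  { intros t; now rewrite !inner_plus_l, inner_scal_l, (adjP T (q t)). }
  apply cdiff_plus; [apply h2 |]; apply cdiff_plus; [apply cdiff_const |].
  apply cdiff_mult; [apply cdiff_id | apply h2].
Qed.

Lemma vpoly_affine_pow (H : Hilbert) (T : bop H H) (f : C -> H) v0 v1 n :
  vpoly f v0 v1 ->
  vpoly (fun t => ((1 + t *: T) ^ n)%B (f t)) v0 (plus v1 (scal (RtoC (INR n)) (T v0))).
Proof.
intros hf; induction n as [| n IH].
- replace (plus v1 (scal (RtoC (INR 0)) (T v0))) with v1; [exact hf |].
  apply inner_ext; intros z; rewrite inner_plus_l, inner_scal_l; simpl; ring.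
- replace (plus v1 (scal (RtoC (INR (S n))) (T v0)))
    with (plus (plus v1 (scal (RtoC (INR n)) (T v0)) : H) (T v0)).
  2: { apply inner_ext; intros z; rewrite !inner_plus_l, !inner_scal_l, S_INR, RtoC_plus; ring. }
  apply (vpoly_affine T IH).
Qed.

Section Fuglede.

Variables (H : Hilbert) (N A : bop H H).
Hypotheses (hN : normal N) (hAN : commute A N).

(** Powers of 1 + c N^* play the part of an exponential. For normal T the vectors (T^n)^* y and T^n
    y have equal norms, and T^n commutes with [A]; so [A] is pulled out at a cost independent of
    n. *)
Lemma fuglede_transfer (M : R) (c : C) n x :
  (forall x, norm (A x) <= M * norm x) ->
  norm (((1 + c *: N^*) ^ n)%B (A x)) <= M * norm (((1 + c *: N^*) ^ n)%B x).
Proof.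
intros hM.
set (T := (1 + Cconj c *: N)%B).
assert (e : ((1 + c *: N^*) ^ n = (T ^ n)^*)%B).
{ rewrite adj_bpow; unfold T; now rewrite adj_add, adj_id, adj_scal, Cconj_conj. }
assert (nT : normal (T ^ n)%B) by now apply normal_pow, normal_affine.
assert (cT : commute A (T ^ n)%B) by now apply commute_pow, commute_affine.
pointwise cT as k; rewrite e, !normal_norm, <- k by exact nT; apply hM.
Qed.

(* [(1 - a t N^* )^k A (1 + a t N^* )^k] stays bounded on [|t| = 1] for [a = r / k], [k] large,
   and its linear coefficient in [t] is [r (A N^* - N^* A)]; Cauchy's estimate and [r -> oo]
   give the claim. *)
Theorem fuglede : commute A N^*%B.
Proof.
destruct (bop_bound A) as [M [M0 hM]], (bop_bound N^*%B) as [s [s0 hs]].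
set (S := N^*%B) in *.
assert (key : forall x y r, 0 < r ->
  r * Cmod (inner (minus (A (S x)) (S (A x))) y) <= 4 * M * norm x * norm y).
{ intros x y r hr.
  (* [n] is so large that a s <= 1 and n (a s)^2 = (r s)^2 / n <= 1/2. *)
  destruct (INR_unbounded (2 * (r * s) ^ 2 + r * s + 1)) as [n hn].
  assert (rs : 0 < r * s) by now apply Rmult_lt_0_compat.
  assert (n0 : 0 < INR n) by (pose proof (pow2_ge_0 (r * s)); lra).
  set (a := r / INR n).
  assert (a0 : 0 < a) by now apply Rdiv_lt_0_compat.
  set (u := (a * s) ^ 2).
  assert (as1 : a * s * INR n = r * s) by (unfold a; field; lra).
  assert (nu : INR n * u <= / 2).
  { apply Rmult_le_reg_l with (INR n); [exact n0 |].
    replace (INR n * (INR n * u)) with ((r * s) ^ 2) by (rewrite <- as1; unfold u; ring); lra. }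
  assert (u0 : 0 <= u) by apply pow2_ge_0.
  assert (u1 : u <= 1).
  { assert (a * s <= 1).
    { apply Rmult_le_reg_r with (INR n); [exact n0 |]; rewrite as1; pose proof (pow2_ge_0 (r * s)); lra. }
    unfold u; assert (0 < a * s) by now apply Rmult_lt_0_compat. nra. }
  set (Sp := (RtoC a *: S)%B); set (Sm := (RtoC (- a) *: S)%B).
  set (f := fun t : C => ((1 + t *: Sm) ^ n)%B (A (((1 + t *: Sp) ^ n)%B x))).
  assert (vp : vpoly f (A x) (plus (A (scal (RtoC (INR n)) (Sp x))) (scal (RtoC (INR n)) (Sm (A x))))).
  { apply vpoly_affine_pow.
    replace (A (scal (RtoC (INR n)) (Sp x))) with (A (plus zero (scal (RtoC (INR n)) (Sp x)))).
    2: { now rewrite plus_zero_l. }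
    apply vpoly_bop, vpoly_affine_pow.
    exists (fun _ => zero); split.
    - intros t; hvec.
    - intros y0 z; apply cdiff_ext with (fun _ => 0%C); [intros; now rewrite inner_zero_l | apply cdiff_const]. }
  assert (bf : forall t, Cmod t <= 1 -> norm (f t) <= 2 * M * norm x).
  { intros t ht; unfold f.
    assert (em : (1 + t *: Sm = 1 + (t * RtoC (- a))%C *: S)%B) by (unfold Sm; apply bop_eq; intros v; bopE; hvec).
    rewrite em.
    eapply Rle_trans; [apply fuglede_transfer, hM |].
    rewrite (Rmult_comm 2), Rmult_assoc; apply Rmult_le_compat_l; [lra |].
    (* First-order terms cancel: (1 - a t S) (1 + a t S) = 1 - a^2 t^2 S^2, so the n-th power has
       norm at most (1 + (a s)^2)^n <= 2. *)
    assert (ep : ((1 + (t * RtoC (- a))%C *: S) ^ n * (1 + t *: Sp) ^ n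
                = (1 + (- (t * t * RtoC (a * a)))%C *: (S * S)) ^ n)%B).
    { rewrite <- bpow_mult.
      - f_equal; unfold Sp; apply bop_eq; intros v; bopE; hvec_push.
        rewrite RtoC_opp, RtoC_mult; hvec.
      - unfold Sp, commute; apply bop_eq; intros v; bopE; hvec_push; hvec. }
    change (norm (((1 + (t * RtoC (- a))%C *: S) ^ n * (1 + t *: Sp) ^ n)%B x) <= 2 * norm x).
    rewrite ep.
    eapply Rle_trans.
    - apply (@affine_pow_bound H (S * S)%B _ (s * s) u); [| nra |].
      + intros v; bopE; eapply Rle_trans; [apply hs |]; rewrite Rmult_assoc; apply Rmult_le_compat_l; [lra | apply hs].
      + rewrite Cmod_opp, !Cmod_mult, Cmod_R, Rabs_pos_eq by nra.
        unfold u; pose proof (Cmod_ge_0 t).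
        assert (Cmod t * Cmod t <= 1) by nra.
        assert (0 <= a * a * (s * s)) by (apply Rmult_le_pos; nra).
        replace ((a * s) ^ 2) with (1 * (a * a * (s * s))) by ring.
        replace (Cmod t * Cmod t * (a * a) * (s * s)) with (Cmod t * Cmod t * (a * a * (s * s))) by ring.
        now apply Rmult_le_compat_r.
    - apply Rmult_le_compat_r; [apply hnorm_ge0 | now apply pow_one_plus_small]. }
  destruct vp as [q [hq cq]].
  set (v1 := plus (A (scal (RtoC (INR n)) (Sp x))) (scal (RtoC (INR n)) (Sm (A x)))) in *.
  assert (ev : v1 = scal (RtoC r) (minus (A (S x)) (S (A x)))).
  { unfold v1, Sp, Sm; bopE; rewrite !bop_scal.
    apply inner_ext; intros z; rewrite inner_plus_l, !inner_scal_l, inner_minus_l.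
    replace r with (INR n * a) by (unfold a; field; lra).
    rewrite RtoC_mult, RtoC_opp; ring. }
  (* This is <f t - A x, y> / t with the singularity at 0 removed; its value at 0 is the linear
     coefficient, and on the circle it is controlled by the bounds on [f] and [A]. *)
  set (h := fun t : C => (inner v1 y + t * inner (q t) y)%C).
  assert (ch : forall z, cdiff h z).
  { intros z; apply cdiff_plus; [apply cdiff_const |]; apply cdiff_mult; [apply cdiff_id | apply cq]. }
  assert (hb : Cmod (h 0%C) <= 4 * M * norm x * norm y).
  { apply max_modulus.
    - intros z _; apply ch.
    - intros z _ e he; destruct (cdiff_ccont (ch z) he) as [d [dp hd]].
      exists d; split; [exact dp |]; intros w _; apply hd.
    - intros z hz.
      replace (Cmod (h z)) with (Cmod (z * h z)%C) by (rewrite Cmod_mult, hz; ring).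
      replace (z * h z)%C with (inner (minus (f z) (A x)) y).
      2: { rewrite hq, inner_minus_l, !inner_plus_l, !inner_scal_l; unfold h; ring. }
      eapply Rle_trans; [apply inner_CS |]; apply Rmult_le_compat_r; [apply hnorm_ge0 |].
      unfold minus; eapply Rle_trans; [apply hnorm_triangle |]; rewrite hnorm_opp.
      pose proof (bf z ltac:(lra)); pose proof (hM x); pose proof (hnorm_ge0 x).
      assert (0 <= M * norm x) by (apply Rmult_le_pos; lra); lra. }
  unfold h in hb; rewrite ev, inner_scal_l, Cmult_0_l, Cplus_0_r, Cmod_mult, Cmod_R, Rabs_pos_eq in hb by lra.
  exact hb. }
apply bop_eq; intros x; bopE.
apply hminus_eq0, inner_ext; intros y; rewrite inner_zero_l.
apply Cmod_eq_0, Rle_antisym; [| apply Cmod_ge_0]; apply Rnot_lt_le; intros hp.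
set (m := Cmod _) in *; set (K := 4 * M * norm x * norm y).
assert (K0 : 0 <= K).
{ pose proof (hnorm_ge0 x); pose proof (hnorm_ge0 y).
  unfold K; repeat apply Rmult_le_pos; lra. }
pose proof (key x y ((K + 1) / m) ltac:(apply Rdiv_lt_0_compat; lra)) as h.
fold m K in h; replace ((K + 1) / m * m) with (K + 1) in h by (field; lra); lra.
Qed.

End Fuglede.

(** * Joint approximate eigenvectors and the Koszul complex *)

(** With [L] made of operators T - z this says that joint approximate eigenvectors exist; a
    predicate lets operators be added one at a time by a disjunction. *)
Definition near_kernel (H : Hilbert) (L : bop H H -> Prop) : Prop :=
  forall e, 0 < e -> exists x : H, norm x = 1 /\ forall S, L S -> norm (S x) <= e.

Lemma normalize (H : Hilbert) (x : H) : 0 < norm x ->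
  norm (scal (RtoC (/ norm x)) x) = 1.
Proof.
intros h; rewrite norm_scal_Hilbert, Cmod_R, Rabs_pos_eq by (left; now apply Rinv_0_lt_compat).
field; lra.
Qed.

Section SelfAdjointStep.

Variables (H : Hilbert) (L : bop H H -> Prop) (T : bop H H) (r : R).
Hypotheses (T_self : (T^* = T)%B) (T_comm : forall S, L S -> commute S T)
  (hr : forall e, 0 < e -> exists x : H, norm x = 1 /\ (forall S, L S -> norm (S x) <= e) /\
     r <= Re (inner (T x) x)).

(** Let l be the supremum of the form of [T] over unit vectors nearly annihilated by [L]. If the
    form at x is close to l but u = (T - l) x is not small, a short step to x + s u, still nearly
    annihilated because [T] commutes with [L], raises the form above l. The bound [r] serves to keep
    l positive when this is applied to D^* D. *)
Lemma self_adjoint_step : exists l : R, r <= l /\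
  near_kernel (fun S => S = (T - RtoC l *: 1)%B \/ L S).
Proof.
destruct (bop_bound T) as [M [M0 hM]].
set (good := fun l => forall e, 0 < e -> exists x : H, norm x = 1 /\
  (forall S, L S -> norm (S x) <= e) /\ l <= Re (inner (T x) x)).
assert (up : forall l, good l -> l <= M).
{ intros l hl; destruct (hl 1 Rlt_0_1) as (x & h1 & _ & h3).
  eapply Rle_trans; [exact h3 |]; eapply Rle_trans; [apply Rle_abs |].
  eapply Rle_trans; [apply re_le_Cmod |]; eapply Rle_trans; [apply inner_CS |].
  pose proof (hM x) as h; rewrite h1 in *; lra. }
destruct (completeness good) as [l [ub lub]].
{ exists M; exact up. }
{ now exists r. }
exists l; split; [now apply ub |].
assert (lo : forall e, 0 < e -> good (l - e)).
{ intros e he; apply NNPP; intros hn.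
  assert (l <= l - e); [| lra].
  apply lub; intros s hs; apply Rnot_lt_le; intros hlt; apply hn; intros d hd.
  destruct (hs d hd) as (x & h1 & h2 & h3); exists x; repeat split; trivial; lra. }
assert (hi : forall e, 0 < e -> exists d, 0 < d /\ forall v, (forall S, L S -> norm (S v) <= d * norm v) ->
  Re (inner (T v) v) <= (l + e) * norm v ^ 2).
{ intros e he.
  assert (ng : ~ good (l + e)) by (intros hg; specialize (ub _ hg); lra).
  apply not_all_ex_not in ng; destruct ng as [d ng]; apply imply_to_and in ng; destruct ng as [d0 ng].
  exists d; split; [exact d0 |]; intros v hv.
  destruct (hnorm_ge0 v) as [v0 | v0].
  2: { symmetry in v0; apply hnorm_eq0 in v0; subst v; rewrite inner_zero_r, hnorm_zero; simpl; lra. }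
  apply Rnot_lt_le; intros hlt; apply ng; exists (scal (RtoC (/ norm v)) v).
  assert (i0 : 0 < / norm v) by now apply Rinv_0_lt_compat.
  split; [now apply normalize | split].
  - intros S hS; rewrite bop_scal, norm_scal_Hilbert, Cmod_R, Rabs_pos_eq by lra.
    specialize (hv S hS); apply (Rmult_le_compat_l (/ norm v)) in hv; [| lra].
    replace (/ norm v * (d * norm v)) with d in hv by (field; lra); exact hv.
  - rewrite bop_scal, inner_scal_l, inner_scal_r.
    replace (Re (RtoC (/ norm v) * (Cconj (RtoC (/ norm v)) * inner (T v) v))%C)
      with ((/ norm v) ^ 2 * Re (inner (T v) v)).
    2: { destruct (inner (T v) v); simpl; ring. }
    apply (Rmult_lt_compat_l ((/ norm v) ^ 2)) in hlt; [| now apply pow_lt].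
    replace ((/ norm v) ^ 2 * ((l + e) * norm v ^ 2)) with (l + e) in hlt by (field; lra); lra. }
set (K := M + Rabs l).
assert (K0 : 0 < K) by (pose proof (Rabs_pos l); unfold K; lra).
set (D := (T - RtoC l *: 1)%B).
assert (hK : forall x, norm (D x) <= K * norm x).
{ intros x; unfold D; bopE; eapply Rle_trans; [apply hnorm_triangle |].
  rewrite hnorm_opp, norm_scal_Hilbert, Cmod_R; pose proof (hM x); unfold K; lra. }
assert (D_self : (D^* = D)%B).
{ unfold D; rewrite adj_add, adj_opp, adj_scal, adj_id, T_self; do 2 f_equal.
  unfold RtoC, Cconj; simpl; now rewrite Ropp_0. }
(* Small enough that |s u| <= 1/2, hence 1/2 <= |y| <= 2, and that the second-order term s^2 K |u|^2
   costs at most half of s |u|^2. *)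
set (s := / (2 * (K + 1))).
assert (s0 : 0 < s) by (apply Rinv_0_lt_compat; lra).
assert (sK : s * (2 * (K + 1)) = 1) by (unfold s; field; lra).
intros del hdel.
(* The expansion at y yields s |u|^2 <= 5 e: 4 e from |y|^2 <= 4 and e from the near-maximality of
   x. *)
set (e := del ^ 2 * s / 5).
assert (e0 : 0 < e).
{ unfold e; apply Rdiv_lt_0_compat; [apply Rmult_lt_0_compat; [now apply pow_lt | exact s0] | lra]. }
destruct (hi e e0) as [d0 [d0p hd0]].
(* S y = (1 + s D) S x is at most twice as long as S x, and |y| >= 1/2; so d0/4 at x gives d0 |y| at
   y. *)
set (d1 := Rmin del (d0 / 4)).
assert (d1p : 0 < d1) by (apply Rmin_pos; lra).
destruct (lo e e0 d1 d1p) as (x & x1 & xL & xT).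
exists x; split; [exact x1 |].
intros S [-> | hS]; [| eapply Rle_trans; [now apply xL | apply Rmin_l]].
fold D; set (u := D x).
assert (u1 : norm u <= K) by (pose proof (hK x) as h; rewrite x1 in h; unfold u; lra).
set (y := plus x (scal (RtoC s) u)).
assert (nsu : norm (scal (RtoC s) u) <= / 2).
{ rewrite norm_scal_Hilbert, Cmod_R, Rabs_pos_eq by lra; pose proof (hnorm_ge0 u); nra. }
assert (ylo : / 2 <= norm y).
{ pose proof (hnorm_triangle y (opp (scal (RtoC s) u))) as t; rewrite hnorm_opp in t.
  replace (plus y (opp (scal (RtoC s) u))) with x in t by (unfold y; hvec); lra. }
assert (yhi : norm y <= 2).
{ unfold y; eapply Rle_trans; [apply hnorm_triangle |]; lra. }
assert (yL : forall S, L S -> norm (S y) <= d0 * norm y).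
{ intros S hS.
  assert (e1 : S y = plus (S x) (scal (RtoC s) (D (S x)))).
  { pose proof (T_comm hS) as c; unfold commute in c; pointwise c as k.
    unfold y, u, D; bopE; rewrite bop_plus, bop_scal, bop_plus, bop_opp, bop_scal, k; reflexivity. }
  rewrite e1; eapply Rle_trans; [apply hnorm_triangle |].
  rewrite norm_scal_Hilbert, Cmod_R, Rabs_pos_eq by lra.
  pose proof (hK (S x)); pose proof (xL S hS) as a1.
  assert (d1 <= d0 / 4) by apply Rmin_r.
  pose proof (hnorm_ge0 (S x)).
  nra. }
specialize (hd0 y yL).
assert (ex : Re (inner (D y) y) <= e * norm y ^ 2).
{ unfold D; bopE; rewrite inner_plus_l, inner_opp_l, inner_scal_l, inner_norm.
  destruct (inner (T y) y) as [p q] eqn:E; simpl in *; lra. }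
assert (low : - e <= Re (inner (D x) x)).
{ unfold D; bopE; rewrite inner_plus_l, inner_opp_l, inner_scal_l, inner_norm, x1.
  destruct (inner (T x) x) as [p q] eqn:E; simpl in *; lra. }
assert (expand : Re (inner (D y) y) =
  Re (inner (D x) x) + 2 * s * norm u ^ 2 + s ^ 2 * Re (inner (D u) u)).
{ assert (k : inner (D u) x = inner u u) by now rewrite adjP, D_self.
  unfold y; rewrite bop_plus, bop_scal, inner_plus_l, !inner_plus_r, !inner_scal_l, !inner_scal_r, k.
  fold u; rewrite inner_norm; destruct (inner (D u) u), (inner u x); simpl; ring. }
assert (du : - (K * norm u ^ 2) <= Re (inner (D u) u)).
{ pose proof (re_le_Cmod (inner (D u) u)) as a1; apply Rabs_le_between in a1.
  pose proof (inner_CS (D u) u); pose proof (hK u); pose proof (hnorm_ge0 u).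
  assert (norm (D u) * norm u <= K * norm u * norm u) by (apply Rmult_le_compat_r; lra). replace (norm u ^ 2) with (norm u * norm u) by ring; lra. }
assert (y4 : norm y ^ 2 <= 4) by nra.
assert (fin : s * norm u ^ 2 <= 5 * e).
{ assert (n0 : 0 <= norm u ^ 2) by apply pow2_ge_0.
  set (N := norm u ^ 2) in *; set (Y := norm y ^ 2) in *.
  assert (e * Y <= e * 4) by (apply Rmult_le_compat_l; lra).
  assert (s ^ 2 * - (K * N) <= s ^ 2 * Re (inner (D u) u)) by (apply Rmult_le_compat_l; [apply pow2_ge_0 | lra]).
  assert (0 <= s * N) by (apply Rmult_le_pos; lra).
  assert (s * K * (s * N) <= / 2 * (s * N)) by (apply Rmult_le_compat_r; lra).
  replace (s ^ 2 * - (K * N)) with (- (s * K * (s * N))) in * by ring. lra. }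
assert (f2 : norm u ^ 2 <= del ^ 2).
{ unfold e in fin; replace (5 * (del ^ 2 * s / 5)) with (s * del ^ 2) in fin by field.
  now apply Rmult_le_reg_l in fin. }
pose proof (hnorm_ge0 u); apply Rnot_lt_le; intros hl; nra.
Qed.

End SelfAdjointStep.

Lemma near_kernel_self_adjoint (H : Hilbert) (L : bop H H -> Prop) (T : bop H H) :
  near_kernel L -> (T^* = T)%B -> (forall S, L S -> commute S T) ->
  exists l : R, near_kernel (fun S => S = (T - RtoC l *: 1)%B \/ L S).
Proof.
intros hL hT hc; destruct (bop_bound T) as [M [M0 hM]].
destruct (@self_adjoint_step H L T (- M) hT hc) as [l [_ hl]]; [| now exists l].
intros e he; destruct (hL e he) as [x [h1 h2]]; exists x; repeat split; trivial.
pose proof (re_le_Cmod (inner (T x) x)) as a1; apply Rabs_le_between in a1.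
pose proof (inner_CS (T x) x); pose proof (hM x); rewrite h1 in *; lra.
Qed.

Definition re_part (H : Hilbert) (T : bop H H) : bop H H := (RtoC (/ 2) *: (T + T^*))%B.
Definition im_part (H : Hilbert) (T : bop H H) : bop H H := ((- Ci * RtoC (/ 2))%C *: (T - T^*))%B.

Lemma re_part_self (H : Hilbert) (T : bop H H) : ((re_part T)^* = re_part T)%B.
Proof.
unfold re_part; rewrite adj_scal, adj_add, adj_adj.
replace (Cconj (RtoC (/ 2))) with (RtoC (/ 2)) by (apply injective_projections; simpl; ring).
apply bop_eq; intros x; bopE; hvec.
Qed.

Lemma im_part_self (H : Hilbert) (T : bop H H) : ((im_part T)^* = im_part T)%B.
Proof.
unfold im_part; rewrite adj_scal, adj_add, adj_opp, adj_adj.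
replace (Cconj (- Ci * RtoC (/ 2))) with (- (- Ci * RtoC (/ 2)))%C
  by (apply injective_projections; simpl; ring).
apply bop_eq; intros x; bopE; hvec.
Qed.

Lemma re_im_partE (H : Hilbert) (T : bop H H) (l m : R) x :
  (T - (l, m) *: 1)%B x
  = plus ((re_part T - RtoC l *: 1)%B x) (scal Ci ((im_part T - RtoC m *: 1)%B x)).
Proof.
unfold re_part, im_part; bopE; apply inner_ext; intros z.
rewrite ?inner_plus_l, ?inner_opp_l, ?inner_scal_l, ?inner_plus_l, ?inner_opp_l, ?inner_scal_l,
  ?inner_plus_l, ?inner_opp_l.
destruct (inner (T x) z), (inner (T^*%B x) z), (inner x z).
apply injective_projections; simpl; field.
Qed.

Lemma commute_re_part (H : Hilbert) (S T : bop H H) :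
  commute S T -> commute S T^*%B -> commute S (re_part T).
Proof. unfold re_part; commute_pointwise. Qed.

Lemma commute_im_part (H : Hilbert) (S T : bop H H) :
  commute S T -> commute S T^*%B -> commute S (im_part T).
Proof. unfold im_part; commute_pointwise. Qed.

(** The real and the imaginary part are handled in turn. They commute by normality, and each
    commutes with [L] because both [T] and its adjoint do. *)
Lemma near_kernel_normal (H : Hilbert) (L : bop H H -> Prop) (T : bop H H) :
  near_kernel L -> normal T -> (forall S, L S -> commute S T /\ commute S T^*%B) ->
  exists z : C, near_kernel (fun S => S = (T - z *: 1)%B \/ L S).
Proof.
intros hL nT hc.
destruct (@near_kernel_self_adjoint H L (re_part T) hL (re_part_self T)) as [l hl].
{ intros S hS; now apply commute_re_part; apply hc. }
assert (crT : commute (re_part T) T).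
{ apply commute_sym, commute_re_part; [reflexivity | exact nT]. }
assert (crTs : commute (re_part T) T^*%B).
{ apply commute_sym, commute_re_part; [apply commute_sym, nT | reflexivity]. }
destruct (near_kernel_self_adjoint hl (im_part_self T)) as [m hm].
{ intros S [-> | hS].
  - apply commute_shift; now apply commute_im_part.
  - now apply commute_im_part; apply hc. }
exists (l, m); intros e he.
destruct (hm (e / 2)) as [x [x1 hx]]; [lra |]; exists x; split; [exact x1 |].
intros S [-> | hS].
- rewrite re_im_partE; eapply Rle_trans; [apply hnorm_triangle |].
  rewrite norm_scal_Hilbert.
  replace (Cmod Ci) with 1 by (unfold Cmod; simpl; rewrite !Rmult_0_l, !Rmult_1_l, Rplus_0_l; now rewrite sqrt_1).
  pose proof (hx _ (or_intror (or_introl eq_refl))).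
  pose proof (hx _ (or_introl eq_refl)); lra.
- pose proof (hx _ (or_intror (or_intror hS))); lra.
Qed.

(** The two numbers differ by 2 c. *)
Lemma Cmod_sign_choice (a : C) (c : R) : 0 <= c ->
  c <= Cmod (a + RtoC c) \/ c <= Cmod (a - RtoC c).
Proof.
intros hc; destruct (Rle_lt_dec c (Cmod (a + RtoC c))) as [h | h]; [now left | right].
apply Rnot_lt_le; intros h'.
pose proof (Cmod_triangle (a + RtoC c) (- (a - RtoC c)))%C as t; rewrite Cmod_opp in t.
replace (a + RtoC c + - (a - RtoC c))%C with (RtoC (2 * c)) in t by (rewrite RtoC_mult; ring).
rewrite Cmod_R, Rabs_pos_eq in t by lra; lra.
Qed.

(* [w] is the limit of the sums of [s_k 4^-k x_k] with signs chosen so that no term is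
   cancelled by the preceding ones. *)
Lemma gliding_hump (H : Hilbert) (x : nat -> H) : (forall k, norm (x k) = 1) ->
  exists w : H, forall k, / 2 * (/ 4) ^ S k <= Cmod (inner w (x (S k))).
Proof.
intros hx.
set (p := fun k => scal (RtoC ((/ 4) ^ S k)) (x (S k))).
assert (st : forall kw : nat * H, exists w', norm (minus w' (snd kw)) <= (/ 4) ^ S (fst kw) /\
  (/ 4) ^ S (fst kw) <= Cmod (inner w' (x (S (fst kw))))).
{ intros [k w]; simpl fst; simpl snd.
  assert (q0 : 0 <= (/ 4) ^ S k) by (apply pow_le; lra).
  assert (np : norm (p k) = (/ 4) ^ S k).
  { unfold p; rewrite norm_scal_Hilbert, hx, Cmod_R, Rabs_pos_eq by exact q0; ring. }
  assert (ip : inner (p k) (x (S k)) = RtoC ((/ 4) ^ S k)).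
  { unfold p; rewrite inner_scal_l, inner_norm, hx, <- RtoC_mult; f_equal; ring. }
  destruct (Cmod_sign_choice (inner w (x (S k))) q0) as [h | h].
  - exists (plus w (p k)); split.
    + replace (minus (plus w (p k)) w) with (p k) by hvec; lra.
    + now rewrite inner_plus_l, ip.
  - exists (minus w (p k)); split.
    + replace (minus (minus w (p k)) w) with (opp (p k)) by hvec; rewrite hnorm_opp; lra.
    + now rewrite inner_minus_l, ip. }
destruct (choice _ st) as [f hf].
set (w := nat_rect (fun _ => H : Type) zero (fun k u => f (k, u))).
assert (w1 : forall k, norm (minus (w (S k)) (w k)) <= (/ 4) ^ S k) by (intros k; apply (hf (k, w k))).
assert (w2 : forall k, (/ 4) ^ S k <= Cmod (inner (w (S k)) (x (S k)))) by (intros k; apply (hf (k, w k))).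
assert (tail : forall n m, (n <= m)%nat -> norm (minus (w m) (w n)) <= / 3 * (/ 4) ^ n - / 3 * (/ 4) ^ m).
{ intros n m h; induction h as [| m h IH].
  - rewrite hminus_eq_zero, hnorm_zero; lra.
  - eapply Rle_trans; [apply (hdist_triangle _ (w m)) |].
    pose proof (w1 m); simpl in *; lra. }
destruct (@hlim_cauchy H w (fun n => - (/ 3 * (/ 4) ^ n))) as [v hv].
{ apply (ex_finite_lim_seq_incr _ 0).
  - intros n; assert (0 < (/ 4) ^ n) by (apply pow_lt; lra); simpl; lra.
  - intros n; assert (0 < (/ 4) ^ n) by (apply pow_lt; lra); lra. }
{ intros n m h; pose proof (tail n m h); lra. }
exists v; intros k.
assert (dv : norm (minus v (w (S k))) <= / 3 * (/ 4) ^ S k).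
{ apply (@hlim_norm_le H (fun n => minus (w (n + S k)%nat) (w (S k)))).
  - apply (hlim_plus (y := opp (w (S k)))); [| apply hlim_const].
    intros e he; destruct (hv e he) as [N hN]; exists N; intros n hn; apply hN; lia.
  - intros n; eapply Rle_trans; [apply tail; lia |].
    assert (0 < (/ 4) ^ (n + S k)) by (apply pow_lt; lra); lra. }
pose proof (inner_CS (minus v (w (S k))) (x (S k))) as cs; rewrite hx, inner_minus_l in cs.
destruct (Cmod_dist (inner v (x (S k))) (inner (w (S k)) (x (S k)))) as [_ t].
specialize (w2 k); assert (0 < (/ 4) ^ S k) by (apply pow_lt; lra); lra.
Qed.

(** Surjectivity of the last map fails. If w = T1 y23 - T2 y13 + T3 y12, then <w, x_k> is of order
    8^-k, since adjoints of normal operators are equally small on x_k; the vector of [gliding_hump]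
    decays no faster than 4^-k. *)
Lemma near_kernel_not_exact (H : Hilbert) (T1 T2 T3 : bop H H) :
  normal T1 -> normal T2 -> normal T3 ->
  near_kernel (fun S => S = T1 \/ S = T2 \/ S = T3) -> ~ koszul_exact T1 T2 T3.
Proof.
intros n1 n2 n3 hk (_ & _ & _ & onto).
assert (hx : forall k : nat, exists x : H, norm x = 1 /\
  forall S, S = T1 \/ S = T2 \/ S = T3 -> norm (S x) <= (/ 8) ^ k).
{ intros k; apply hk, pow_lt; lra. }
destruct (choice _ hx) as [x hx']; clear hx.
destruct (@gliding_hump H x (fun k => proj1 (hx' k))) as [w hw].
destruct (onto w) as [[[y12 y13] y23] e]; simpl in e.
set (Y := norm y23 + norm y13 + norm y12).
assert (b : forall k, / 2 * (/ 4) ^ S k <= Y * (/ 8) ^ S k).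
{ intros k; eapply Rle_trans; [apply hw |].
  assert (small : forall T y, normal T -> T = T1 \/ T = T2 \/ T = T3 ->
    Cmod (inner (T y) (x (S k))) <= norm y * (/ 8) ^ S k).
  { intros T y nT hT; rewrite adjP; eapply Rle_trans; [apply inner_CS |].
    apply Rmult_le_compat_l; [apply hnorm_ge0 |]; rewrite normal_norm by exact nT.
    now apply hx'. }
  rewrite e; unfold minus; rewrite !inner_plus_l, inner_opp_l.
  eapply Rle_trans; [apply Cmod_triangle |].
  eapply Rle_trans; [apply Rplus_le_compat_r, Cmod_triangle |]; rewrite Cmod_opp.
  pose proof (small T1 y23 n1 ltac:(tauto)); pose proof (small T2 y13 n2 ltac:(tauto)).
  pose proof (small T3 y12 n3 ltac:(tauto)); unfold Y; lra. }
destruct (INR_unbounded (2 * Y)) as [n hn].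
specialize (b n).
assert (e4 : (/ 4) ^ S n = 2 ^ S n * (/ 8) ^ S n) by (rewrite <- Rpow_mult_distr; f_equal; field).
assert (p8 : 0 < (/ 8) ^ S n) by (apply pow_lt; lra).
rewrite e4 in b.
assert (2 ^ S n <= 2 * Y) by (apply Rmult_le_reg_r with ((/ 8) ^ S n); lra).
assert (g : INR n <= 2 ^ n).
{ clear; induction n as [| n IH]; [simpl; lra |]; rewrite S_INR; simpl.
  assert (1 <= 2 ^ n) by (apply pow_R1_Rle; lra); lra. }
simpl in *; assert (0 < 2 ^ n) by (apply pow_lt; lra); lra.
Qed.

Section CommutingNormals.

Variables (H : Hilbert) (N1 N2 N3 : bop H H).
Hypotheses (c12 : commute N1 N2) (c13 : commute N1 N3) (c23 : commute N2 N3)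
  (n1 : normal N1) (n2 : normal N2) (n3 : normal N3)
  (spec : forall z1 z2 z3 : C, taylor_spectrum N1 N2 N3 (z1, z2, z3) -> z1 = (Cconj z2 * z3)%C).

Let D := (N1 - N2^* * N3)%B.
Let Q := (D^* * D)%B.

Lemma relation_of_spectrum : (N1 = N2^* * N3)%B.
Proof.
assert (f : forall S T : bop H H, normal T -> commute S T -> commute S T^*%B)
  by (intros S T nT h; exact (fuglede nT h)).
assert (f' : forall S T : bop H H, normal T -> normal S -> commute S T -> commute S^*%B T).
{ intros S T nT nS h; apply commute_sym, f; [exact nS | now apply commute_sym]. }
(* Commuting with [D] includes commuting with N2^*, and commuting with D^* is obtained from T^*
   commuting with [D]; both rest on Fuglede's theorem. *)
assert (cD : forall T : bop H H, normal T -> commute T N1 -> commute T N2 -> commute T N3 -> commute T Q).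
{ intros T nT h1 h2 h3.
  assert (hD : commute T D) by (apply commute_minus; [| apply commute_comp]; auto).
  assert (hD' : commute T^*%B D).
  { apply commute_minus; [| apply commute_comp]; auto using commute_adj. }
  apply commute_comp; [| exact hD].
  pose proof (commute_adj hD') as k; rewrite adj_adj in k; exact k. }
apply NNPP; intros hne.
assert (exv : exists v, 0 < norm (D v)).
{ apply NNPP; intros hn; apply hne; apply bop_eq; intros v.
  destruct (hnorm_ge0 (D v)) as [h | h]; [elim hn; now exists v |].
  symmetry in h; apply hnorm_eq0 in h.
  exact (hminus_eq0 h). }
destruct exv as [v hv].
assert (v0 : 0 < norm v).
{ destruct (hnorm_ge0 v) as [h | h]; [exact h |]; symmetry in h; apply hnorm_eq0 in h.
  subst v; rewrite bop_zero, hnorm_zero in hv; lra. }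
set (x0 := scal (RtoC (/ norm v)) v).
assert (x01 : norm x0 = 1) by now apply normalize.
assert (Qx : forall x, Re (inner (Q x) x) = norm (D x) ^ 2).
{ intros x; unfold Q; bopE; now rewrite adjP', hnorm_sqr. }
assert (r0 : 0 < norm (D x0) ^ 2).
{ unfold x0; rewrite bop_scal, norm_scal_Hilbert, Cmod_R.
  apply pow_lt, Rmult_lt_0_compat; [apply Rabs_pos_lt, Rinv_neq_0_compat |]; lra. }
assert (Qs : (Q^* = Q)%B) by (unfold Q; now rewrite adj_comp, adj_adj).
(* No operator is constrained yet; the lower bound |D x0|^2 ensures q > 0. *)
destruct (@self_adjoint_step H (fun _ => False) Q (norm (D x0) ^ 2) Qs) as [q [hq k0]].
{ intros S []. }
{ intros e he; exists x0; rewrite Qx; repeat split; [exact x01 | intros S [] | lra]. }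
set (L0 := fun S : bop H H => S = (Q - RtoC q *: 1)%B \/ False) in *.
assert (cQ : forall T : bop H H, normal T -> commute T N1 -> commute T N2 -> commute T N3 ->
  commute (Q - RtoC q *: 1)%B T /\ commute (Q - RtoC q *: 1)%B T^*%B).
{ intros T nT h1 h2 h3.
  assert (commute Q T) by (apply commute_sym; auto).
  split; apply commute_shift; auto. }
destruct (near_kernel_normal k0 n1) as [z1 k1].
{ intros S [-> | []]; apply cQ; auto; reflexivity. }
destruct (near_kernel_normal k1 n2) as [z2 k2].
{ intros S [-> | [-> | []]].
  - split; apply commute_shift; auto.
  - apply cQ; auto; [now apply commute_sym | reflexivity]. }
destruct (near_kernel_normal k2 n3) as [z3 k3].
{ intros S [-> | [-> | [-> | []]]].
  - split; apply commute_shift; auto.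
  - split; apply commute_shift; auto.
  - apply cQ; auto using commute_sym; reflexivity. }
assert (ez : z1 = (Cconj z2 * z3)%C).
{ apply spec; simpl; apply near_kernel_not_exact; try (now apply normal_shift).
  intros e he; destruct (k3 e he) as [x [h1 h2]]; exists x; split; [exact h1 |].
  intros S hS; apply h2; unfold L0; tauto. }
destruct (bop_bound N2^*%B) as [M [M0 hM]].
(* The coefficients in D = (N1 - z1) - N2^* (N3 - z3) - z3 (N2^* - conj z2), which holds since z1 =
   conj z2 z3. The [e] chosen next makes e + (K e)^2 <= q/2. *)
set (K := 1 + M + Cmod z3).
set (e := Rmin 1 (q / (2 * (1 + K ^ 2)))).
assert (KK : 0 <= K ^ 2) by apply pow2_ge_0.
assert (e0 : 0 < e) by (apply Rmin_pos; [lra | apply Rdiv_lt_0_compat; lra]).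
assert (e1 : e <= 1) by apply Rmin_l.
assert (e2 : e * (1 + K ^ 2) <= q / 2).
{ apply Rle_trans with (q / (2 * (1 + K ^ 2)) * (1 + K ^ 2)).
  - apply Rmult_le_compat_r; [lra | apply Rmin_r].
  - right; field; lra. }
destruct (k3 e e0) as [x [x1 hx]].
assert (b3 := hx _ (or_introl eq_refl)).
assert (b2 := hx _ (or_intror (or_introl eq_refl))).
assert (b1 := hx _ (or_intror (or_intror (or_introl eq_refl)))).
assert (bQ := hx _ (or_intror (or_intror (or_intror (or_introl eq_refl))))).
rewrite <- (normal_norm _ (normal_shift z2 n2)), adj_add, adj_opp, adj_scal, adj_id in b2.
assert (Dx : norm (D x) <= K * e).
{ assert (d : D x = plus ((N1 - z1 *: 1)%B x)
    (opp (plus (N2^*%B ((N3 - z3 *: 1)%B x)) (scal z3 ((N2^* - Cconj z2 *: 1)%B x))))).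
  { unfold D; bopE; hvec_push; rewrite ez; hvec. }
  rewrite d; eapply Rle_trans; [apply hnorm_triangle |]; rewrite hnorm_opp.
  eapply Rle_trans; [apply Rplus_le_compat_l, hnorm_triangle |].
  rewrite norm_scal_Hilbert.
  pose proof (hM ((N3 - z3 *: 1)%B x)).
  assert (M * norm ((N3 - z3 *: 1)%B x) <= M * e) by (apply Rmult_le_compat_l; lra).
  assert (Cmod z3 * norm ((N2^* - Cconj z2 *: 1)%B x) <= Cmod z3 * e)
    by (apply Rmult_le_compat_l; [apply Cmod_ge_0 | exact b2]).
  unfold K; lra. }
assert (qb : q <= e + norm (D x) ^ 2).
{ rewrite <- Qx.
  pose proof (inner_CS ((Q - RtoC q *: 1)%B x) x) as cs; rewrite x1 in cs.
  pose proof (re_le_Cmod (inner ((Q - RtoC q *: 1)%B x) x)) as a1; apply Rabs_le_between in a1.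
  assert (Re (inner ((Q - RtoC q *: 1)%B x) x) = Re (inner (Q x) x) - q).
  { bopE; rewrite inner_plus_l, inner_opp_l, inner_scal_l, inner_norm, x1.
    destruct (inner (Q x) x); simpl; ring. }
  lra. }
assert (norm (D x) ^ 2 <= (K * e) ^ 2) by (apply pow_incr; split; [apply hnorm_ge0 | exact Dx]).
assert (e * e <= e) by nra.
assert ((K * e) ^ 2 <= K ^ 2 * e).
{ replace ((K * e) ^ 2) with (K ^ 2 * (e * e)) by ring; now apply Rmult_le_compat_l. }
lra.
Qed.

End CommutingNormals.

(** * The distinguished boundary of the tetrablock *)

Lemma Cmod_sqr (z : C) : Cmod z ^ 2 = Re z ^ 2 + Im z ^ 2.
Proof. apply Cmod2_alt. Qed.

Lemma norm_C2 (x : C * C) : norm x ^ 2 = Cmod (fst x) ^ 2 + Cmod (snd x) ^ 2.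
Proof.
change (sqrt (Cmod (fst x) ^ 2 + Cmod (snd x) ^ 2) ^ 2 = Cmod (fst x) ^ 2 + Cmod (snd x) ^ 2).
apply pow2_sqrt, Rplus_le_le_0_compat; apply pow2_ge_0.
Qed.

Lemma norm_C2_ge0 (x : C * C) : 0 <= norm x.
Proof. exact (norm_ge_0 x). Qed.

Lemma opnorm_le (U V : NormedModule C_AbsRing) (T : U -> V) (m : R) :
  (forall (c : C) x, T (scal c x) = scal c (T x)) -> Rbar_le (opnorm T) m ->
  forall x, norm (T x) <= m * norm x.
Proof.
intros hT hm.
assert (unit_le : forall x, norm x <= 1 -> norm (T x) <= m).
{ intros x hx; apply (Rbar_le_trans (norm (T x)) (opnorm T) m); [| exact hm].
  apply Lub_Rbar_correct; now exists x. }
intros x; destruct (norm_ge_0 x) as [x0 | x0].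
- set (c := / norm x); assert (c0 : 0 < c) by now apply Rinv_0_lt_compat.
  assert (k : norm (T (scal (RtoC c) x)) <= m).
  { apply unit_le; eapply Rle_trans; [exact (norm_scal (RtoC c) x) |].
    change (Cmod (RtoC c) * norm x <= 1); rewrite Cmod_R, Rabs_pos_eq by lra.
    right; unfold c; field; lra. }
  assert (e : T x = scal (RtoC (norm x)) (T (scal (RtoC c) x))).
  { rewrite hT, scal_assoc; change (mult (RtoC (norm x)) (RtoC c)) with (RtoC (norm x) * RtoC c)%C.
    rewrite <- RtoC_mult; unfold c; rewrite Rinv_r by lra; symmetry; exact (scal_one (T x)). }
  rewrite e; eapply Rle_trans; [exact (norm_scal (RtoC (norm x)) _) |].
  change (Cmod (RtoC (norm x)) * norm (T (scal (RtoC c) x)) <= m * norm x).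
  rewrite Cmod_R, Rabs_pos_eq by lra; nra.
- symmetry in x0; rewrite (norm_eq_zero _ x0), norm_zero, Rmult_0_r.
  assert (e : T zero = zero).
  { transitivity (T (scal (RtoC 0) zero)); [| rewrite hT; exact (scal_zero_l (T zero))].
    f_equal; symmetry; exact (scal_zero_r (RtoC 0 : C_Ring)). }
  rewrite e; right; apply norm_zero.
Qed.

(** * Contractive two by two matrices *)

Section Mat2.

Variables a11 a12 a21 a22 : C.

Let A := mat2 a11 a12 a21 a22.
(** [al], [be] and [ga] are the entries of A^* A, whose determinant is |det A|^2. *)
Let al := Cmod a11 ^ 2 + Cmod a21 ^ 2.
Let be := Cmod a12 ^ 2 + Cmod a22 ^ 2.
Let ga := (Cconj a11 * a12 + Cconj a21 * a22)%C.

Lemma mat2_norm (x : C * C) : norm (A x) ^ 2 =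
  al * Cmod (fst x) ^ 2 + be * Cmod (snd x) ^ 2 + 2 * Re (Cconj (fst x) * snd x * ga).
Proof.
rewrite norm_C2; unfold A, mat2, al, be, ga; simpl fst; simpl snd.
rewrite !Cmod_sqr; destruct a11, a12, a21, a22, x as [[x1 x2] [y1 y2]]; simpl; ring.
Qed.

Lemma mat2_gram_det : al * be - Cmod ga ^ 2 = Cmod (a11 * a22 - a12 * a21)%C ^ 2.
Proof.
unfold al, be, ga; rewrite !Cmod_sqr; destruct a11, a12, a21, a22; simpl; ring.
Qed.

Lemma mat2_contraction_bound : Rbar_lt (opnorm A) 1 ->
  exists m, 0 <= m < 1 /\ forall x, norm (A x) ^ 2 <= m * norm x ^ 2.
Proof.
intros h.
assert (hm : exists m, 0 <= m < 1 /\ Rbar_le (opnorm A) m).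
{ destruct (opnorm A) as [m | |].
  - exists (Rmax 0 m); split; [| exact (Rmax_r 0 m)].
    split; [apply Rmax_l | apply Rmax_lub_lt; [lra | exact h]].
  - destruct h.
  - exists 0; split; [lra | exact I]. }
destruct hm as (m & m1 & hm).
exists (m ^ 2); split; [split; [apply pow2_ge_0 | nra] |]; intros x.
rewrite <- Rpow_mult_distr; apply pow_incr; split; [apply norm_C2_ge0 |].
refine (opnorm_le _ hm x); intros c [y1 y2]; apply injective_projections.
- change (a11 * (c * y1) + a12 * (c * y2) = c * (a11 * y1 + a12 * y2))%C; ring.
- change (a21 * (c * y1) + a22 * (c * y2) = c * (a21 * y1 + a22 * y2))%C; ring.
Qed.

(** For a two by two matrix, 1 - A^* A is positive definite exactly when its determinant 1 - al - be
    + |det A|^2 is positive and |det A| < 1; [mat2_opnorm_lt1] is the converse direction. *)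
Lemma mat2_strict_contraction : Rbar_lt (opnorm A) 1 ->
  al + be < 1 + Cmod (a11 * a22 - a12 * a21)%C ^ 2 /\ Cmod (a11 * a22 - a12 * a21)%C < 1.
Proof.
intros h; destruct (mat2_contraction_bound h) as (m & [m0 m1] & hm).
rewrite <- mat2_gram_det.
set (G := Cmod ga ^ 2).
assert (G0 : 0 <= G) by apply pow2_ge_0.
assert (f : forall t : R, al * (t ^ 2 * G) + be + 2 * t * G <= m * (t ^ 2 * G + 1)).
(* The vector (t ga, 1) makes the cross term real and nonnegative for t >= 0; t = 1 / (1 - al) will
   give G <= (1 - al) (m - be). *)
{ intros t; pose proof (hm ((RtoC t * ga)%C, RtoC 1)) as k.
  rewrite mat2_norm, norm_C2 in k; simpl fst in k; simpl snd in k.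
  rewrite Cmod_mult, Cmod_1, Cmod_R, Rpow_mult_distr, pow2_abs in k; fold G in k.
  replace (Re (Cconj (RtoC t * ga) * RtoC 1 * ga)%C) with (t * G) in k.
  2: { unfold G; rewrite Cmod_sqr; destruct ga; simpl; ring. }
  lra. }
assert (ha : al <= m).
{ pose proof (hm (RtoC 1, RtoC 0)) as k; rewrite mat2_norm, norm_C2 in k; simpl fst in k; simpl snd in k.
  rewrite Cmod_1, Cmod_0 in k; destruct ga; simpl in k; lra. }
assert (a0 : 0 <= al) by (unfold al; apply Rplus_le_le_0_compat; apply pow2_ge_0).
assert (p0 : 0 < 1 - al) by lra.
assert (k : G <= (1 - al) * (m - be)).
{ pose proof (f (/ (1 - al))) as k; set (t := / (1 - al)) in *.
  assert (t1 : t * (1 - al) = 1) by (unfold t; field; lra).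
  assert (t0 : 0 < t) by now apply Rinv_0_lt_compat.
  assert (k1 : t * G <= m - be).
  { assert (t ^ 2 * G * (m - al) <= t ^ 2 * G * (1 - al)).
    { apply Rmult_le_compat_l; [| lra]; apply Rmult_le_pos; [apply pow2_ge_0 | exact G0]. }
    replace (t ^ 2 * G * (1 - al)) with (t * G * (t * (1 - al))) in H by ring.
    rewrite t1 in H; lra. }
  apply Rmult_le_reg_l with t; [exact t0 |].
  rewrite <- Rmult_assoc, t1; lra. }
assert (k2 : G < (1 - al) * (1 - be)).
{ eapply Rle_lt_trans; [exact k |]; apply Rmult_lt_compat_l; lra. }
split; [lra |].
pose proof mat2_gram_det as gd; fold G in gd.
apply Rnot_le_lt; intros h1.
assert (1 <= Cmod (a11 * a22 - a12 * a21)%C ^ 2) by nra.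
nra.
Qed.

Lemma mat2_opnorm_lt1 : al + be < 1 + Cmod (a11 * a22 - a12 * a21)%C ^ 2 ->
  Cmod (a11 * a22 - a12 * a21)%C < 1 -> Rbar_lt (opnorm A) 1.
Proof.
intros h1 h2; rewrite <- mat2_gram_det in h1.
assert (d1 : Cmod (a11 * a22 - a12 * a21)%C ^ 2 < 1) by (pose proof (Cmod_ge_0 (a11 * a22 - a12 * a21)%C); nra).
rewrite <- mat2_gram_det in d1.
set (g := Cmod ga) in *; assert (g0 : 0 <= g) by apply Cmod_ge_0.
set (p := 1 - al); set (q := 1 - be).
assert (pq : g ^ 2 < p * q) by (unfold p, q; lra).
assert (ps : 0 < p + q) by (unfold p, q; lra).
(* Determinant over trace of 1 - A^* A, a lower bound for its smaller eigenvalue: (p - c) (q - c) =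
   g^2 + c^2. *)
set (c := (p * q - g ^ 2) / (p + q)).
assert (ce : c * (p + q) = p * q - g ^ 2) by (unfold c; field; lra).
assert (c0 : 0 < c) by (apply Rdiv_lt_0_compat; lra).
assert (cp : c < p) by nra.
assert (key : g ^ 2 <= (p - c) * (q - c)) by nra.
assert (bd : forall x, norm (A x) ^ 2 <= (1 - c) * norm x ^ 2).
{ intros x; rewrite mat2_norm, norm_C2.
  set (u := Cmod (fst x)); set (v := Cmod (snd x)).
  assert (r : Re (Cconj (fst x) * snd x * ga)%C <= u * v * g).
  { eapply Rle_trans; [apply Rle_abs |]; eapply Rle_trans; [apply re_le_Cmod |].
    rewrite !Cmod_mult, Cmod_conj; fold u v g; lra. }
  assert (amgm : 2 * (u * v * g) <= (p - c) * u ^ 2 + (q - c) * v ^ 2).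
  { set (a := p - c) in *; set (b := q - c) in *.
    assert (a0 : 0 < a) by (unfold a; lra).
    apply Rmult_le_reg_l with a; [exact a0 |].
    pose proof (pow2_ge_0 (a * u - g * v)); nra. }
  unfold p, q in amgm; lra. }
assert (c1 : 0 <= 1 - c).
{ unfold p in *; assert (0 <= al) by (unfold al; apply Rplus_le_le_0_compat; apply pow2_ge_0); lra. }
apply Rbar_le_lt_trans with (Finite (sqrt (1 - c))).
- apply Lub_Rbar_correct; intros r [x [hx ->]]; simpl.
  pose proof (norm_C2_ge0 x); pose proof (norm_C2_ge0 (A x)).
  rewrite <- (sqrt_pow2 (norm (A x))) by trivial; apply sqrt_le_1_alt.
  eapply Rle_trans; [apply bd |].
  assert (norm x ^ 2 <= 1) by nra; nra.
- simpl; apply Rlt_le_trans with (sqrt 1); [apply sqrt_lt_1_alt; lra | rewrite sqrt_1; lra].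
Qed.

End Mat2.

Lemma Csqrt_exists (c : C) : exists s : C, (s * s = c)%C.
Proof.
destruct c as [a b]; set (m := Cmod (a, b)).
assert (m2 : m ^ 2 = a ^ 2 + b ^ 2) by (unfold m; rewrite Cmod_sqr; reflexivity).
assert (ma : Rabs a <= m) by exact (re_le_Cmod (a, b)).
apply Rabs_le_between in ma.
set (u := sqrt ((m + a) / 2)); set (v := sqrt ((m - a) / 2)).
assert (u2 : u * u = (m + a) / 2) by (apply sqrt_sqrt; lra).
assert (v2 : v * v = (m - a) / 2) by (apply sqrt_sqrt; lra).
assert (u0 : 0 <= u) by apply sqrt_pos; assert (v0 : 0 <= v) by apply sqrt_pos.
assert (uv : (2 * (u * v)) ^ 2 = b ^ 2).
{ replace ((2 * (u * v)) ^ 2) with (4 * (u * u) * (v * v)) by ring; rewrite u2, v2; nra. }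
assert (uv0 : 0 <= 2 * (u * v)) by nra.
destruct (Rle_lt_dec 0 b) as [hb | hb].
- exists (u, v); apply injective_projections; simpl; [lra |].
  assert (2 * (u * v) = b) by nra; lra.
- exists (u, - v); apply injective_projections; simpl; [lra |].
  assert (2 * (u * v) = - b) by nra; lra.
Qed.

Definition tetra_ineq (z1 z2 z3 : C) : Prop :=
  Cmod z3 < 1 /\ Cmod z1 ^ 2 + Cmod z2 ^ 2 + 2 * Cmod (z1 * z2 - z3) < 1 + Cmod z3 ^ 2.

(* A point satisfying the inequality is realized by the matrix with equal off-diagonal entries
   [sqrt (z1 z2 - z3)]. *)
Lemma tetrablock_ineq (z1 z2 z3 : C) : tetrablock (z1, z2, z3) <-> tetra_ineq z1 z2 z3.
Proof.
split.
- intros (a11 & a12 & a21 & a22 & h & e); injection e; intros -> -> ->; clear e.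
  destruct (mat2_strict_contraction h) as [h1 h2]; split; [exact h2 |].
  replace (a11 * a22 - (a11 * a22 - a12 * a21))%C with (a12 * a21)%C by ring.
  rewrite Cmod_mult; pose proof (pow2_ge_0 (Cmod a12 - Cmod a21)); nra.
- intros [h1 h2]; destruct (Csqrt_exists (z1 * z2 - z3)%C) as [s hs].
  assert (e : (z1 * z2 - s * s = z3)%C) by (rewrite hs; ring).
  exists z1, s, s, z2; rewrite e; split; [| reflexivity].
  apply mat2_opnorm_lt1; rewrite e; [| exact h1].
  rewrite <- hs, Cmod_mult in h2; lra.
Qed.

Lemma rotation_sup (v l : C) : Cmod l = 1 -> Re (Cconj v * l)%C <= Cmod v.
Proof.
intros hl; eapply Rle_trans; [apply Rle_abs |]; eapply Rle_trans; [apply re_le_Cmod |].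
rewrite Cmod_mult, Cmod_conj, hl; lra.
Qed.

Lemma circle_diff (x1 x2 x3 l : C) : Cmod l = 1 ->
  Cmod (1 + Cconj x3 * l)%C ^ 2 - Cmod (x2 + Cconj x1 * l)%C ^ 2 =
  1 + Cmod x3 ^ 2 - Cmod x1 ^ 2 - Cmod x2 ^ 2 - 2 * Re (Cconj (x1 * x2 - x3) * l)%C.
Proof.
intros hl.
assert (e : Cmod (1 + Cconj x3 * l)%C ^ 2 - Cmod (x2 + Cconj x1 * l)%C ^ 2 =
  1 + Cmod x3 ^ 2 * Cmod l ^ 2 - Cmod x1 ^ 2 * Cmod l ^ 2 - Cmod x2 ^ 2
  - 2 * Re (Cconj (x1 * x2 - x3) * l)%C).
{ rewrite !Cmod_sqr; destruct x1, x2, x3, l; simpl; ring. }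
rewrite e, hl; ring.
Qed.

(** By [circle_diff] the difference of the squared moduli is smallest at l = v / |v| with v = x1 x2
    - x3, where its positivity is the inequality. The circle form is the one that behaves well under
    disc automorphisms. *)
Lemma tetra_ineq_circle (x1 x2 x3 : C) : Cmod x3 < 1 ->
  (forall l, Cmod l = 1 -> Cmod (x2 + Cconj x1 * l)%C < Cmod (1 + Cconj x3 * l)%C) ->
  tetra_ineq x1 x2 x3.
Proof.
intros h3 h; split; [exact h3 |].
set (v := (x1 * x2 - x3)%C).
assert (hl : exists l, Cmod l = 1 /\ Re (Cconj v * l)%C = Cmod v).
{ destruct (Req_dec (Cmod v) 0) as [v0 | v0].
  - exists 1%C; split; [apply Cmod_1 |]; apply Cmod_eq_0 in v0; rewrite v0, Cmod_0; simpl; ring.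
  - exists (v / RtoC (Cmod v))%C.
    assert (nz : RtoC (Cmod v) <> 0%C) by (intros E; apply v0, RtoC_inj; exact E).
    pose proof (Cmod_ge_0 v).
    split.
    + rewrite Cmod_div by exact nz; rewrite Cmod_R, Rabs_pos_eq by lra; field; lra.
    + replace (Cconj v * (v / RtoC (Cmod v)))%C with (v * Cconj v / RtoC (Cmod v))%C by (unfold Cdiv; ring).
      rewrite <- Cmod2_conj, <- RtoC_div by lra.
      simpl; field; lra. }
destruct hl as (l & l1 & l2).
pose proof (circle_diff x1 x2 x3 l1) as k; fold v in k; rewrite l2 in k.
specialize (h l l1); pose proof (Cmod_ge_0 (x2 + Cconj x1 * l)%C).
assert (Cmod (x2 + Cconj x1 * l)%C ^ 2 < Cmod (1 + Cconj x3 * l)%C ^ 2) by nra.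
fold v; lra.
Qed.

Lemma tetra_circle_lt (x1 x2 x3 l : C) : tetra_ineq x1 x2 x3 -> Cmod l = 1 ->
  Cmod (x2 + Cconj x1 * l)%C < Cmod (1 + Cconj x3 * l)%C.
Proof.
intros [h3 h] hl.
pose proof (circle_diff x1 x2 x3 hl) as k; pose proof (rotation_sup (x1 * x2 - x3)%C hl) as r.
pose proof (Cmod_ge_0 (x2 + Cconj x1 * l)%C); pose proof (Cmod_ge_0 (1 + Cconj x3 * l)%C).
nra.
Qed.

Lemma Cconj_neq0 (b : C) : b <> 0%C -> Cconj b <> 0%C.
Proof.
intros hb E; apply hb; rewrite <- (Cconj_conj b), E; apply injective_projections; simpl; ring.
Qed.

Lemma Cconj_div (a b : C) : b <> 0%C -> Cconj (a / b) = (Cconj a / Cconj b)%C.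
Proof.
intros hb; pose proof (Cconj_neq0 hb) as hb'.
replace (Cconj a / Cconj b)%C with (Cconj (a / b * b) / Cconj b)%C.
- rewrite Cmult_conj; field; exact hb'.
- f_equal; f_equal; field; exact hb.
Qed.

Lemma Cmod_blaschke (a b : C) :
  Cmod (1 + Cconj a * b)%C ^ 2 - Cmod (a + b)%C ^ 2 = (1 - Cmod a ^ 2) * (1 - Cmod b ^ 2).
Proof. rewrite !Cmod_sqr; destruct a, b; simpl; ring. Qed.

Lemma one_plus_neq0 (a : C) : Cmod a < 1 -> (1 + a)%C <> 0%C.
Proof.
intros h E; replace a with (- (1))%C in h.
- rewrite Cmod_opp, Cmod_1 in h; lra.
- replace a with (1 + a - 1)%C by ring; rewrite E; ring.
Qed.

(** * Analytic discs in the tetrablock *)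

Section TetraDisc.

Variables w1 w2 w3 : C.
Hypothesis hw : tetra_ineq w1 w2 w3.

(* The analytic disc of degree one through [(w1, w2, w3)] at [t = 0]; on [|t| = 1] its components
   satisfy [phi1 = conj phi2 * phi3]. *)
Definition tetra_den (t : C) : C := (1 + Cconj w3 * t)%C.
Definition tetra_disc (t : C) : C * C * C :=
  ((w1 + Cconj w2 * t) / tetra_den t, (w2 + Cconj w1 * t) / tetra_den t,
   (w3 + t) / tetra_den t)%C.

Lemma tetra_den_neq0 t : Cmod t <= 1 -> tetra_den t <> 0%C.
Proof.
intros ht; apply one_plus_neq0; rewrite Cmod_mult, Cmod_conj.
destruct hw as [h _]; pose proof (Cmod_ge_0 w3); pose proof (Cmod_ge_0 t); nra.
Qed.

(** The circle condition for the disc point at [l] is the one for (w1, w2, w3) at l'': both sides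
    acquire the same factor v / n, and l'' is the image of a rotated [l] under the disc automorphism
    s |-> (t + s) / (1 + conj t s), hence unimodular. *)
Lemma tetra_disc_in (t : C) : Cmod t < 1 -> tetrablock (tetra_disc t).
Proof.
intros ht; unfold tetra_disc; apply tetrablock_ineq.
pose proof (tetra_den_neq0 (Rlt_le _ _ ht)) as n0; pose proof (Cconj_neq0 n0) as n0'.
set (n := tetra_den t) in *.
assert (n1 : 0 < Cmod n) by now apply Cmod_gt_0.
pose proof (Cmod_ge_0 w3); pose proof (Cmod_ge_0 t); destruct hw as [hw3 _].
apply tetra_ineq_circle.
- rewrite Cmod_div by exact n0.
  pose proof (Cmod_blaschke w3 t) as b; change (1 + Cconj w3 * t)%C with n in b.
  assert (0 < (1 - Cmod w3 ^ 2) * (1 - Cmod t ^ 2)) by (apply Rmult_lt_0_compat; nra).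
  apply Rmult_lt_reg_r with (Cmod n); [exact n1 |].
  unfold Rdiv; rewrite Rmult_assoc, Rinv_l, Rmult_1_r, Rmult_1_l by lra; nra.
- intros l hl.
  set (l' := (l * n / Cconj n)%C).
  assert (hl' : Cmod l' = 1).
  { unfold l'; rewrite Cmod_div, Cmod_mult, Cmod_conj, hl by exact n0'; field; lra. }
  set (v := (1 + Cconj t * l')%C).
  assert (v0 : v <> 0%C).
  { apply one_plus_neq0; rewrite Cmod_mult, Cmod_conj, hl'; lra. }
  assert (v1 : 0 < Cmod v) by now apply Cmod_gt_0.
  set (l'' := ((t + l') / v)%C).
  assert (hl'' : Cmod l'' = 1).
  { unfold l''; rewrite Cmod_div by exact v0.
    pose proof (Cmod_blaschke t l') as b; rewrite hl' in b; fold v in b.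
    pose proof (Cmod_ge_0 (t + l')%C).
    replace (Cmod (t + l')%C) with (Cmod v) by nra; field; lra. }
  assert (el : l = (l' * Cconj n / n)%C) by (unfold l'; field; now split).
  assert (e1 : ((w2 + Cconj w1 * t) / n + Cconj ((w1 + Cconj w2 * t) / n) * l
              = v / n * (w2 + Cconj w1 * l''))%C).
  { rewrite Cconj_div, Cplus_conj, Cmult_conj, Cconj_conj by exact n0; rewrite el.
    unfold l'', v; field; repeat split; trivial. }
  assert (e2 : (1 + Cconj ((w3 + t) / n) * l = v / n * (1 + Cconj w3 * l''))%C).
  { rewrite Cconj_div, Cplus_conj by exact n0; rewrite el.
    transitivity ((n + (Cconj w3 + Cconj t) * l') / n)%C; [field; now split |].
    transitivity ((v + Cconj w3 * (t + l')) / n)%C; [unfold n, tetra_den, v; f_equal; ring |].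
    unfold l''; field; now split. }
  rewrite e1, e2, !Cmod_mult.
  apply Rmult_lt_compat_l; [rewrite Cmod_div by exact n0; apply Rdiv_lt_0_compat; lra |].
  now apply tetra_circle_lt.
Qed.

(** The explicit description of bE. Showing that it is a boundary set puts [distinguished_boundary]
    inside it. *)
Definition tetra_shilov (z : C * C * C) : Prop :=
  Cmod (snd z) = 1 /\ Cmod (snd (fst z)) <= 1 /\ fst (fst z) = (Cconj (snd (fst z)) * snd z)%C.

Lemma tetra_disc_boundary (t : C) : Cmod t = 1 -> tetra_shilov (tetra_disc t).
Proof.
intros ht; unfold tetra_shilov, tetra_disc; simpl fst; simpl snd.
assert (ht' : Cmod t <= 1) by lra.
pose proof (tetra_den_neq0 ht') as n0; pose proof (Cconj_neq0 n0) as n0'.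
set (n := tetra_den t) in *.
assert (n1 : 0 < Cmod n) by now apply Cmod_gt_0.
pose proof (Cmod_ge_0 w3); pose proof (Cmod_ge_0 (w3 + t)%C).
assert (E : Cmod (w3 + t)%C = Cmod n).
{ pose proof (Cmod_blaschke w3 t) as b; change (1 + Cconj w3 * t)%C with n in b; rewrite ht in b; nra. }
split; [| split].
- rewrite Cmod_div, E by exact n0; field; lra.
- pose proof (tetra_circle_lt hw ht) as b; change (1 + Cconj w3 * t)%C with n in b.
  rewrite Cmod_div by exact n0.
  apply Rmult_le_reg_r with (Cmod n); [exact n1 |].
  unfold Rdiv; rewrite Rmult_assoc, Rinv_l, Rmult_1_r, Rmult_1_l by lra; lra.
- rewrite Cconj_div, Cplus_conj, Cmult_conj, Cconj_conj by exact n0.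
  assert (tt : (Cconj t * t = 1)%C).
  { rewrite Cmult_comm, <- Cmod2_conj, ht; apply injective_projections; simpl; ring. }
  (* On |t| = 1 the numerator is t times the conjugate denominator, so the third component becomes t
     conj n / n. *)
  assert (cn : (w3 + t = t * Cconj n)%C).
  { unfold n, tetra_den; rewrite Cplus_conj, Cmult_conj, Cconj_conj.
    replace (Cconj 1) with (RtoC 1) by (apply injective_projections; simpl; ring).
    transitivity (t + w3 * (Cconj t * t))%C; [rewrite tt; ring | ring]. }
  rewrite cn.
  transitivity ((Cconj w2 * t + w1 * (Cconj t * t)) / n)%C; [rewrite tt; field; exact n0 |].
  field; now split.
Qed.

End TetraDisc.

(** * Neighbourhoods in C^3 and attained maxima *)

Definition near3 (r : R) (z w : C * C * C) : Prop :=
  Cmod (fst (fst w) - fst (fst z))%C < r /\ Cmod (snd (fst w) - snd (fst z))%C < r /\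
  Cmod (snd w - snd z)%C < r.

Lemma near3_refl r z : 0 < r -> near3 r z z.
Proof.
assert (e : forall c : C, Cmod (c - c) = 0).
{ intros c; replace (c - c)%C with (RtoC 0) by ring; apply Cmod_0. }
intros hr; unfold near3; rewrite !e; lra.
Qed.

Lemma ball_C_Cmod (z w : C) (r : R) : Cmod (w - z) < r -> ball z r w.
Proof.
intros h; split.
- change (Rabs (fst w - fst z) < r); eapply Rle_lt_trans; [| exact h].
  exact (re_le_Cmod (w - z)%C).
- change (Rabs (snd w - snd z) < r); eapply Rle_lt_trans; [| exact h].
  exact (Rabs_Im_le (w - z)%C).
Qed.

Lemma Cmod_ball_C (z w : C) (r : R) : ball z r w -> Cmod (w - z) < 2 * r.
Proof.
intros [h1 h2]; change (Rabs (fst w - fst z) < r) in h1; change (Rabs (snd w - snd z) < r) in h2.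
eapply Rle_lt_trans; [apply Cmod_le_2Rmax |].
apply Rmult_lt_compat_l; [lra |]; now apply Rmax_lub_lt.
Qed.

Lemma locally_near3 (z : C * C * C) (P : C * C * C -> Prop) :
  locally z P <-> exists r, 0 < r /\ forall w, near3 r z w -> P w.
Proof.
split.
- intros [r h]; exists r; split; [apply cond_pos |]; intros w (h1 & h2 & h3); apply h.
  repeat split; try (apply ball_C_Cmod; assumption); apply (ball_C_Cmod h1) || apply (ball_C_Cmod h2) || apply (ball_C_Cmod h3).
- intros (r & hr & h); assert (r2 : 0 < r / 2) by lra; exists (mkposreal _ r2).
  intros w [[h1 h2] h3]; apply h; simpl in h1, h2, h3.
  apply Cmod_ball_C in h1; apply Cmod_ball_C in h2; apply Cmod_ball_C in h3.
  repeat split; lra.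
Qed.

Lemma locally_C_Cmod (z : C) (P : C -> Prop) :
  locally z P <-> exists r, 0 < r /\ forall w, Cmod (w - z) < r -> P w.
Proof.
split.
- intros [r h]; exists r; split; [apply cond_pos |]; intros w hw; apply h, ball_C_Cmod, hw.
- intros (r & hr & h); assert (r2 : 0 < r / 2) by lra; exists (mkposreal _ r2).
  intros w hw; apply h; apply Cmod_ball_C in hw; simpl in hw; lra.
Qed.

Lemma closure_near3 (D : C * C * C -> Prop) z :
  closure D z <-> forall r, 0 < r -> exists w, D w /\ near3 r z w.
Proof.
split.
- intros h r hr; apply h; apply locally_near3; now exists r.
- intros h Q hQ; apply locally_near3 in hQ; destruct hQ as (r & hr & hQ).
  destruct (h r hr) as (w & h1 & h2); exists w; auto.
Qed.

Lemma closed_near3 (D : C * C * C -> Prop) :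
  closed D <-> forall z, (forall r, 0 < r -> exists w, D w /\ near3 r z w) -> D z.
Proof.
split.
- intros h z hz; apply h; intros hl; apply locally_near3 in hl; destruct hl as (r & hr & hl).
  destruct (hz r hr) as (w & h1 & h2); exact (hl w h2 h1).
- intros h z hz; apply h; intros r hr; apply NNPP; intros hn; apply hz.
  apply locally_near3; exists r; split; [exact hr |]; intros w h2 h1; apply hn; now exists w.
Qed.

Lemma continuous_on_near3 (D : C * C * C -> Prop) (f : C * C * C -> C) :
  continuous_on D f -> forall z, D z -> forall e, 0 < e ->
  exists r, 0 < r /\ forall w, D w -> near3 r z w -> Cmod (f w - f z) < e.
Proof.
intros h z hz e he.
assert (hP : locally (f z) (fun y => Cmod (y - f z)%C < e)).
{ apply locally_C_Cmod; now exists e. }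
pose proof (h z hz _ hP) as k; unfold filtermap, within in k.
apply locally_near3 in k; destruct k as (r & hr & k); exists r; split; [exact hr |]; auto.
Qed.

(** Real coordinates in the nested-pair format of the compactness lemma, which ends in a unit
    component. *)
Definition box_point (t : Tn 6 R) : C * C * C :=
  let '(a, (b, (c, (d, (e, (f, _)))))) := t in (((a, b), (c, d)), (e, f)).

Lemma close_box (r : R) (x t : Tn 6 R) : 0 < r -> close_n 6 (r / 2) x t ->
  near3 r (box_point t) (box_point x).
Proof.
intros hr; destruct x as (a & b & c & d & e & f & []), t as (a' & b' & c' & d' & e' & f' & []).
intros (h1 & h2 & h3 & h4 & h5 & h6 & _); unfold box_point.
assert (k : forall p q p' q', Rabs (p - p') < r / 2 -> Rabs (q - q') < r / 2 ->
  Cmod ((p, q) - (p', q'))%C < r).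
{ intros p q p' q' k1 k2; pose proof (Cmod_le_2Rmax ((p, q) - (p', q'))%C) as k0.
  change (Cmod ((p, q) - (p', q'))%C <= 2 * Rmax (Rabs (p - p')) (Rabs (q - q'))) in k0.
  pose proof (Rmax_lub_lt _ _ _ k1 k2); lra. }
repeat split; simpl fst; simpl snd; now apply k.
Qed.

Lemma list_argmax (T : Type) (F : T -> R) (l : list T) : l <> nil ->
  exists x, In x l /\ forall y, In y l -> F y <= F x.
Proof.
induction l as [| a l IH]; [congruence |]; intros _.
destruct l as [| b l].
- exists a; split; [now left |]; intros y [-> | []]; lra.
- destruct IH as (x & h1 & h2); [discriminate |].
  destruct (Rle_lt_dec (F x) (F a)) as [h | h].
  + exists a; split; [now left |]; intros y [-> | hy]; [lra | specialize (h2 y hy); lra].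
  + exists x; split; [now right |]; intros y [-> | hy]; [lra | auto].
Qed.

(** If no maximum is attained, each point of [S] has a neighbourhood where the values stay below F s
    for some s in [S], and each other point has one missing [S]. Among the finitely many s of a
    subcover the one with largest value itself lies in some neighbourhood, hence has a value below
    another of them. *)
Lemma extreme_value (S : C * C * C -> Prop) (F : C * C * C -> R) (z0 : C * C * C) :
  closed S -> S z0 ->
  (forall z, S z -> Cmod (fst (fst z)) <= 1 /\ Cmod (snd (fst z)) <= 1 /\ Cmod (snd z) <= 1) ->
  (forall z, S z -> forall e, 0 < e -> exists r, 0 < r /\ forall w, S w -> near3 r z w -> F w < F z + e) ->
  exists z, S z /\ forall w, S w -> F w <= F z.
Proof.
intros hc h0 hb hF; apply NNPP; intros hn.
assert (larger : forall z, S z -> exists s, S s /\ F z < F s).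
{ intros z hz; apply NNPP; intros hn'; apply hn; exists z; split; [exact hz |]; intros w hw.
  apply Rnot_lt_le; intros hl; apply hn'; now exists w. }
assert (cover : forall t : Tn 6 R, exists sr : (C * C * C) * posreal, S (fst sr) /\
  forall w, S w -> near3 (2 * snd sr) (box_point t) w -> F w < F (fst sr)).
{ intros t; destruct (classic (S (box_point t))) as [hs | hs].
  - destruct (larger _ hs) as (s & h1 & h2).
    destruct (hF _ hs (F s - F (box_point t))) as (r & hr & h3); [lra |].
    assert (r2 : 0 < r / 2) by lra.
    exists (s, mkposreal _ r2); simpl; split; [exact h1 |]; intros w hw hn'.
    replace (2 * (r / 2)) with r in hn' by field; specialize (h3 w hw hn'); lra.
  - assert (ex : exists r, 0 < r /\ forall w, S w -> ~ near3 r (box_point t) w).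
    { apply NNPP; intros hn'; apply hs, (proj1 (closed_near3 S) hc); intros r hr.
      apply NNPP; intros hn2; apply hn'; exists r; split; [exact hr |].
      intros w h1 h2; apply hn2; now exists w. }
    destruct ex as (r & hr & h); assert (r2 : 0 < r / 2) by lra.
    exists (z0, mkposreal _ r2); simpl; split; [exact h0 |]; intros w hw hn'.
    replace (2 * (r / 2)) with r in hn' by field; elim (h w hw hn'). }
destruct (choice _ cover) as [f hf]; clear cover.
set (lo := (-1, (-1, (-1, (-1, (-1, (-1, tt)))))) : Tn 6 R).
set (up := (1, (1, (1, (1, (1, (1, tt)))))) : Tn 6 R).
(* The finite cover comes under a double negation, which the goal [False] absorbs. *)
apply (compactness_list 6 lo up (fun t => snd (f t))); intros (l & hl).
assert (inbox : forall s, S s -> exists t, In t l /\ F s < F (fst (f t))).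
{ intros s hs; destruct (hb s hs) as (b1 & b2 & b3); destruct s as [[[a b] [c d]] [e g]].
  simpl fst in *; simpl snd in *.
  assert (co : forall p q, Cmod (p, q) <= 1 -> (-1 <= p <= 1) /\ (-1 <= q <= 1)).
  { intros p q h; pose proof (re_le_Cmod (p, q)) as k1; pose proof (Rabs_Im_le (p, q)) as k2.
    simpl in k1, k2; apply Rabs_le_between in k1; apply Rabs_le_between in k2; lra. }
  destruct (co _ _ b1), (co _ _ b2), (co _ _ b3).
  destruct (hl (a, (b, (c, (d, (e, (g, tt))))))) as (t & h1 & _ & h3).
  { simpl; tauto. }
  exists t; split; [exact h1 |].
  apply (proj2 (hf t)); [exact hs |].
  apply (@close_box (2 * snd (f t)) (a, (b, (c, (d, (e, (g, tt))))))).
  - pose proof (cond_pos (snd (f t))); lra.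
  - replace (2 * snd (f t) / 2) with (pos (snd (f t))) by field; exact h3. }
destruct (inbox z0 h0) as (t0 & ht0 & _).
destruct (@list_argmax _ (fun t => F (fst (f t))) l) as (t & h1 & h2).
{ intros ->; destruct ht0. }
destruct (inbox (fst (f t)) (proj1 (hf t))) as (t' & h3 & h4).
specialize (h2 t' h3); simpl in h2; lra.
Qed.

Lemma sqrt_sum_sqr_le (a b : R) : 0 <= a -> 0 <= b -> sqrt (a ^ 2 + b ^ 2) <= a + b.
Proof.
intros ha hb; rewrite <- (sqrt_pow2 (a + b)) by lra; apply sqrt_le_1_alt; nra.
Qed.

Lemma norm_C3_le (z : C * C * C) :
  norm z <= Cmod (fst (fst z)) + Cmod (snd (fst z)) + Cmod (snd z).
Proof.
pose proof (sqrt_sum_sqr_le (Cmod_ge_0 (fst (fst z))) (Cmod_ge_0 (snd (fst z)))) as h1.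
assert (h0 : 0 <= sqrt (Cmod (fst (fst z)) ^ 2 + Cmod (snd (fst z)) ^ 2)) by apply sqrt_pos.
pose proof (sqrt_sum_sqr_le h0 (Cmod_ge_0 (snd z))) as h2.
change (sqrt (sqrt (Cmod (fst (fst z)) ^ 2 + Cmod (snd (fst z)) ^ 2) ^ 2 + Cmod (snd z) ^ 2)
  <= Cmod (fst (fst z)) + Cmod (snd (fst z)) + Cmod (snd z)).
lra.
Qed.

Definition curve (p1 p2 p3 : C -> C) (t : C) : C * C * C := (p1 t, p2 t, p3 t).

Lemma curve_near3 p1 p2 p3 t : ccont p1 t -> ccont p2 t -> ccont p3 t ->
  forall r, 0 < r -> exists d, 0 < d /\ forall s, Cmod (s - t) < d ->
    near3 r (curve p1 p2 p3 t) (curve p1 p2 p3 s).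
Proof.
intros h1 h2 h3 r hr.
destruct (h1 r hr) as (d1 & q1 & k1), (h2 r hr) as (d2 & q2 & k2), (h3 r hr) as (d3 & q3 & k3).
exists (Rmin d1 (Rmin d2 d3)); split; [repeat apply Rmin_pos; trivial |]; intros s hs.
pose proof (Rmin_l d1 (Rmin d2 d3)); pose proof (Rmin_r d1 (Rmin d2 d3)).
pose proof (Rmin_l d2 d3); pose proof (Rmin_r d2 d3).
repeat split; simpl; [apply k1 | apply k2 | apply k3]; lra.
Qed.

(** The Caratheodory factorization of the coordinates gives y - z = (w - t) s(w) with s continuous,
    so the derivative is l (s t); the error splits into the remainder of [f] and l (s w - s t). *)
Lemma holomorphic_curve (f : C * C * C -> C) (p1 p2 p3 : C -> C) (t : C) :
  ex_filterdiff (K := C_AbsRing) f (locally (curve p1 p2 p3 t)) ->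
  cdiff p1 t -> cdiff p2 t -> cdiff p3 t -> cdiff (fun s => f (curve p1 p2 p3 s)) t.
Proof.
intros [l [lin hl]] h1 h2 h3; set (z := curve p1 p2 p3 t) in *.
pose proof (curve_near3 (cdiff_ccont h1) (cdiff_ccont h2) (cdiff_ccont h3)) as cn.
apply cdiff_caratheodory in h1; apply cdiff_caratheodory in h2; apply cdiff_caratheodory in h3.
destruct h1 as (s1 & c1 & e1), h2 as (s2 & c2 & e2), h3 as (s3 & c3 & e3).
pose proof (curve_near3 c1 c2 c3) as cs; set (s := curve s1 s2 s3) in *.
specialize (hl z (fun P h => h)).
destruct (linear_norm _ lin) as [M [M0 hM]].
exists (l (s t)); intros e he.
set (B := norm (s t) + 3).
assert (B0 : 0 < B) by (pose proof (norm_ge_0 (s t)); unfold B; lra).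
assert (eb : 0 < e / (2 * B)) by (apply Rdiv_lt_0_compat; lra).
specialize (hl (mkposreal _ eb)); apply locally_near3 in hl; destruct hl as (r & hr & hl).
destruct (cn r hr) as (d1 & q1 & k1).
set (g := Rmin 1 (e / (6 * M))).
assert (g0 : 0 < g) by (apply Rmin_pos; [lra | apply Rdiv_lt_0_compat; lra]).
assert (g1 : g <= 1) by apply Rmin_l.
assert (g2 : M * (3 * g) <= e / 2).
{ assert (g <= e / (6 * M)) by apply Rmin_r.
  apply Rle_trans with (M * (3 * (e / (6 * M)))); [apply Rmult_le_compat_l; lra | right; field; lra]. }
destruct (cs g g0) as (d2 & q2 & k2).
exists (Rmin d1 d2); split; [now apply Rmin_pos |]; intros w hw.
specialize (k1 w (Rlt_le_trans _ _ _ hw (Rmin_l _ _))).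
specialize (k2 w (Rlt_le_trans _ _ _ hw (Rmin_r _ _))).
specialize (hl _ k1).
set (y := curve p1 p2 p3 w) in *.
assert (ey : minus y z = scal (w - t)%C (s w)).
{ change ((p1 w - p1 t, p2 w - p2 t, p3 w - p3 t)%C
        = ((w - t) * s1 w, (w - t) * s2 w, (w - t) * s3 w)%C).
  rewrite e1, e2, e3; f_equal; [f_equal |]; ring. }
set (ds := minus (s w) (s t)).
assert (nds : norm ds <= 3 * g).
{ destruct k2 as (m1 & m2 & m3); simpl in m1, m2, m3.
  eapply Rle_trans; [apply norm_C3_le |]; simpl.
  change (Cmod (s1 w - s1 t) + Cmod (s2 w - s2 t) + Cmod (s3 w - s3 t) <= 3 * g); lra. }
assert (nsw : norm (s w) <= B).
{ assert (e4 : s w = plus ds (s t)) by (unfold ds; symmetry; apply minus_plusK).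
  rewrite e4; eapply Rle_trans; [apply (norm_triangle ds (s t)) |]; unfold B; lra. }
assert (nyz : norm (minus y z) <= Cmod (w - t) * B).
{ rewrite ey; eapply Rle_trans; [exact (norm_scal (w - t)%C (s w)) |].
  apply Rmult_le_compat_l; [apply Cmod_ge_0 | exact nsw]. }
assert (lyz : l (minus y z) = ((w - t) * l (s w))%C).
{ rewrite ey; exact (linear_scal _ lin (w - t)%C (s w)). }
assert (lds : l (s w) = (l ds + l (s t))%C).
{ assert (e4 : s w = plus ds (s t)) by (unfold ds; symmetry; apply minus_plusK).
  rewrite e4 at 1; exact (linear_plus _ lin ds (s t)). }
assert (b1 : Cmod (f y - f z - (w - t) * l (s w))%C <= e / (2 * B) * (Cmod (w - t) * B)).
{ eapply Rle_trans; [| apply Rmult_le_compat_l; [lra | exact nyz]].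
  rewrite <- lyz; exact hl. }
assert (b2 : Cmod (l ds) <= e / 2).
{ eapply Rle_trans; [exact (hM ds) |]; eapply Rle_trans; [| exact g2].
  apply Rmult_le_compat_l; [lra | exact nds]. }
change (Cmod (f y - f z - l (s t) * (w - t))%C <= e * Cmod (w - t)).
replace (f y - f z - l (s t) * (w - t))%C
  with ((f y - f z - (w - t) * l (s w)) + (w - t) * l ds)%C by (rewrite lds; ring).
eapply Rle_trans; [apply Cmod_triangle |]; rewrite Cmod_mult.
pose proof (Cmod_ge_0 (w - t)).
assert (Cmod (w - t) * Cmod (l ds) <= Cmod (w - t) * (e / 2)) by (apply Rmult_le_compat_l; lra).
replace (e / (2 * B) * (Cmod (w - t) * B)) with (Cmod (w - t) * (e / 2)) in b1 by (field; lra).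
lra.
Qed.

(** Multiplying a matrix by q < 1 moves its point to (q z1, q z2, q^2 z3); for a point of this set
    [tetra_ineq] then amounts to 2 q^2 < 1 + q^4. *)
Lemma tetra_shilov_closure (z : C * C * C) : tetra_shilov z -> closed_tetrablock z.
Proof.
destruct z as [[z1 z2] z3]; intros (h3 & h2 & h1); simpl in h1, h2, h3.
apply closure_near3; intros r hr.
set (s := Rmin (/ 2) (r / 4)).
assert (s0 : 0 < s) by (apply Rmin_pos; lra).
assert (s1 : s <= / 2) by apply Rmin_l; assert (s2 : s <= r / 4) by apply Rmin_r.
set (q := 1 - s).
assert (m1 : Cmod z1 = Cmod z2) by (rewrite h1, Cmod_mult, Cmod_conj, h3; ring).
exists (RtoC q * z1, RtoC q * z2, RtoC (q * q) * z3)%C; split.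
- apply tetrablock_ineq; split.
  + rewrite Cmod_mult, Cmod_R, h3, Rabs_pos_eq by (unfold q; nra); unfold q; nra.
  + replace (RtoC q * z1 * (RtoC q * z2) - RtoC (q * q) * z3)%C
      with (RtoC (q * q * (Cmod z2 ^ 2 - 1)) * z3)%C.
    2: { assert (e : RtoC (Cmod z2 ^ 2) = (z2 * Cconj z2)%C) by apply Cmod2_conj.
         rewrite h1, !RtoC_mult, RtoC_minus, e; ring. }
    pose proof (Cmod_ge_0 z2).
    assert (z22 : 0 <= Cmod z2 ^ 2 <= 1) by nra.
    rewrite !Cmod_mult, !Cmod_R, h3, m1, !Rpow_mult_distr, !pow2_abs, !Rmult_1_r.
    rewrite (Rabs_left1 (q * q * (Cmod z2 ^ 2 - 1))) by (assert (0 <= q * q) by nra; nra).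
    assert (q * q < 1) by (unfold q; nra).
    assert (0 < (1 - q * q) * (1 - q * q)) by nra. nra.
- assert (d : forall c k : C, Cmod (c * k - k) = Cmod (c - 1) * Cmod k).
  { intros c k; rewrite <- Cmod_mult; f_equal; ring. }
  assert (d1 : Cmod (RtoC q - 1) = s).
  { rewrite <- RtoC_minus, Cmod_R; unfold q; replace (1 - s - 1) with (- s) by ring.
    rewrite Rabs_Ropp, Rabs_pos_eq; lra. }
  assert (d2 : Cmod (RtoC (q * q) - 1) <= 2 * s).
  { rewrite <- RtoC_minus, Cmod_R; unfold q; apply Rabs_le; nra. }
  unfold near3; simpl fst; simpl snd; rewrite !d, m1, h3, d1; repeat split; nra.
Qed.

Lemma tetra_shilov_closed : closed tetra_shilov.
Proof.
apply closed_near3; intros z hz.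
assert (b3 : Cmod (snd z) = 1).
{ apply Rle_antisym; apply Rnot_lt_le; intros hl.
  - destruct (hz (Cmod (snd z) - 1)) as (w & (w3 & _) & (_ & _ & n3)); [lra |].
    pose proof (Cmod_dist (snd w) (snd z)); lra.
  - destruct (hz (1 - Cmod (snd z))) as (w & (w3 & _) & (_ & _ & n3)); [lra |].
    pose proof (Cmod_dist (snd w) (snd z)); lra. }
assert (b2 : Cmod (snd (fst z)) <= 1).
{ apply Rnot_lt_le; intros hl.
  destruct (hz (Cmod (snd (fst z)) - 1)) as (w & (_ & w2 & _) & (_ & n2 & _)); [lra |].
  pose proof (Cmod_dist (snd (fst w)) (snd (fst z))); lra. }
split; [exact b3 | split; [exact b2 |]].
apply C_eq_of_small with 3; intros e he; destruct (hz e he) as (w & (w3 & w2 & w1) & (m1 & m2 & m3)).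
replace (fst (fst z) - Cconj (snd (fst z)) * snd z)%C
  with (- (fst (fst w) - fst (fst z)) + (Cconj (snd (fst w) - snd (fst z)) * snd w
     + Cconj (snd (fst z)) * (snd w - snd z)))%C by (rewrite w1, Cminus_conj; ring).
eapply Rle_trans; [apply Cmod_triangle |]; rewrite Cmod_opp.
eapply Rle_trans; [apply Rplus_le_compat_l, Cmod_triangle |].
rewrite !Cmod_mult, !Cmod_conj, w3.
pose proof (Cmod_ge_0 (snd (fst z))); pose proof (Cmod_ge_0 (snd w - snd z)); nra.
Qed.

Section Attained.

Variable f : C * C * C -> C.
Hypotheses (f_cont : continuous_on closed_tetrablock f) (f_hol : holomorphic_on tetrablock f).

Lemma tetra_max_modulus (w : C * C * C) (M : R) : tetrablock w ->
  (forall z, tetra_shilov z -> Cmod (f z) <= M) -> Cmod (f w) <= M.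
Proof.
destruct w as [[w1 w2] w3]; intros hw hM; apply tetrablock_ineq in hw.
set (p1 := fun t => ((w1 + Cconj w2 * t) / tetra_den w3 t)%C).
set (p2 := fun t => ((w2 + Cconj w1 * t) / tetra_den w3 t)%C).
set (p3 := fun t => ((w3 + t) / tetra_den w3 t)%C).
assert (ec : forall t, tetra_disc w1 w2 w3 t = curve p1 p2 p3 t) by reflexivity.
assert (cd : forall t, Cmod t <= 1 -> cdiff p1 t /\ cdiff p2 t /\ cdiff p3 t).
{ intros t ht; pose proof (tetra_den_neq0 hw ht) as n0.
  assert (di : cdiff (fun t => / tetra_den w3 t)%C t).
  { apply cdiff_inv; [exact n0 |].
    apply cdiff_plus; [apply cdiff_const |]; apply cdiff_mult; [apply cdiff_const | apply cdiff_id]. }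
  assert (af : forall a b : C, cdiff (fun t => a + b * t)%C t).
  { intros a b; apply cdiff_plus; [apply cdiff_const |]; apply cdiff_mult; [apply cdiff_const | apply cdiff_id]. }
  repeat split; apply cdiff_mult; trivial.
  apply cdiff_plus; [apply cdiff_const | apply cdiff_id]. }
assert (incl : forall t, Cmod t <= 1 -> closed_tetrablock (curve p1 p2 p3 t)).
{ intros t [ht | ht]; rewrite <- ec.
  - apply closure_near3; intros r hr; exists (tetra_disc w1 w2 w3 t).
    split; [now apply tetra_disc_in | now apply near3_refl].
  - now apply tetra_shilov_closure, tetra_disc_boundary. }
assert (e0 : curve p1 p2 p3 0%C = (w1, w2, w3)).
{ assert (ed : tetra_den w3 0%C = 1%C) by (unfold tetra_den; ring).
  unfold curve, p1, p2, p3; rewrite ed; f_equal; [f_equal |]; field;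
    intros E; apply C1_nz; exact E. }
rewrite <- e0; apply (@max_modulus (fun t => f (curve p1 p2 p3 t))).
- intros t ht; destruct (cd t (Rlt_le _ _ ht)) as (h1 & h2 & h3).
  apply holomorphic_curve; trivial; apply f_hol; rewrite <- ec; now apply tetra_disc_in.
- intros t ht e he.
  destruct (continuous_on_near3 f_cont (incl t ht) he) as (r & hr & h).
  destruct (cd t ht) as (h1 & h2 & h3).
  destruct (curve_near3 (cdiff_ccont h1) (cdiff_ccont h2) (cdiff_ccont h3) hr) as (d & hd & k).
  exists d; split; [exact hd |]; intros s hs hs'; apply h; [now apply incl | now apply k].
- intros t ht; apply hM; rewrite <- ec; now apply tetra_disc_boundary.
Qed.

(** Compactness provides a maximum over the set; the discs extend the bound to the open domain, and
    continuity to its closure. *)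
Lemma tetra_shilov_attains :
  exists z, tetra_shilov z /\ forall w, closed_tetrablock w -> Cmod (f w) <= Cmod (f z).
Proof.
destruct (@extreme_value tetra_shilov (fun z => Cmod (f z)) (RtoC 0, RtoC 0, RtoC 1)) as (z & hz & hmax).
- apply tetra_shilov_closed.
- unfold tetra_shilov; simpl fst; simpl snd; rewrite Cmod_1, Cmod_0.
  repeat split; [lra |]; apply injective_projections; simpl; ring.
- intros z (h3 & h2 & h1); rewrite h1, Cmod_mult, Cmod_conj, h3; lra.
- intros z hz e he.
  destruct (continuous_on_near3 f_cont (tetra_shilov_closure hz) he) as (r & hr & h).
  exists r; split; [exact hr |]; intros w hw hn.
  specialize (h w (tetra_shilov_closure hw) hn).
  pose proof (Cmod_dist (f w) (f z)); lra.
- exists z; split; [exact hz |]; intros w hw; apply Rnot_lt_le; intros hl.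
  destruct (continuous_on_near3 f_cont hw (e := Cmod (f w) - Cmod (f z))) as (r & hr & h); [lra |].
  destruct (proj1 (closure_near3 _ _) hw r hr) as (v & hv & nv).
  assert (cv : closed_tetrablock v).
  { apply closure_near3; intros q hq; exists v; split; [exact hv | now apply near3_refl]. }
  specialize (h v cv nv).
  pose proof (tetra_max_modulus hv hmax) as m.
  pose proof (Cmod_dist (f v) (f w)); lra.
Qed.

End Attained.

Theorem distinguished_boundary_sub (z : C * C * C) : distinguished_boundary z -> tetra_shilov z.
Proof.
intros h; apply h; split; [apply tetra_shilov_closed |].
split; [exact tetra_shilov_closure | exact tetra_shilov_attains].
Qed.

Lemma closed_tetrablock_snd (z : C * C * C) : closed_tetrablock z -> Cmod (snd z) <= 1.
Proof.
intros h; apply Rnot_lt_le; intros hl.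
destruct (proj1 (closure_near3 _ _) h (Cmod (snd z) - 1)) as ([[w1 w2] w3] & hw & (_ & _ & n3)); [lra |].
apply tetrablock_ineq in hw; destruct hw as [hw _]; simpl in n3.
pose proof (Cmod_dist w3 (snd z)); lra.
Qed.

(** * Uniqueness of the tetrablock unitary dilation *)

(** The polynomial bound is applied to the coordinate z3, whose modulus is at most 1 on the closed
    tetrablock. *)
Lemma tetrablock_contraction_contr (H : Hilbert) (A B P : bop H H) :
  tetrablock_contraction A B P -> forall x, norm (P x) <= norm x.
Proof.
intros (_ & _ & h).
set (p := (RtoC 1, (O, O, 1%nat)) :: nil); specialize (h p).
assert (ub : Rbar_le (opnorm (pevalop p A B P)) 1).
{ eapply Rbar_le_trans; [exact h |]; apply Lub_Rbar_correct; intros r [[[z1 z2] z3] [hz ->]].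
  pose proof (closed_tetrablock_snd hz) as k; simpl in k.
  simpl; replace (1 * (1 * 1 * (z3 * 1)) + 0)%C with z3 by ring; exact k. }
intros x; rewrite <- (Rmult_1_l (norm x)).
replace (P x) with (pevalop p A B P x).
2: { change (plus (scal (RtoC 1) (P x)) zero = P x); hvec. }
refine (opnorm_le _ ub x); intros c y; apply bop_scal.
Qed.

(** The second identity follows from the first: N1^* N3 = N3^* N2 N3 = N2, as N3 is unitary and
    commutes with N2. *)
Lemma tetrablock_unitary_relation (K : Hilbert) (N1 N2 N3 : bop K K) :
  tetrablock_unitary N1 N2 N3 -> unitary N3 ->
  (N1 = N2^* * N3)%B /\ (N2 = N1^* * N3)%B.
Proof.
intros ((c12 & c13 & c23) & n1 & n2 & n3 & spec) [u _].
assert (e : (N1 = N2^* * N3)%B).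
{ apply relation_of_spectrum; trivial; intros z1 z2 z3 hz.
  now destruct (distinguished_boundary_sub (spec _ hz)) as (_ & _ & h). }
split; [exact e |].
rewrite e, adj_comp, adj_adj, <- bcompA, c23, bcompA, u; now rewrite bcomp1l.
Qed.

Section Conjugation.

Variables (K L : Hilbert) (W : bop K L).
Hypothesis W_unitary : unitary W.

Definition conj_by (T : bop K K) : bop L L := (W * T * W^*)%B.

Lemma conj_comp S T : conj_by (S * T)%B = (conj_by S * conj_by T)%B.
Proof.
pose proof (proj1 W_unitary) as w0; pointwise w0 as w; unfold conj_by.
apply bop_eq; intros x; bopE; now rewrite w.
Qed.

Lemma conj_adj T : conj_by T^*%B = ((conj_by T)^*)%B.
Proof. unfold conj_by; rewrite !adj_comp, adj_adj; symmetry; apply bcompA. Qed.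

Lemma conj_pow T n : conj_by (T ^ n)%B = (conj_by T ^ n)%B.
Proof.
induction n as [| n IH].
- change (W * 1 * W^* = 1)%B; rewrite bcomp1r; apply W_unitary.
- change (conj_by (T * T ^ n)%B = (conj_by T * conj_by T ^ n)%B); now rewrite conj_comp, IH.
Qed.

Lemma conj_compress (H : Hilbert) (j : bop H K) T :
  ((W * j)^* * conj_by T * (W * j) = j^* * T * j)%B.
Proof.
pose proof (proj1 W_unitary) as w0; pointwise w0 as w; unfold conj_by; rewrite adj_comp.
apply bop_eq; intros x; bopE; now rewrite !w.
Qed.

End Conjugation.

(** Serves both parts: W is the identity when the unitary is [dil_U] itself, and the equivalence of
    minimal dilations otherwise. Conjugation by W is multiplicative and respects adjoints and
    embeddings, so relations and moments carry over to the model space. *)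
Lemma dilation_unique (H : Hilbert) (A B P : bop H H)
    (F1 F2 : bop (defect_space P) (defect_space P))
    (G1 G2 : bop (defect_space P^*) (defect_space P^*))
    (K : Hilbert) (j : bop H K) (W : bop K (dil_space P)) (N1 N2 N3 : bop K K) :
  tetrablock_contraction A B P -> fundamental_operators A B P F1 F2 ->
  fundamental_operators A^* B^* P^* G1 G2 ->
  unitary N3 -> tetrablock_unitary_dilation j A B P N1 N2 N3 ->
  unitary W -> (W * j = dil_embed P)%B -> (W * N3 = dil_U P * W)%B ->
  conj_by W N1 = dil_R1 P A F1 F2 G1 G2 /\ conj_by W N2 = dil_R2 P B F1 F2 G1 G2 /\
  conj_by W N3 = dil_U P.
Proof.
intros hT hF hG u3 (_ & hN & hm) uW Wj WU.
pose proof (tetrablock_contraction_contr hT) as hP.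
destruct hT as ((cAB & cAP & cBP) & _).
destruct (tetrablock_unitary_relation hN u3) as [e1 e2].
destruct hN as ((c12 & c13 & c23) & _).
assert (eU : conj_by W N3 = dil_U P).
{ unfold conj_by; rewrite WU, <- bcompA, (proj2 uW); apply bcomp1r. }
assert (cc : forall T, commute T N3 -> commute (conj_by W T) (dil_U P)).
{ intros T h; unfold commute; rewrite <- eU, <- !conj_comp by exact uW; now rewrite h. }
assert (rel : forall S T, (S = T^* * N3)%B -> conj_by W S = ((conj_by W T)^* * dil_U P)%B).
{ intros S T h; now rewrite h, conj_comp, conj_adj, eU by exact uW. }
assert (mom : forall T n, ((dil_embed P)^* * (conj_by W T * dil_U P ^ n) * dil_embed P
                        = j^* * (T * N3 ^ n) * j)%B).
{ intros T n; rewrite <- Wj, <- eU, <- conj_pow, <- conj_comp by exact uW; now apply conj_compress. }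
assert (m1 : forall n, (A * P ^ n = j^* * (N1 * N3 ^ n) * j)%B).
{ intros n; generalize (hm 1%nat O n); simpl bpow; now rewrite !bcomp1r. }
assert (m2 : forall n, (B * P ^ n = j^* * (N2 * N3 ^ n) * j)%B).
{ intros n; generalize (hm O 1%nat n); simpl bpow; now rewrite !bcomp1l, !bcomp1r. }
split; [| split; [| exact eU]].
- apply (@dil_R1_unique H A B P F1 F2 G1 G2 _ (conj_by W N2)); auto; intros n; rewrite mom; auto.
(* By definition [dil_R2] is [dil_R1] with A and B, and the indices of the fundamental operators,
   exchanged. *)
- apply (@dil_R1_unique H B A P F2 F1 G2 G1 _ (conj_by W N1)); auto using fundamental_swap;
    intros n; rewrite mom; auto.
Qed.

Theorem theorem14 (H : Hilbert) (A B P : bop H H)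
    (F1 F2 : bop (defect_space P) (defect_space P))
    (G1 G2 : bop (defect_space P^*) (defect_space P^*))
    (hT : tetrablock_contraction A B P)
    (hF : fundamental_operators A B P F1 F2)
    (hG : fundamental_operators A^* B^* P^* G1 G2)
    (hF12 : commutator F1 F2 = 0%B)
    (hFF : commutator F1 F1^* = commutator F2 F2^*) :
  (forall Rt1 Rt2 : bop (dil_space P) (dil_space P),
     tetrablock_unitary_dilation (dil_embed P) A B P Rt1 Rt2 (dil_U P) ->
     Rt1 = dil_R1 P A F1 F2 G1 G2 /\ Rt2 = dil_R2 P B F1 F2 G1 G2) /\
  (forall (Kt : Hilbert) (j : bop H Kt) (Rt1 Rt2 Ut : bop Kt Kt),
     tetrablock_unitary_dilation j A B P Rt1 Rt2 Ut ->
     minimal_unitary_dilation j P Ut ->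
     unitarily_equivalent Rt1 Rt2 Ut
       (dil_R1 P A F1 F2 G1 G2) (dil_R2 P B F1 F2 G1 G2) (dil_U P)).
Proof.
pose proof (tetrablock_contraction_contr hT) as hP.
split.
- intros Rt1 Rt2 h.
  assert (u1 : unitary (1 : bop (dil_space P) (dil_space P))%B).
  { split; rewrite adj_id; apply bcomp1l. }
  destruct (dilation_unique (W := 1%B) hT hF hG (dil_U_unitary hP) h u1) as (e1 & e2 & _).
  + apply bcomp1l.
  + now rewrite bcomp1l, bcomp1r.
  + unfold conj_by in e1, e2; rewrite adj_id, bcomp1l, bcomp1r in e1, e2; now split.
- intros Kt j Rt1 Rt2 Ut h hmin.
  destruct (minimal_dilation_equiv hP hmin) as (W & uW & Wj & WU).
  exists W; split; [exact uW |].
  exact (dilation_unique hT hF hG (proj1 (proj2 hmin)) h uW Wj WU).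
Qed.
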